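(* Let $G$ be a finite group and $k$ a field of characteristic $p>0$. Let $\zeta\in H^n(G,k)$ be a nonzero cohomology class of degree $n\ge 1$, and let $\mathbf{P}(\zeta)$ be the associated chain complex of projective $kG$-modules, which has the homology of an $(n-1)$-sphere and whose $k$-invariant is $\zeta$. Then $\zeta$ is productive if and only if there is a chain map $\Delta:\mathbf{P}(\zeta)\to \mathbf{P}(\zeta)\otimes\mathbf{P}(\zeta)$ which satisfies $(\mathrm{id}\otimes\epsilon)\Delta\simeq \mathrm{id}$ and $(\epsilon\otimes\mathrm{id})\Delta\simeq\mathrm{id}$.
   Context: All modules are finitely generated; chain complexes are complexes of $kG$-modules bounded below. Tensor products are over $k$ with diagonal $G$-action and differential $\partial(x\otimes y)=\partial x\otimes y+(-1)^{\deg x}x\otimes\partial y$. $(\Sigma^m\mathbf{C})_i=\mathbf{C}_{i-m}$ with differential $(-1)^m\partial$. $\simeq$ denotes chain homotopy of chain maps of complexes of $kG$-modules, and $[\mathbf{C},\mathbf{D}]$ is the group of homotopy classes of chain maps. Productive: let $P_*$ be a minimal projective resolution of the trivial module $k$ and $\Omega^n k=\ker(P_{n-1}\to P_{n-2})$ (with $P_{-1}=k$). The class $\zeta$ is represented by a $kG$-homomorphism $\hat\zeta:\Omega^n k\to k$, and $L_\zeta=\ker\hat\zeta$. The class $\zeta$ is called productive if it annihilates $\mathrm{Ext}^*_{kG}(L_\zeta,L_\zeta)$, where $H^*(G,k)=\mathrm{Ext}^*_{kG}(k,k)$ acts by tensoring with $L_\zeta$ (giving a map $H^*(G,k)\to\mathrm{Ext}^*_{kG}(L_\zeta,L_\zeta)$)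 followed by Yoneda product. The complex $\mathbf{P}(\zeta)$: let $\mathbf{P}$ be a projective resolution of $k$ as a $kG$-module (as a positive chain complex) with augmentation $\epsilon:\mathbf{P}\to k$. An extension $0\to\mathbf{A}\to\mathbf{B}\to\mathbf{C}\to 0$ of complexes of projective modules has an extension class in $[\mathbf{C},\Sigma\mathbf{A}]$: choosing degreewise splittings $\mathbf{B}_i=\mathbf{A}_i\oplus\mathbf{C}_i$, one has $\partial^B=\begin{pmatrix}\partial^A&\alpha\\0&\partial^C\end{pmatrix}$, and the class is that of the chain map $\alpha:\mathbf{C}\to\Sigma\mathbf{A}$. $\mathbf{P}(\zeta)$ is the complex in an extension $0\to\Sigma^{n-1}\mathbf{P}\to\mathbf{P}(\zeta)\to\mathbf{P}\to 0$ whose extension class is $\zeta$ under the identification $[\mathbf{P},\Sigma^n\mathbf{P}]=\mathrm{Ext}^n_{kG}(k,k)=H^n(G,k)$. The augmentation $\epsilon:\mathbf{P}(\zeta)\to k$ is the composite $\mathbf{P}(\zeta)\to\mathbf{P}\to k$. The maps $\mathrm{id}\otimes\epsilon,\ \epsilon\otimes\mathrm{id}:\mathbf{P}(\zeta)\otimes\mathbf{P}(\zeta)\to\mathbf{P}(\zeta)$ use $\mathbf{P}(\zeta)\otimes k\cong\mathbf{P}(\zeta)\cong k\otimes\mathbf{P}(\zeta)$. *)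

(* Defs.v *)
From HB Require Import structures.
From mathcomp Require Import all_boot all_order all_algebra all_fingroup.
From mathcomp Require Import mxrepresentation.
From mathcomp.real_closed Require Import mxtens.

Set Implicit Arguments.
Unset Strict Implicit.
Unset Printing Implicit Defensive.

Import GRing.Theory.
Local Open Scope ring_scope.

(* A finitely generated kG-module is a matrix representation of G, acting on
   row vectors.  Linear maps are therefore applied on the right, and the
   composite "first f, then g" is the product f *m g.  Right modules are
   left modules through g |-> g^-1; k-linear tensor products, kernels and Ext
   are unaffected. *)
Record kGmod (k : fieldType) (gT : finGroupType) (G : {group gT}) := KGmod {
  mdim : nat;
  mrep : mx_representation k G mdim }.

Section Modules.

Context {k : fieldType} {gT : finGroupType} {G : {group gT}}.
Implicit Types M N L : kGmod k G.

Local Notation linmap M N := 'M[k]_(mdim M, mdim N).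

Definition is_hom M N (f : linmap M N) : Prop :=
  forall x, x \in G -> mrep M x *m f = f *m mrep N x.

Lemma triv_mx_repr : mx_repr G (fun _ : gT => 1%:M : 'M[k]_1).
Proof. by split=> // x y _ _; rewrite mulmx1. Qed.
Definition triv_mod : kGmod k G := KGmod (MxRepresentation triv_mx_repr).

Lemma zero_mx_repr : mx_repr G (fun _ : gT => 1%:M : 'M[k]_0).
Proof. by split=> // x y _ _; rewrite mulmx1. Qed.
Definition zero_mod : kGmod k G := KGmod (MxRepresentation zero_mx_repr).

Lemma tens_mx_repr M N : mx_repr G (fun x => mrep M x *t mrep N x).
Proof.
split=> [|x y Gx Gy]; last by rewrite !repr_mxM // tensmx_mul.
rewrite !repr_mx1; apply/matrixP=> i j.
case: (mxtens_indexP i) => i0 i1; case: (mxtens_indexP j) => j0 j1.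
rewrite tensmxE !mxE -natrM mulnb (can_eq (@mxtens_indexK _ _)).
by rewrite xpair_eqE.
Qed.
Definition tens_mod M N : kGmod k G := KGmod (MxRepresentation (tens_mx_repr M N)).

Lemma dsum_mx_repr n (M : 'I_n -> kGmod k G) :
  mx_repr G (fun x => \mxdiag_(i < n) mrep (M i) x).
Proof.
split=> [|x y Gx Gy].
  rewrite -(mxdiagZ (p_ := fun i => mdim (M i))).
  by apply: eq_mxdiag => i; rewrite repr_mx1.
rewrite [X in X *m _]/mxdiag mul_mxblock_mxdiag; apply: eq_mxblock => i j.
case: eqVneq => [{j}<-|_]; last by rewrite mul0mx.
by rewrite !conform_mx_id repr_mxM.
Qed.
Definition dsum_mod n (M : 'I_n -> kGmod k G) : kGmod k G :=
  KGmod (MxRepresentation (dsum_mx_repr M)).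

Lemma kermx_mod M N (f : linmap M N) : is_hom f -> mxmodule (mrep M) (kermx f).
Proof.
move=> fH; apply/mxmoduleP => x Gx; apply/sub_kermxP.
by rewrite -mulmxA fH // mulmxA mulmx_ker mul0mx.
Qed.
Definition ker_mod M N (f : linmap M N) (fH : is_hom f) : kGmod k G :=
  KGmod (submod_repr (kermx_mod fH)).

Definition projective M : Prop :=
  forall (A B : kGmod k G) (g : linmap A B) (f : linmap M B),
    is_hom g -> row_full g -> is_hom f ->
    exists2 h : linmap M A, is_hom h & h *m g = f.

(* No proper submodule of M has the same image under f as M; when M is
   projective this says that M -> im f is a projective cover. *)
Definition essential M N (f : linmap M N) : Prop :=
  forall U : 'M[k]_(mdim M),
    mxmodule (mrep M) U -> (f <= U *m f)%MS -> row_full U.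

End Modules.

(* Complexes concentrated in degrees >= 0; diff C i is the differential
   C_{i+1} -> C_i. *)
Record complex (k : fieldType) (gT : finGroupType) (G : {group gT}) := Complex {
  obj :> nat -> kGmod k G;
  diff : forall i, 'M[k]_(mdim (obj i.+1), mdim (obj i));
  diff_hom : forall i, is_hom (diff i);
  diffK : forall i, diff i.+1 *m diff i = 0 }.
Arguments diff {k gT G} _ _.
Arguments diff_hom {k gT G} _ _.
Arguments diffK {k gT G} _ _.

Section Complexes.

Context {k : fieldType} {gT : finGroupType} {G : {group gT}}.
Implicit Types C D : complex k G.
Implicit Types M N L : kGmod k G.

Definition gmap C D := forall i, 'M[k]_(mdim (C i), mdim (D i)).

Definition chain_map C D (f : gmap C D) : Prop :=
  (forall i, is_hom (f i)) /\
  (forall i, f i.+1 *m diff D i = diff C i *m f i).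

Definition homotopic C D (f g : gmap C D) : Prop :=
  exists h : forall i, 'M[k]_(mdim (C i), mdim (D i.+1)),
    [/\ forall i, is_hom (h i),
        f 0%N - g 0%N = h 0%N *m diff D 0
      & forall i, f i.+1 - g i.+1 = h i.+1 *m diff D i.+1 + diff C i *m h i].

Definition gid C : gmap C C := fun i => 1%:M.
Definition gcomp C D E (f : gmap C D) (g : gmap D E) : gmap C E :=
  fun i => f i *m g i.

(* The identity and the differential as families over all pairs of degrees,
   zero where they make no sense; conform_mx only transports along i = j,
   resp. i = j.+1. *)
Definition idfam C i j : 'M[k]_(mdim (C i), mdim (C j)) :=
  if i == j then conform_mx 0 (1%:M : 'M[k]_(mdim (C i))) else 0.

Definition dfam C i j : 'M[k]_(mdim (C i), mdim (C j)) :=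
  if i == j.+1 then conform_mx 0 (diff C j) else 0.

Lemma idfam_id C i : idfam C i i = 1%:M.
Proof. by rewrite /idfam eqxx conform_mx_id. Qed.

Lemma idfam0 C i j : i != j -> idfam C i j = 0.
Proof. by rewrite /idfam => /negPf->. Qed.

Lemma dfamE C i : dfam C i.+1 i = diff C i.
Proof. by rewrite /dfam eqxx conform_mx_id. Qed.

Lemma dfam0 C i j : i != j.+1 -> dfam C i j = 0.
Proof. by rewrite /dfam => /negPf->. Qed.

Lemma idfam_hom C i j : is_hom (idfam C i j).
Proof.
move=> x Gx; case: (eqVneq i j) => [<-|ne].
  by rewrite idfam_id mulmx1 mul1mx.
by rewrite idfam0 // mulmx0 mul0mx.
Qed.

Lemma dfam_hom C i j : is_hom (dfam C i j).
Proof.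
move=> x Gx; case: (eqVneq i j.+1) => [->|ne].
  by rewrite dfamE diff_hom.
by rewrite dfam0 // mulmx0 mul0mx.
Qed.

Lemma dfamK C i j l : dfam C i j *m dfam C j l = 0.
Proof.
case: (eqVneq i j.+1) => [->|ne]; last by rewrite dfam0 // mul0mx.
case: (eqVneq j l.+1) => [->|ne]; last by rewrite [X in _ *m X]dfam0 // mulmx0.
by rewrite !dfamE diffK.
Qed.

(* Suspension: (susp C)_i = C_{i-1} with differential - diff C. *)
Section Susp.
Variable C : complex k G.

Definition susp_obj i := if i is j.+1 then C j else zero_mod.

Definition susp_diff i : 'M[k]_(mdim (susp_obj i.+1), mdim (susp_obj i)) :=
  match i with 0 => 0 | j.+1 => - diff C j end.

Lemma susp_diff_hom i : is_hom (susp_diff i).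
Proof.
case: i => [|i] x Gx /=; first by rewrite mulmx0 mul0mx.
by rewrite mulmxN mulNmx diff_hom.
Qed.

Lemma susp_diffK i : susp_diff i.+1 *m susp_diff i = 0.
Proof.
case: i => [|i] /=; first by rewrite mulmx0.
by rewrite mulmxN mulNmx opprK diffK.
Qed.

Definition susp := Complex susp_diff_hom susp_diffK.
End Susp.

Fixpoint suspn m C : complex k G :=
  if m is m'.+1 then susp (suspn m' C) else C.

(* The identification (suspn m C)_{m+j} = C_j; zero when i != m + j. *)
Fixpoint unsusp m C i j : 'M[k]_(mdim (suspn m C i), mdim (C j)) :=
  match m with
  | 0 => idfam C i j
  | m'.+1 => match i with 0 => 0 | i'.+1 => unsusp m' C i' j end
  end.

(* Tensor product with diagonal action.  The component C_s (x) D_(n+1-s) ->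
   C_t (x) D_(n-t) of the differential is diff (x) id if s = t + 1,
   (-1)^s id (x) diff if s = t, and zero otherwise. *)
Section Tensor.
Variables C D : complex k G.

Definition tens_obj n := dsum_mod (fun s : 'I_n.+1 => tens_mod (C s) (D (n - s)%N)).

Definition tens_comp n s t :
    'M[k]_(mdim (C s) * mdim (D (n.+1 - s)%N), mdim (C t) * mdim (D (n - t)%N)) :=
  dfam C s t *t idfam D (n.+1 - s)%N (n - t)%N
  + (-1) ^+ s *: (idfam C s t *t dfam D (n.+1 - s)%N (n - t)%N).

Definition tens_diff n : 'M[k]_(mdim (tens_obj n.+1), mdim (tens_obj n)) :=
  \mxblock_(s < n.+2, t < n.+1) tens_comp n s t.

Lemma tens_diff_hom n : is_hom (tens_diff n).
Proof.
move=> x Gx; rewrite /= /tens_diff mul_mxdiag_mxblock mul_mxblock_mxdiag.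
apply: eq_mxblock => s t /=; rewrite /tens_comp.
rewrite mulmxDr mulmxDl -!scalemxAr -!scalemxAl !tensmx_mul.
by rewrite !dfam_hom // !idfam_hom.
Qed.

Lemma tens_diffK n : tens_diff n.+1 *m tens_diff n = 0.
Proof.
rewrite /tens_diff mul_mxblock -[RHS]mxblock0; apply: eq_mxblock => s u.
have cross (t : 'I_n.+2) : tens_comp n.+1 s t *m tens_comp n t u =
    (-1) ^+ t *: ((dfam C s t *m idfam C t u)
       *t (idfam D (n.+2 - s)%N (n.+1 - t)%N *m dfam D (n.+1 - t)%N (n - u)%N))
  + (-1) ^+ s *: ((idfam C s t *m dfam C t u)
       *t (dfam D (n.+2 - s)%N (n.+1 - t)%N *m idfam D (n.+1 - t)%N (n - u)%N)).
  rewrite /tens_comp mulmxDl !mulmxDr -!scalemxAr -!scalemxAl.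
  by rewrite !tensmx_mul !dfamK tens0mx tensmx0 !scaler0 add0r addr0.
have [su|nsu] := eqVneq (s : nat) u.+1; last first.
  apply: big1 => t _; rewrite cross.
  have -> : dfam C s t *m idfam C t u = 0.
    case: (eqVneq (t : nat) u) => [->|ne]; last by rewrite idfam0 ?mulmx0.
    by rewrite dfam0 ?mul0mx.
  have -> : idfam C s t *m dfam C t u = 0.
    case: (eqVneq (s : nat) t) => [<-|ne]; last by rewrite idfam0 ?mul0mx.
    by rewrite dfam0 ?mulmx0.
  by rewrite !tens0mx !scaler0 addr0.
have un : (u <= n)%N by rewrite -ltnS.
under eq_bigr do rewrite cross.
rewrite big_split /= (bigD1 (widen_ord (leqnSn _) u)) //=.
rewrite big1 ?addr0; last first.
  move=> t /eqP ne; rewrite [idfam C t u]idfam0 ?mulmx0 ?tens0mx ?scaler0 //.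
  by apply/eqP => e; apply: ne; apply: val_inj.
rewrite (bigD1 (lift ord0 u)) //= big1 ?addr0; last first.
  move=> t /eqP ne; rewrite [idfam C s t]idfam0 ?mul0mx ?tens0mx ?scaler0 //.
  by apply/eqP => e; apply: ne; apply: val_inj; rewrite /= -e su.
rewrite /bump /= add1n su !subSS subSn // !idfam_id !mul1mx !mulmx1.
by rewrite exprS mulN1r scaleNr addrN.
Qed.

Definition tens := Complex tens_diff_hom tens_diffK.

(* An augmentation, extended by zero to all degrees. *)
Definition augfam (E : complex k G) (e : 'M[k]_(mdim (E 0%N), 1)) j : 'M[k]_(mdim (E j), 1) :=
  match j with 0 => e | j'.+1 => 0 end.

(* id (x) e : C (x) D -> C (x) k = C and e (x) id : C (x) D -> k (x) D = D. *)
Definition id_tens_aug (e : 'M[k]_(mdim (D 0%N), 1)) : gmap tens C := fun n =>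
  \mxcol_(s < n.+1) castmx (erefl _, muln1 _)
    (idfam C s n *t augfam e (n - s)%N).

Definition aug_tens_id (e : 'M[k]_(mdim (C 0%N), 1)) : gmap tens D := fun n =>
  \mxcol_(s < n.+1) castmx (erefl _, mul1n _)
    (augfam e s *t idfam D (n - s)%N n).

End Tensor.

Section TensorModule.
Variables (C : complex k G) (L : kGmod k G).

Definition tensm_obj i := tens_mod (C i) L.

Definition tensm_diff i : 'M[k]_(mdim (tensm_obj i.+1), mdim (tensm_obj i)) :=
  diff C i *t (1%:M : 'M[k]_(mdim L)).

Lemma tensm_diff_hom i : is_hom (tensm_diff i).
Proof. by move=> x Gx; rewrite /= !tensmx_mul diff_hom // mulmx1 mul1mx. Qed.

Lemma tensm_diffK i : tensm_diff i.+1 *m tensm_diff i = 0.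
Proof. by rewrite tensmx_mul diffK tens0mx. Qed.

Definition tensm := Complex tensm_diff_hom tensm_diffK.

(* z (x) L : C_m (x) L -> k (x) L = L for z : C_m -> k. *)
Definition tensm_map m (z : 'M[k]_(mdim (C m), 1)) :
    'M[k]_(mdim (tensm m), mdim L) :=
  castmx (erefl _, mul1n _) (z *t (1%:M : 'M[k]_(mdim L))).

End TensorModule.

(* Ext^m(M, N) is H^m(Hom(Q, N)) for a projective resolution Q of M; classes
   are handled through representing cocycles Q_m -> N. *)
Definition cocycle (Q : complex k G) N m (f : 'M[k]_(mdim (Q m), mdim N)) : Prop :=
  is_hom f /\ diff Q m *m f = 0.

Definition coboundary (Q : complex k G) N m :
    'M[k]_(mdim (Q m), mdim N) -> Prop :=
  match m with
  | 0 => fun f => f = 0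
  | m'.+1 => fun f => exists2 h : 'M[k]_(mdim (Q m'), mdim N),
      is_hom h & f = diff Q m' *m h
  end.

(* h represents the Yoneda product g o f in Ext^(m+n)(M, N') of the classes of
   f in Ext^m(M, N) and g in Ext^n(N, N'), where Q resolves M and R resolves N
   with augmentation eta: f is lifted to a chain map F : Q -> Sigma^m R. *)
Definition yoneda (Q R : complex k G) N N' (eta : 'M[k]_(mdim (R 0%N), mdim N))
    m n (f : 'M[k]_(mdim (Q m), mdim N)) (g : 'M[k]_(mdim (R n), mdim N'))
    (h : 'M[k]_(mdim (Q (m + n)%N), mdim N')) : Prop :=
  exists F : gmap Q (suspn m R),
    [/\ chain_map F,
        F m *m unsusp m R m 0 *m eta = f
      & F (m + n)%N *m unsusp m R (m + n)%N n *m g = h].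

End Complexes.

Record resolution (k : fieldType) (gT : finGroupType) (G : {group gT})
    (M : kGmod k G) := Resolution {
  rcomplex :> complex k G;
  aug : 'M[k]_(mdim (rcomplex 0%N), mdim M);
  aug_hom : is_hom aug;
  res_projective : forall i, projective (rcomplex i);
  aug_full : row_full aug;
  aug_exact : (kermx aug == diff rcomplex 0%N)%MS;
  res_exact : forall i, (kermx (diff rcomplex i) == diff rcomplex i.+1)%MS }.
Arguments aug {k gT G M} _.
Arguments aug_hom {k gT G M} _.

Section Productive.

Context {k : fieldType} {gT : finGroupType} {G : {group gT}}.
Local Notation kk := (@triv_mod k gT G).
Implicit Types P Pm : resolution kk.

Definition minimal P : Prop :=
  essential (aug P) /\ forall i, essential (diff P i).

(* omega P n is Omega^(n+1) k = ker (P_n -> P_(n-1)), where P_(-1) = k. *)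
Definition omega P n : kGmod k G :=
  match n with
  | 0 => ker_mod (aug_hom P)
  | n'.+1 => ker_mod (diff_hom P n')
  end.

(* The differential P_(n+1) -> P_n, with codomain restricted to omega P n. *)
Definition to_omega P n : 'M[k]_(mdim (P n.+1), mdim (omega P n)) :=
  match n with
  | 0 => in_submod (kermx (aug P)) (diff P 0%N)
  | n'.+1 => in_submod (kermx (diff P n')) (diff P n'.+1)
  end.

(* The class of the cocycle z : Pm_n -> k annihilates Ext^*(L, L).  The
   complex Pm (x) L is a projective resolution of k (x) L = L, on which
   z (x) L is a cocycle representing the image of z in Ext^n(L, L). *)
Definition annihilates_Ext Pm n (z : 'M[k]_(mdim (Pm n), mdim kk))
    (L : kGmod k G) : Prop :=
  forall m (f : 'M[k]_(mdim (tensm Pm L m), mdim L))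
           (h : 'M[k]_(mdim (tensm Pm L (m + n)%N), mdim L)),
    cocycle (N := L) f ->
    yoneda (N := L) (N' := L) (tensm_map L (aug Pm)) f (tensm_map L z) h ->
    coboundary (N := L) h.

(* zh is the homomorphism Omega^(n+1) k -> k representing z, and
   ker_mod zhH is L_zeta. *)
Definition productive Pm n (z : 'M[k]_(mdim (Pm n.+1), mdim kk)) : Prop :=
  exists (zh : 'M[k]_(mdim (omega Pm n), mdim kk)) (zhH : is_hom zh),
    to_omega Pm n *m zh = z /\ annihilates_Ext z (ker_mod zhH).

(* z on P and z' on P' are cocycles representing the same class of H^m(G, k);
   theta is a comparison map of resolutions. *)
Definition same_class P P' m (z : 'M[k]_(mdim (P m), mdim kk))
    (z' : 'M[k]_(mdim (P' m), mdim kk)) : Prop :=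
  exists theta : gmap P P',
    [/\ chain_map theta, theta 0%N *m aug P' = aug P
      & coboundary (N := kk) (z - theta m *m z')].

(* The cocycle P_m -> k corresponding to a chain map P -> Sigma^m P. *)
Definition cocycle_of P m (alpha : gmap P (suspn m P)) :
    'M[k]_(mdim (P m), mdim kk) :=
  alpha m *m unsusp m P m 0 *m aug P.

Definition short_exact (A B C : complex k G) (i : gmap A B) (q : gmap B C) : Prop :=
  [/\ chain_map i, chain_map q
    & forall j, [/\ row_free (i j), row_full (q j)
                  & (kermx (q j) == i j)%MS]].

(* alpha : C -> Sigma A is the chain map attached to some degreewise splitting
   s of the extension.  (In degree 0 the target of alpha is zero.) *)
Definition extension_map (A B C : complex k G) (i : gmap A B) (q : gmap B C)
    (alpha : gmap C (susp A)) : Prop :=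
  exists s : gmap C B,
    (forall j, is_hom (s j) /\ s j *m q j = 1%:M) /\
    (forall j, s j.+1 *m diff B j =
       diff C j *m s j + (alpha j.+1 : 'M_(mdim (C j.+1), mdim (A j))) *m i j).

(* B is the complex P(zeta), where zeta is the class of z in H^(n+1)(G, k),
   in an extension 0 -> Sigma^n P -> B -> P -> 0. *)
Definition is_Pzeta P Pm n (z : 'M[k]_(mdim (Pm n.+1), mdim kk))
    (B : complex k G) (i : gmap (suspn n P) B) (q : gmap B P) : Prop :=
  short_exact i q /\
  exists alpha : gmap P (suspn n.+1 P),
    [/\ chain_map alpha, extension_map i q alpha
      & same_class (cocycle_of alpha) z].

End Productive.

(* Main.v *)
Require Import Defs.
From HB Require Import structures.
From mathcomp Require Import all_boot all_order all_algebra all_fingroup.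
From mathcomp Require Import mxrepresentation.
From mathcomp.real_closed Require Import mxtens.
From mathcomp Require Import ring zify.
From Stdlib Require ClassicalEpsilon.

Set Implicit Arguments.
Unset Strict Implicit.
Unset Printing Implicit Defensive.

Import GRing.Theory.
Local Open Scope ring_scope.

(** Let [N = n + 1], let [y : P_N -> k] be the cocycle attached to the extension
    [0 -> Sigma^n P -> B -> P -> 0], and say that zeta kills a complex [C] if the chain
    map [y (x) C : P (x) C -> Sigma^N C] is null-homotopic ([kills]).  As
    [P (x) C -> C] is a quasi-isomorphism from a complex of projectives, this means that
    the map [C -> Sigma^N C] induced by zeta vanishes in the derived category; in
    particular it only depends on [C] up to quasi-isomorphism ([kills_qis]).  The theorem
    holds because both of its sides say that zeta kills [B].

    Productivity says that zeta kills the module [L = L_zeta]: the identity class of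
    [Ext^0(L, L)] has to be annihilated, and this suffices ([annihilates_ExtP]).
    Replacing the minimal resolution by [P] is harmless ([tensm_coboundary]).

    To pass from [L] to [B], let [V] be the complex [L -> Pm_n -> ... -> Pm_0].  Both [B]
    and [V] are models of the homotopy fibre of zeta, seen as a map from [k] to
    [Sigma^N k], and there is an explicit quasi-isomorphism [B -> V] ([comparison]), so
    zeta kills [B] if and only if it kills [V].  The
    quotient of [V] by the complex [X] of its terms of degree at most [n] is [Sigma^N L].
    If zeta kills [L], then [P (x) V -> Sigma^N V] is null-homotopic in high degrees, and
    the homotopy extends to all degrees because the terms of [X], being projective, are
    injective, while [V] is exact above degree [n] ([splice_kills]).  Conversely, a
    null-homotopy for [V] can be made to vanish on [P (x) X] in the degree [2 n + 1] that
    matters for [L], because [P (x) X] is homotopy equivalent to [X], which vanishes there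
    ([kills_splice]).

    For the comultiplication, tensor the extension with [B].  The left counit condition
    asks for a section up to homotopy of [B (x) B -> P (x) B -> B]; the second map is an
    equivalence and the obstruction to splitting the first is the class of [y (x) B]
    ([kills_counit], [counit_kills]).  So zeta kills [B] if and only if there is a
    [Delta] with a left counit.  The right counit is then free ([two_sided_counit]): if
    [e] is the augmentation and [phi = (1 (x) e) Delta - 1], then [e phi = 0], and
    subtracting from [Delta] its composite with [x (x) y |-> +- phi y (x) x] repairs the
    right counit without changing the left one. *)

(** * Products with linear forms, averaging and projectivity *)

Ltac mx_abel := apply/matrixP => ? ?; rewrite !mxE; ring.

Lemma no_rows (k : fieldType) m n (A B : 'M[k]_(m, n)) : m = 0%N -> A = B.
Proof. by move=> m0; move: A B; rewrite m0 => A B; apply/matrixP => - []. Qed.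

Lemma no_cols (k : fieldType) m n (A B : 'M[k]_(m, n)) : n = 0%N -> A = B.
Proof. by move=> m0; move: A B; rewrite m0 => A B; apply/matrixP => ? []. Qed.

Section TensorWithColumn.
Variable k : fieldType.

(** The map [a (x) f] for a linear form [a], with [k (x) N] identified with [N]. *)
Definition ftens m r s (A : 'M[k]_(m, 1)) (X : 'M[k]_(r, s)) : 'M[k]_(m * r, s) :=
  castmx (erefl _, mul1n _) (A *t X).
Definition tensf m r s (X : 'M[k]_(r, s)) (A : 'M[k]_(m, 1)) : 'M[k]_(r * m, s) :=
  castmx (erefl _, muln1 _) (X *t A).

Lemma ftensE m r s (A : 'M[k]_(m, 1)) (X : 'M[k]_(r, s)) i j l :
  ftens A X (mxtens_index (i, j)) l = A i 0 * X j l.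
Proof.
rewrite /ftens castmxE /= cast_ord_id.
rewrite (_ : cast_ord _ l = mxtens_index (0 : 'I_1, l)) ?tensmxE //.
by apply: val_inj; rewrite /= mul0n.
Qed.

Lemma tensfE m r s (A : 'M[k]_(m, 1)) (X : 'M[k]_(r, s)) i j l :
  tensf X A (mxtens_index (i, j)) l = X i l * A j 0.
Proof.
rewrite /tensf castmxE /= cast_ord_id.
rewrite (_ : cast_ord _ l = mxtens_index (l, 0 : 'I_1)) ?tensmxE //.
by apply: val_inj; rewrite /= muln1 addn0.
Qed.

Lemma castmx_mulr m n p p' (e : p = p') (A : 'M[k]_(m, n)) (B : 'M[k]_(n, p)) :
  A *m castmx (erefl _, e) B = castmx (erefl _, e) (A *m B).
Proof. by case: p' / e. Qed.

Lemma tens_ftens m' m r' r s (A' : 'M[k]_(m', m)) (Y : 'M[k]_(r', r))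
    (A : 'M[k]_(m, 1)) (X : 'M[k]_(r, s)) :
  (A' *t Y) *m ftens A X = ftens (A' *m A) (Y *m X).
Proof. by rewrite /ftens castmx_mulr tensmx_mul. Qed.

Lemma tens_tensf m' m r' r s (A' : 'M[k]_(m', m)) (Y : 'M[k]_(r', r))
    (A : 'M[k]_(m, 1)) (X : 'M[k]_(r, s)) :
  (Y *t A') *m tensf X A = tensf (Y *m X) (A' *m A).
Proof. by rewrite /tensf castmx_mulr tensmx_mul. Qed.

Lemma ftens_mul m r s u (A : 'M[k]_(m, 1)) (X : 'M[k]_(r, s)) (Z : 'M[k]_(s, u)) :
  ftens A X *m Z = ftens A (X *m Z).
Proof.
apply/matrixP => i l; case: (mxtens_indexP i) => a b.
rewrite ftensE !mxE big_distrr /=; apply: eq_bigr => j _.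
by rewrite ftensE mulrA.
Qed.

Lemma tensf_mul m r s u (A : 'M[k]_(m, 1)) (X : 'M[k]_(r, s)) (Z : 'M[k]_(s, u)) :
  tensf X A *m Z = tensf (X *m Z) A.
Proof.
apply/matrixP => i l; case: (mxtens_indexP i) => a b.
rewrite tensfE !mxE big_distrl /=; apply: eq_bigr => j _.
by rewrite tensfE mulrAC.
Qed.

Lemma ftensDl m r s (A A' : 'M[k]_(m, 1)) (X : 'M[k]_(r, s)) :
  ftens (A + A') X = ftens A X + ftens A' X.
Proof.
apply/matrixP => i l; case: (mxtens_indexP i) => a b.
by rewrite [RHS]mxE !ftensE mxE mulrDl.
Qed.

Lemma ftensZr m r s c (A : 'M[k]_(m, 1)) (X : 'M[k]_(r, s)) :
  ftens A (c *: X) = c *: ftens A X.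
Proof.
apply/matrixP => i l; case: (mxtens_indexP i) => a b.
by rewrite [RHS]mxE !ftensE mxE mulrCA.
Qed.

Lemma ftens0l m r s (X : 'M[k]_(r, s)) : ftens (0 : 'M[k]_(m, 1)) X = 0.
Proof.
apply/matrixP => i l; case: (mxtens_indexP i) => a b.
by rewrite ftensE !mxE mul0r.
Qed.

Lemma ftens0r m r s (A : 'M[k]_(m, 1)) : ftens A (0 : 'M[k]_(r, s)) = 0.
Proof.
apply/matrixP => i l; case: (mxtens_indexP i) => a b.
by rewrite ftensE !mxE mulr0.
Qed.

Lemma tensf0l m r s (A : 'M[k]_(m, 1)) : tensf (0 : 'M[k]_(r, s)) A = 0.
Proof.
apply/matrixP => i l; case: (mxtens_indexP i) => a b.
by rewrite tensfE !mxE mul0r.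
Qed.

Lemma tensf0r m r s (X : 'M[k]_(r, s)) : tensf X (0 : 'M[k]_(m, 1)) = 0.
Proof.
apply/matrixP => i l; case: (mxtens_indexP i) => a b.
by rewrite tensfE !mxE mulr0.
Qed.

(** The matrix of the flip [x (x) y |-> y (x) x]. *)
Definition flipmx m r : 'M[k]_(m * r, r * m) :=
  \matrix_(i, j) ((mxtens_unindex i == ((mxtens_unindex j).2, (mxtens_unindex j).1))%:R).

Lemma tens_flipmx m m' r r' (A : 'M[k]_(m, m')) (B : 'M[k]_(r, r')) :
  (A *t B) *m flipmx m' r' = flipmx m r *m (B *t A).
Proof.
apply/matrixP => i j; case: (mxtens_indexP i) => a b; case: (mxtens_indexP j) => c d.
rewrite !mxE (bigD1 (mxtens_index (d, c))) //= big1 => [|l nl]; last first.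
  case: (mxtens_indexP l) nl => l1 l2 nl.
  rewrite [flipmx _ _ _ _]mxE !mxtens_indexK /=.
  rewrite (_ : ((l1, l2) == (d, c)) = false) ?mulr0 //.
  by apply: contraNF nl => /eqP->.
rewrite addr0 tensmxE [flipmx _ _ _ _]mxE !mxtens_indexK eqxx mulr1.
rewrite (bigD1 (mxtens_index (b, a))) //= big1 => [|l nl]; last first.
  case: (mxtens_indexP l) nl => l1 l2 nl.
  rewrite [flipmx _ _ _ _]mxE !mxtens_indexK /=.
  rewrite (_ : ((a, b) == (l2, l1)) = false) ?mul0r //.
  by apply: contraNF nl => /eqP[-> ->].
by rewrite addr0 tensmxE [flipmx _ _ _ _]mxE !mxtens_indexK eqxx mul1r mulrC.
Qed.

Lemma flipmx_tensf m r s (A : 'M[k]_(m, 1)) (X : 'M[k]_(r, s)) :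
  flipmx m r *m tensf X A = ftens A X.
Proof.
apply/matrixP => i j; case: (mxtens_indexP i) => a b.
rewrite !mxE (bigD1 (mxtens_index (b, a))) //= big1 => [|l nl]; last first.
  case: (mxtens_indexP l) nl => l1 l2 nl.
  rewrite [flipmx _ _ _ _]mxE !mxtens_indexK /=.
  rewrite (_ : ((a, b) == (l2, l1)) = false) ?mul0r //.
  by apply: contraNF nl => /eqP[-> ->].
by rewrite addr0 [flipmx _ _ _ _]mxE !mxtens_indexK eqxx mul1r tensfE ftensE mulrC.
Qed.

Lemma flipmx_ftens m r s (A : 'M[k]_(m, 1)) (X : 'M[k]_(r, s)) :
  flipmx r m *m ftens A X = tensf X A.
Proof.
apply/matrixP => i j; case: (mxtens_indexP i) => a b.
rewrite !mxE (bigD1 (mxtens_index (b, a))) //= big1 => [|l nl]; last first.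
  case: (mxtens_indexP l) nl => l1 l2 nl.
  rewrite [flipmx _ _ _ _]mxE !mxtens_indexK /=.
  rewrite (_ : ((a, b) == (l2, l1)) = false) ?mul0r //.
  by apply: contraNF nl => /eqP[-> ->].
by rewrite addr0 [flipmx _ _ _ _]mxE !mxtens_indexK eqxx mul1r tensfE ftensE mulrC.
Qed.

Lemma tensDl m n p q (A A' : 'M[k]_(m, n)) (B : 'M[k]_(p, q)) :
  (A + A') *t B = A *t B + A' *t B.
Proof. by apply/matrixP => i j; rewrite !mxE mulrDl. Qed.

Lemma tens11 m n : (1%:M : 'M[k]_m) *t (1%:M : 'M[k]_n) = 1%:M.
Proof.
apply/matrixP=> i j.
case: (mxtens_indexP i) => i0 i1; case: (mxtens_indexP j) => j0 j1.
rewrite tensmxE !mxE -natrM mulnb (can_eq (@mxtens_indexK _ _)).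
by rewrite xpair_eqE.
Qed.

Lemma tensNl m n p q (A : 'M[k]_(m, n)) (B : 'M[k]_(p, q)) : (- A) *t B = - (A *t B).
Proof. by apply/matrixP => i j; rewrite !mxE mulNr. Qed.

(** The map [x |-> a (x) x] for a fixed vector [a]. *)
Definition vtens m r (a : 'M[k]_(1, m)) : 'M[k]_(r, m * r) :=
  \matrix_(i, j) (a 0 (mxtens_unindex j).1 * (i == (mxtens_unindex j).2)%:R).

Lemma vtensE m r (a : 'M[k]_(1, m)) (i : 'I_r) j l :
  vtens r a i (mxtens_index (j, l)) = a 0 j * (i == l)%:R.
Proof. by rewrite mxE mxtens_indexK. Qed.

Lemma ftens_vtens m r (w : 'M[k]_(m, 1)) (a : 'M[k]_(1, m)) :
  ftens w (vtens r a) = (w *m a) *t 1%:M.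
Proof.
apply/matrixP => i j; case: (mxtens_indexP i) => i1 i2.
case: (mxtens_indexP j) => j1 j2; rewrite ftensE vtensE tensmxE !mxE.
by rewrite big_ord1 mulrA.
Qed.

Lemma vtens_ftens m r s (w : 'M[k]_(m, 1)) (a : 'M[k]_(1, m)) (X : 'M[k]_(r, s)) :
  a *m w = 1%:M -> vtens r a *m ftens w X = X.
Proof.
move=> /matrixP/(_ 0 0); rewrite !mxE eqxx => aw.
apply/matrixP => i j; rewrite !mxE.
rewrite (reindex (@mxtens_index _ _)) /=; last first.
  by exists (@mxtens_unindex _ _) => l _; rewrite ?mxtens_indexK ?mxtens_unindexK.
transitivity (\sum_c \sum_d (a 0 c * w c 0) * ((i == d)%:R * X d j)).
  rewrite pair_bigA /=; apply: eq_bigr => -[c d] _ /=.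
  by rewrite ftensE vtensE; ring.
rewrite exchange_big /= (bigD1 i) //= [X in _ + X]big1 => [|d nd]; last first.
  by apply: big1 => c _; rewrite eq_sym (negPf nd) mul0r mulr0.
by rewrite addr0 -mulr_suml aw eqxx !mul1r.
Qed.

End TensorWithColumn.

Section Homs.
Context {k : fieldType} {gT : finGroupType} {G : {group gT}}.
Implicit Types M N L U : kGmod k G.
Local Notation linmap M N := 'M[k]_(mdim M, mdim N).

Lemma hom_mul M N L (f : linmap M N) (g : linmap N L) :
  is_hom f -> is_hom g -> is_hom (M := M) (N := L) (f *m g).
Proof. by move=> fH gH x Gx; rewrite mulmxA fH // -!mulmxA gH. Qed.

Lemma hom_add M N (f g : linmap M N) : is_hom f -> is_hom g -> is_hom (f + g).
Proof. by move=> fH gH x Gx; rewrite mulmxDr mulmxDl fH // gH. Qed.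

Lemma hom_opp M N (f : linmap M N) : is_hom f -> is_hom (- f).
Proof. by move=> fH x Gx; rewrite mulmxN mulNmx fH. Qed.

Lemma hom_sub M N (f g : linmap M N) : is_hom f -> is_hom g -> is_hom (f - g).
Proof. by move=> fH gH; apply: hom_add => //; apply: hom_opp. Qed.

Lemma hom_scale M N c (f : linmap M N) : is_hom f -> is_hom (c *: f).
Proof. by move=> fH x Gx; rewrite -scalemxAr -scalemxAl fH. Qed.

Lemma hom0 M N : is_hom (0 : linmap M N).
Proof. by move=> x Gx; rewrite mulmx0 mul0mx. Qed.

Lemma hom1 M : is_hom (M := M) (N := M) 1%:M.
Proof. by move=> x Gx; rewrite mulmx1 mul1mx. Qed.

Lemma hom_tens M N M' N' (f : linmap M M') (g : linmap N N') :
  is_hom f -> is_hom g ->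
  is_hom (M := tens_mod M N) (N := tens_mod M' N') (f *t g).
Proof. by move=> fH gH x Gx; rewrite /= !tensmx_mul fH // gH. Qed.

Lemma hom_ftens M N L (a : linmap M (@triv_mod k gT G)) (g : linmap N L) :
  is_hom a -> is_hom g -> is_hom (M := tens_mod M N) (N := L) (ftens a g).
Proof.
move=> aH gH x Gx; rewrite /= tens_ftens ftens_mul (gH x Gx) (aH x Gx).
by rewrite /= mulmx1.
Qed.

Lemma hom_flip M N :
  is_hom (M := tens_mod M N) (N := tens_mod N M) (flipmx k (mdim M) (mdim N)).
Proof. by move=> x Gx; rewrite /= tens_flipmx. Qed.

Lemma hom_cancel_free M N L (f : linmap M N) (g : linmap N L) :
  row_free g -> is_hom g -> is_hom (M := M) (N := L) (f *m g) -> is_hom f.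
Proof.
move=> gF gH fgH x Gx; apply: (row_free_inj gF) => /=.
by rewrite -[RHS]mulmxA (gH x Gx) mulmxA -[LHS]mulmxA; apply: fgH.
Qed.

Lemma hom_cancel_full M N L (f : linmap M N) (g : linmap N L) :
  row_full f -> is_hom f -> is_hom (M := M) (N := L) (f *m g) -> is_hom g.
Proof.
move=> fF fH fgH x Gx; apply: (row_full_inj fF) => /=.
by rewrite mulmxA [LHS]mulmxA -(fH x Gx) -[LHS]mulmxA; apply: fgH.
Qed.

(** The trace from the trivial subgroup to [G] on [Hom_k(M, N)]. *)
Definition avg M N (f : linmap M N) : linmap M N :=
  \sum_(x in G) mrep M x^-1%g *m f *m mrep N x.

Lemma avg_hom M N (f : linmap M N) : is_hom (avg f).
Proof.
move=> y Gy; rewrite /avg mulmx_sumr mulmx_suml.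
rewrite (reindex_inj (mulIg y)) /=; apply: eq_big => [x|x Gx].
  by rewrite groupMr.
rewrite groupMr // in Gx.
rewrite invMg !mulmxA -repr_mxM ?groupM ?groupV // mulgA mulgV mul1g.
by rewrite -!mulmxA repr_mxM.
Qed.

Lemma avg_mulr M N L (f : linmap M N) (g : linmap N L) :
  is_hom g -> avg (f *m g : linmap M L) = avg f *m g.
Proof.
by move=> gH; rewrite /avg mulmx_suml; apply: eq_bigr => x Gx; rewrite -!mulmxA gH.
Qed.

Lemma avg_mull M N L (f : linmap M N) (g : linmap N L) :
  is_hom f -> avg (f *m g : linmap M L) = f *m avg g.
Proof.
move=> gH; rewrite /avg mulmx_sumr; apply: eq_bigr => x Gx.
by rewrite !mulmxA gH // groupV.
Qed.

(** Higman's criterion.  Unlike projectivity it is symmetric under duality, and a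
    [k]-linear solution [c] of a lifting or extension problem becomes [G]-equivariant when
    [t c] or [c t] is averaged. *)
Definition higman M := exists t : linmap M M, avg t = 1%:M.

(** Two unknowns [g] and [h] are treated at once because the problem comes from the
    mapping cone of a chain map, whose terms are direct sums. *)
Lemma higman_lift2 Q M M' N N' (fM : linmap Q M) (fN : linmap Q N)
    (a : linmap M' M) (b : linmap M' N) (c : linmap N' N)
    (g : linmap Q M') (h : linmap Q N') :
  higman Q -> is_hom fM -> is_hom fN -> is_hom a -> is_hom b -> is_hom c ->
  fM = g *m a -> fN = g *m b + h *m c ->
  exists g' : linmap Q M', exists h' : linmap Q N',
   [/\ is_hom g', is_hom h', fM = g' *m a & fN = g' *m b + h' *m c].
Proof.
case=> t tE fMH fNH aH bH cH EM EN.
exists (avg (t *m g)), (avg (t *m h)); split; try exact: avg_hom.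
  by rewrite -avg_mulr // -mulmxA -EM avg_mulr // tE mul1mx.
rewrite -!avg_mulr // -!mulmxA.
have -> : forall u v : linmap Q N, avg u + avg v = avg (u + v).
  move=> u v; rewrite /avg -big_split /=; apply: eq_bigr => x _.
  by rewrite mulmxDr mulmxDl.
by rewrite -mulmxDr -EN avg_mulr // tE mul1mx.
Qed.

Lemma higman_lift Q M N (f : linmap Q N) (d : linmap M N) :
  higman Q -> is_hom f -> is_hom d -> (f <= d)%MS ->
  exists2 h : linmap Q M, is_hom h & h *m d = f.
Proof.
case=> t tE fH dH /submxP[c Ec]; exists (avg (t *m c)); first exact: avg_hom.
by rewrite -avg_mulr // -mulmxA -Ec avg_mulr // tE mul1mx.
Qed.

(** Injectivity of projectives: a [k]-linear extension exists, and averaging its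
    composite with [t] makes it equivariant. *)
Lemma higman_extend Q U W (f : linmap U Q) (d : linmap U W) :
  higman Q -> is_hom f -> is_hom d -> (kermx d <= kermx f)%MS ->
  exists2 h : linmap W Q, is_hom h & d *m h = f.
Proof.
case=> t tE fH dH kdf.
have Ef : d *m (pinvmx d *m f) = f.
  apply/eqP; rewrite mulmxA -subr_eq0 -{2}[f]mul1mx -mulmxBl; apply/eqP.
  apply/sub_kermxP; apply: submx_trans kdf; apply/sub_kermxP.
  by rewrite mulmxBl mul1mx mulmxKpV ?submx_refl // subrr.
exists (avg (pinvmx d *m f *m t)); first exact: avg_hom.
by rewrite -avg_mull // mulmxA Ef avg_mull // tE mulmx1.
Qed.

Definition reg_mod : kGmod k G := KGmod (regular_repr k G).

Let onescol : linmap reg_mod (@triv_mod k gT G) := const_mx 1.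

Lemma reg_onescol x : x \in G -> mrep reg_mod x *m onescol = onescol.
Proof.
move=> Gx; apply/matrixP => i j; rewrite !mxE (bigD1 (gring_index G (enum_val i * x)))//=.
rewrite !mxE eqxx !eqxx /= mulr1 big1 ?addr0 // => l /negPf nl.
by rewrite !mxE nl andbF mul0r.
Qed.

Let onecol : linmap reg_mod (@triv_mod k gT G) := delta_mx (gring_index G 1) 0.

Lemma sum_reg_onecol : \sum_(x in G) mrep reg_mod x^-1%g *m onecol = onescol.
Proof.
apply/matrixP => i j; rewrite summxE !mxE.
have Gi : enum_val i \in G := enum_valP i.
have E x : x \in G -> (mrep reg_mod x^-1%g *m onecol) i j = (x == enum_val i)%:R.
  move=> Gx; rewrite mxE (bigD1 (gring_index G 1%g)) //= big1 => [|l nl].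
    rewrite !mxE !eqxx /= [j]ord1 eqxx mulr1 addr0; congr (nat_of_bool _)%:R.
    rewrite -(inj_eq (can_inj (@gring_valK gT G))) !gring_indexK ?groupM ?groupV //.
    by rewrite eq_sym -eq_mulgV1 eq_sym.
  by rewrite [onecol _ _]mxE (negPf nl) mulr0.
rewrite (bigD1 (enum_val i)) //= E // eqxx big1 ?addr0 // => x /andP[Gx /negPf nx].
by rewrite E // nx.
Qed.

(** [M] is a direct summand of [M (x) kG], where the coefficient at [1] has for trace
    the sum of all coefficients, which is the projection onto [M]. *)
Lemma projective_higman M : projective M -> higman M.
Proof.
pose g : linmap (tens_mod M reg_mod) M := tensf 1%:M onescol.
have gH : is_hom g.
  move=> x Gx; rewrite /g /= tens_tensf tensf_mul mul1mx mulmx1; congr tensf.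
  exact: reg_onescol.
have gE : tensf 1%:M onecol *m 1%:M = tensf (1%:M : linmap M M) onecol by rewrite mulmx1.
have gF : row_full g.
  apply/row_fullP; exists (castmx (muln1 _, erefl _)
     ((1%:M : linmap M M) *t delta_mx (0 : 'I_1) (gring_index G 1%g))).
  apply/matrixP => i j; rewrite !mxE.
  rewrite (bigD1 (mxtens_index (i, gring_index G 1%g))) //= big1 => [|l nl].
    rewrite addr0 /g tensfE castmxE /= cast_ord_id.
    rewrite (_ : cast_ord _ i = mxtens_index (i, 0 : 'I_1)) ?tensmxE; last first.
      by apply: val_inj; rewrite /= muln1 addn0.
    by rewrite !mxE !eqxx !mulr1 mul1r.
  case: (mxtens_indexP l) nl => a b nl.
  rewrite castmxE /= cast_ord_id (_ : cast_ord _ i = mxtens_index (i, 0 : 'I_1)).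
    rewrite tensmxE !mxE; case: eqP => [ia|]; last by rewrite !mul0r.
    rewrite eqxx /=; case: eqP => [ib|]; last by rewrite mulr0 mul0r.
    by case/eqP: nl; rewrite -ia ib.
  by apply: val_inj; rewrite /= muln1 addn0.
move=> /(_ _ _ g 1%:M gH gF (hom1 _))[h hH hg].
exists (h *m (tensf 1%:M onecol : linmap (tens_mod M reg_mod) M)).
rewrite avg_mull // -[RHS]hg; congr (_ *m _); rewrite /avg.
transitivity (\sum_(x in G) tensf (1%:M : linmap M M) (mrep reg_mod x^-1%g *m onecol)).
  apply: eq_bigr => x Gx; rewrite /= tens_tensf tensf_mul mulmx1 -repr_mxM ?groupV //.
  by rewrite mulVg repr_mx1.
rewrite /g -sum_reg_onecol; apply/matrixP => i j; rewrite summxE.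
case: (mxtens_indexP i) => a b; rewrite tensfE summxE big_distrr /=.
by apply: eq_bigr => x _; rewrite tensfE.
Qed.

Lemma avgD M N (f g : 'M_(mdim M, mdim N)) : avg (f + g) = avg f + avg g.
Proof.
rewrite /avg -big_split /=; apply: eq_bigr => x _.
by rewrite mulmxDr mulmxDl.
Qed.

Lemma higman_empty M : mdim M = 0%N -> higman M.
Proof. by move=> M0; exists 0; apply: no_rows. Qed.

Lemma higman_tens M N : higman M -> higman (tens_mod M N).
Proof.
case=> t tE; exists (t *t 1%:M).
rewrite /avg; transitivity (avg t *t (1%:M : linmap N N)); last first.
  by rewrite tE tens11.
transitivity (\sum_(x in G) (mrep M x^-1%g *m t *m mrep M x) *t (1%:M : linmap N N)).
  apply: eq_bigr => x Gx; rewrite /= !tensmx_mul mulmx1 -repr_mxM ?groupV //.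
  by rewrite mulVg repr_mx1.
apply/matrixP => i j; case: (mxtens_indexP i) => i1 i2.
case: (mxtens_indexP j) => j1 j2; rewrite tensmxE !summxE big_distrl /=.
by apply: eq_bigr => x _; rewrite tensmxE.
Qed.

Lemma higman_zero : higman (@zero_mod k gT G).
Proof. by exists 0; apply/matrixP => - []. Qed.

Lemma mul_mxdiag n (p : 'I_n -> nat) (A B : forall i, 'M[k]_(p i)) :
  (\mxdiag_i A i) *m (\mxdiag_i B i) = \mxdiag_i (A i *m B i).
Proof.
rewrite [X in X *m _]/mxdiag mul_mxblock_mxdiag; apply: eq_mxblock => i j.
case: eqVneq => [{j}<-|_]; last by rewrite mul0mx.
by rewrite !conform_mx_id.
Qed.

Lemma higman_dsum n (M : 'I_n -> kGmod k G) :
  (forall i, higman (M i)) -> higman (dsum_mod M).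
Proof.
move=> /fin_all_exists[t tE]; exists (\mxdiag_i t i).
transitivity (\mxdiag_i avg (t i)); last first.
  by rewrite -(mxdiagZ (p_ := fun i => mdim (M i))); apply: eq_mxdiag.
rewrite /avg mxdiag_sum; apply: eq_bigr => x Gx.
by rewrite /= !mul_mxdiag.
Qed.
End Homs.

(** * Chain homotopies, quasi-isomorphisms and suspensions *)

Lemma dependent_choice (T : nat -> Type) (I : forall j, T j -> Prop)
    (R : forall j, T j -> T j.+1 -> Prop) :
  (exists x, I 0%N x) ->
  (forall j x, I j x -> exists y, I j.+1 y /\ R j x y) ->
  exists s : forall j, T j, (forall j, I j (s j)) /\ (forall j, R j (s j) (s j.+1)).
Proof.
move=> /ClassicalEpsilon.constructive_indefinite_description[x0 I0] step.
pose next j (x : {x | I j x}) : {y | I j.+1 y /\ R j (sval x) y} :=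
  ClassicalEpsilon.constructive_indefinite_description _ (step j _ (svalP x)).
pose s := fix s j : {x | I j x} := match j with
  | 0 => exist _ x0 I0
  | j'.+1 => exist _ (sval (next j' (s j'))) (proj1 (svalP (next j' (s j')))) end.
exists (fun j => sval (s j)); split=> j; first exact: svalP.
exact: proj2 (svalP (next j (s j))).
Qed.

Section Homotopy.
Context {k : fieldType} {gT : finGroupType} {G : {group gT}}.
Implicit Types C D E Q : complex k G.

Definition gzero C D : gmap C D := fun i => 0.
Definition gsub C D (f g : gmap C D) : gmap C D := fun i => f i - g i.

Lemma chain_comp C D E (f : gmap C D) (g : gmap D E) :
  chain_map f -> chain_map g -> chain_map (gcomp f g).
Proof.
move=> [fH fd] [gH gd]; split=> i; first exact: hom_mul.
by rewrite /gcomp -mulmxA gd !mulmxA fd.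
Qed.

Lemma chain_id C : chain_map (gid C).
Proof. by split=> i; [apply: hom1 | rewrite /gid mul1mx mulmx1]. Qed.

Lemma chain_sub C D (f g : gmap C D) :
  chain_map f -> chain_map g -> chain_map (gsub f g).
Proof.
move=> [fH fd] [gH gd]; split=> i; first exact: hom_sub.
by rewrite /gsub mulmxBl mulmxBr fd gd.
Qed.

Lemma homotopic_eq C D (f g : gmap C D) : (forall i, f i = g i) -> homotopic f g.
Proof.
move=> fg; exists (fun i => 0); split=> *; first exact: hom0.
  by rewrite fg subrr mul0mx.
by rewrite fg subrr mul0mx mulmx0 addr0.
Qed.

Lemma homotopic_sym C D (f g : gmap C D) : homotopic f g -> homotopic g f.
Proof.
case=> h [hH h0 hS]; exists (fun i => - h i); split=> [i||i].
- exact: hom_opp.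
- by rewrite mulNmx -h0 opprB.
- by rewrite mulNmx mulmxN -opprD -hS opprB.
Qed.

Lemma homotopic_trans C D (f g h : gmap C D) :
  homotopic f g -> homotopic g h -> homotopic f h.
Proof.
move=> [s [sH s0 sS]] [t [tH t0 tS]]; exists (fun i => s i + t i).
split=> [i||i]; first exact: hom_add.
  by rewrite mulmxDl -s0 -t0 addrA subrK.
by rewrite mulmxDl mulmxDr addrACA -sS -tS addrA subrK.
Qed.

Lemma homotopic_compl C D E (u : gmap C D) (f g : gmap D E) :
  chain_map u -> homotopic f g -> homotopic (gcomp u f) (gcomp u g).
Proof.
move=> [uH ud] [h [hH h0 hS]]; exists (fun i => u i *m h i).
split=> [i||i]; rewrite /gcomp -?mulmxBr; first exact: hom_mul.
  by rewrite h0 mulmxA.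
by rewrite hS mulmxDr !mulmxA ud.
Qed.

Lemma homotopic_compr C D E (f g : gmap C D) (u : gmap D E) :
  chain_map u -> homotopic f g -> homotopic (gcomp f u) (gcomp g u).
Proof.
move=> [uH ud] [h [hH h0 hS]]; exists (fun i => h i *m u i.+1).
split=> [i||i]; rewrite /gcomp -?mulmxBl; first exact: hom_mul.
  by rewrite h0 -!mulmxA ud.
by rewrite hS mulmxDl -!mulmxA ud.
Qed.

Lemma homotopic_sub C D (f g f' g' : gmap C D) :
  homotopic f g -> homotopic f' g' -> homotopic (gsub f f') (gsub g g').
Proof.
move=> [s [sH s0 sS]] [t [tH t0 tS]]; exists (fun i => s i - t i).
rewrite /gsub; have E (a b c d : forall i, 'M[k]_(mdim (C i), mdim (D i))) i :
    a i - b i - (c i - d i) = (a i - c i) - (b i - d i).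
  by mx_abel.
split=> [i||i]; first exact: hom_sub.
  by rewrite E s0 t0 mulmxBl.
by rewrite E sS tS mulmxBl mulmxBr opprD addrACA.
Qed.

Lemma homotopic_subr0 C D (f g : gmap C D) :
  homotopic (gsub f g) (gzero C D) <-> homotopic f g.
Proof.
by split=> - [h [hH h0 hS]]; exists h; rewrite /gsub /gzero in h0 hS *; split=> // *;
  rewrite -?h0 -?hS subr0.
Qed.

(** Homology is tested on matrices [b : 'M_(r, _)], read as families of [r]
    elements, because such a family can be composed with linear maps. *)
Definition cyc C i r : 'M[k]_(r, mdim (C i)) -> Prop :=
  match i with
  | 0 => fun _ => True
  | i'.+1 => fun b => b *m diff C i' = 0
  end.

Lemma cyc_sub C i r (a b : 'M_(r, mdim (C i))) : cyc a -> cyc b -> cyc (a - b).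
Proof. by case: i a b => //= i a b; rewrite mulmxBl => -> ->; rewrite subrr. Qed.

Lemma cyc_add C i r (a b : 'M_(r, mdim (C i))) : cyc a -> cyc b -> cyc (a + b).
Proof. by case: i a b => //= i a b; rewrite mulmxDl => -> ->; rewrite addr0. Qed.

Lemma cyc_mul C i r s (u : 'M_(s, r)) (a : 'M_(r, mdim (C i))) : cyc a -> cyc (u *m a).
Proof. by case: i a => //= i a; rewrite -mulmxA => ->; rewrite mulmx0. Qed.

Lemma cyc_diff C i r (a : 'M_(r, mdim (C i.+1))) : cyc (a *m diff C i).
Proof. by case: i a => //= i a; rewrite -mulmxA diffK mulmx0. Qed.

Lemma cyc_map C D (f : gmap C D) i r (a : 'M_(r, mdim (C i))) :
  chain_map f -> cyc a -> cyc (a *m f i).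
Proof.
by case=> _ fd; case: i a => //= i a; rewrite -mulmxA fd mulmxA => ->; rewrite mul0mx.
Qed.

Definition qis C D (f : gmap C D) : Prop :=
  (forall i r (b : 'M_(r, mdim (C i))) (a : 'M_(r, mdim (D i.+1))),
     cyc b -> b *m f i = a *m diff D i -> exists b', b = b' *m diff C i) /\
  (forall i r (a : 'M_(r, mdim (D i))), cyc a ->
     exists b : 'M_(r, mdim (C i)), exists a', cyc b /\ a = b *m f i + a' *m diff D i).

Lemma qis_comp C D E (f : gmap C D) (g : gmap D E) :
  chain_map f -> chain_map g -> qis f -> qis g -> qis (gcomp f g).
Proof.
move=> fC gC [fi fs] [gi gs]; split=> i r.
  move=> b a bc; rewrite /gcomp mulmxA => E1.
  have [|b' Eb'] := gi _ _ _ _ _ E1; first exact: cyc_map.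
  exact: fi Eb'.
move=> a ac; have [b [a' [bc ->]]] := gs _ _ _ ac.
have [c [b' [cc ->]]] := fs _ _ _ bc; exists c, (b' *m g i.+1 + a').
by split=> //; rewrite /gcomp !mulmxDl -!mulmxA gC.2 addrA.
Qed.

Lemma qis_cancel C D E (f : gmap C D) (g : gmap D E) :
  chain_map f -> chain_map g -> qis g -> qis (gcomp f g) -> qis f.
Proof.
move=> fC gC [gi gs] [hi hs]; split=> i r.
  move=> b a bc Ef; apply: (hi i r b (a *m g i.+1) bc).
  by rewrite /gcomp mulmxA Ef -!mulmxA gC.2.
move=> a ac; have [b [a' [bc Eb]]] := hs _ _ _ (cyc_map gC ac).
exists b; have [||b' Eb'] := gi i r (a - b *m f i) a'.
- by apply: cyc_sub => //; apply: cyc_map.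
- by rewrite mulmxBl Eb /gcomp -!mulmxA addrC addKr.
by exists b'; split=> //; rewrite -Eb' addrC subrK.
Qed.

Lemma qis_eq C D (f g : gmap C D) : (forall i, f i = g i) -> qis f -> qis g.
Proof.
move=> E [fi fs]; split=> i r.
  by move=> b a; rewrite -E; apply: fi.
by move=> a; rewrite -E; apply: fs.
Qed.

(** Exactness of the mapping cone, in the elementwise form that a lifting argument
    needs: [(b, a)] is a cycle of the cone and [(b', a')] a chain that it bounds. *)
Lemma qis_cone C D (f : gmap C D) : chain_map f -> qis f ->
  forall i r (b : 'M_(r, mdim (C i))) (a : 'M_(r, mdim (D i.+1))),
  cyc b -> b *m f i = a *m diff D i ->
  exists b', exists a', b = b' *m diff C i /\ a = b' *m f i.+1 + a' *m diff D i.+1.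
Proof.
move=> fC [fi fs] i r b a bc Ef; have [b1 Eb1] := fi i r b a bc Ef.
have [|b2 [a' [b2c Ea]]] := fs i.+1 r (a - b1 *m f i.+1).
  by rewrite /= mulmxBl -Ef Eb1 -!mulmxA fC.2 subrr.
exists (b1 + b2), a'; rewrite !mulmxDl b2c addr0; split=> //.
by rewrite -addrA -Ea addrC subrK.
Qed.

(** Both the lifting of chain maps out of a complex of projectives along a
    quasi-isomorphism ([g = 0]) and the uniqueness of such lifts up to homotopy
    are cases of this obstruction argument: the pair [(h, K)] is built degree by
    degree, the obstruction being a cycle in the exact cone of [f]. *)
Lemma relative_lift Q C D (f : gmap C D)
    (g : forall j, 'M[k]_(mdim (Q j.+1), mdim (C j)))
    (H : forall j, 'M[k]_(mdim (Q j), mdim (D j))) :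
  (forall j, higman (Q j)) -> chain_map f -> qis f ->
  (forall j, is_hom (g j)) -> (forall j, is_hom (H j)) ->
  (forall j, diff Q j.+1 *m g j = - (g j.+1 *m diff C j)) ->
  (forall j, g j *m f j = diff Q j *m H j - H j.+1 *m diff D j) ->
  exists h : forall j, 'M[k]_(mdim (Q j), mdim (C j)),
  exists K : forall j, 'M[k]_(mdim (Q j), mdim (D j.+1)),
  [/\ forall j, is_hom (h j), forall j, is_hom (K j),
      forall j, g j = diff Q j *m h j - h j.+1 *m diff C j,
      H 0%N = h 0%N *m f 0%N + K 0%N *m diff D 0
    & forall j, H j.+1 = h j.+1 *m f j.+1 + K j.+1 *m diff D j.+1 + diff Q j *m K j].
Proof.
move=> hQ fC fQ gH HH gd Hd.
pose T j : Type := ('M[k]_(mdim (Q j), mdim (C j)) * 'M[k]_(mdim (Q j), mdim (D j.+1)))%type.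
pose I j (x : T j) := [/\ is_hom x.1, is_hom x.2, cyc (g j - diff Q j *m x.1)
   & diff Q j *m (H j - x.1 *m f j - x.2 *m diff D j) = 0].
pose R j (x : T j) (y : T j.+1) :=
  g j = diff Q j *m x.1 - y.1 *m diff C j /\
  H j.+1 = y.1 *m f j.+1 + y.2 *m diff D j.+1 + diff Q j *m x.2.
have qc := qis_cone fC fQ.
have step j : forall x, I j x -> exists y, I j.+1 y /\ R j x y.
  case=> h K [/= hH KH bc HE].
  (* [(b, a)] is the obstruction, a cycle of the cone of [f]. *)
  pose b := diff Q j *m h - g j; pose a := H j.+1 - diff Q j *m K.
  have bcyc : cyc b.
    by rewrite /b -opprB -[X in cyc (- X)]mul1mx -mulNmx; apply: cyc_mul.
  have bf : b *m f j = a *m diff D j.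
    move/eqP: HE; rewrite !mulmxBr !subr_eq add0r !mulmxA => /eqP HE.
    rewrite /a /b !mulmxBl Hd HE.
    by mx_abel.
  have [b' [a' [Eb Ea]]] := qc _ _ _ _ bcyc bf.
  have bH : is_hom b by apply: hom_sub => //; apply: hom_mul => //; apply: diff_hom.
  have aH : is_hom a by apply: hom_sub => //; apply: hom_mul => //; apply: diff_hom.
  have [h' [K' [h'H K'H Eh EK]]] :=
    higman_lift2 (hQ j.+1) bH aH (diff_hom C j) (fC.1 j.+1) (diff_hom D j.+1) Eb Ea.
  exists (h', K'); rewrite /I /R /=; split; split=> //.
  - rewrite mulmxBl -mulmxA -Eh /b mulmxBr mulmxA diffK mul0mx sub0r opprK gd.
    by rewrite addrN.
  - rewrite -addrA -opprD -EK /a opprB addrCA subrr addr0.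
    by rewrite mulmxA diffK mul0mx.
  - by rewrite -Eh /b opprB addrC subrK.
  - by rewrite -EK /a subrK.
have init : exists x, I 0%N x /\ H 0%N = x.1 *m f 0%N + x.2 *m diff D 0.
  have [b [a' [_ E]]] := fQ.2 0%N _ (H 0%N) Logic.I.
  have E1 : (0 : 'M_(mdim (Q 0%N), mdim (@zero_mod k gT G))) = b *m (0 : 'M_(mdim (C 0%N), mdim zero_mod)).
    by rewrite mulmx0.
  have [h [K [hH KH _ E2]]] := higman_lift2 (hQ 0%N) (hom0 _ _) (HH 0%N) (hom0 _ _)
    (fC.1 0%N) (diff_hom D 0) E1 E.
  exists (h, K); split=> //; split=> //=.
  by rewrite -addrA -opprD -E2 subrr mulmx0.
pose I' j (x : T j) := I j x /\
  match j return T j -> Prop with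
  | 0 => fun x => H 0%N = x.1 *m f 0%N + x.2 *m diff D 0
  | _ => fun _ => True end x.
have [||s [sI sR]] := @dependent_choice T I' R.
- by [].
- by move=> j x [/step[y [Iy Ry]] _]; exists y.
exists (fun j => (s j).1), (fun j => (s j).2); split=> [j|j|j||j].
- by case: (sI j) => -[].
- by case: (sI j) => -[].
- by case: (sR j).
- exact: (sI 0%N).2.
- by case: (sR j).
Qed.

Lemma qis_lift Q C D (f : gmap C D) (g : gmap Q D) :
  (forall j, higman (Q j)) -> chain_map f -> qis f -> chain_map g ->
  exists2 h : gmap Q C, chain_map h & homotopic (gcomp h f) g.
Proof.
move=> hQ fC fQ [gH gd].
have [j|j|j|h [K [hH KH hd H0 HS]]] := @relative_lift Q C D f (fun j => 0) g hQ fC fQ _ gH.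
- exact: hom0.
- by rewrite mulmx0 mul0mx oppr0.
- by rewrite mul0mx gd subrr.
exists h; first by split=> // j; apply/eqP; rewrite eq_sym -subr_eq0 -hd.
exists (fun j => - K j); rewrite /gcomp; split=> [j||j]; first exact: hom_opp.
  by rewrite H0 mulNmx opprD addrA subrr sub0r.
by rewrite HS mulNmx mulmxN -addrA opprD addrA subrr sub0r opprD.
Qed.

Lemma susp_higman Q : (forall j, higman (Q j)) -> forall j, higman (susp Q j).
Proof. by move=> hQ [|j] /=; [apply: higman_zero | apply: hQ]. Qed.

(** A null-homotopy of [u f] is, after shifting [Q] by one, the map [H] of
    [relative_lift], and [u] itself is the prescribed map [g]. *)
Lemma qis_null Q C D (f : gmap C D) (u : gmap Q C) :
  (forall j, higman (Q j)) -> chain_map f -> qis f -> chain_map u ->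
  homotopic (gcomp u f) (gzero Q D) -> homotopic u (gzero Q C).
Proof.
move=> hQ fC fQ [uH ud] [s [sH s0 sS]].
pose H j : 'M[k]_(mdim (susp Q j), mdim (D j)) :=
  match j with 0 => 0 | j'.+1 => - s j' end.
rewrite /gcomp /gzero in s0 sS *.
have [j||j|h [K [hH _ hd _ _]]] :=
  @relative_lift (susp Q) C D f u H (susp_higman hQ) fC fQ uH.
- by case: j => [|j] /=; [apply: hom0 | apply: hom_opp].
- by move=> j; rewrite /= mulNmx ud.
- case: j => [|j] /=; first by rewrite mul0mx sub0r mulNmx opprK -s0 subr0.
  by rewrite !mulNmx mulmxN !opprK addrC -sS subr0.
exists (fun j => - h j.+1); split=> [j||j].
- exact: (hom_opp (hH j.+1)).
- by rewrite subr0 hd /= mul0mx sub0r mulNmx.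
- by rewrite subr0 hd /= !mulNmx mulmxN addrC.
Qed.

Lemma qis_homotopic Q C D (f : gmap C D) (u v : gmap Q C) :
  (forall j, higman (Q j)) -> chain_map f -> qis f -> chain_map u -> chain_map v ->
  homotopic (gcomp u f) (gcomp v f) -> homotopic u v.
Proof.
move=> hQ fC fQ uC vC /homotopic_subr0 uv; apply/homotopic_subr0.
apply: (qis_null hQ fC fQ); first exact: chain_sub.
apply: homotopic_trans uv; apply: homotopic_eq => i.
by rewrite /gcomp /gsub mulmxBl.
Qed.

(** The identification of [C_j] with the component of degree [m + j] of
    [suspn m C]; it is inverse to [unsusp m C i j]. *)
Fixpoint tosusp m C j i : 'M[k]_(mdim (C j), mdim (suspn m C i)) :=
  match m with
  | 0 => idfam C j i
  | m'.+1 => match i with 0 => 0 | i'.+1 => tosusp m' C j i' end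
  end.

Lemma tosusp_hom m C j i : is_hom (tosusp m C j i).
Proof.
elim: m i => [|m IH] i /=; first exact: idfam_hom.
by case: i => [|i]; [apply: hom0 | apply: IH].
Qed.

Lemma unsusp_hom m C j i : is_hom (unsusp m C i j).
Proof.
elim: m i => [|m IH] i /=; first exact: idfam_hom.
by case: i => [|i]; [apply: hom0 | apply: IH].
Qed.

Lemma tosusp0 m C j i : i != (m + j)%N -> tosusp m C j i = 0.
Proof.
elim: m i => [|m IH] i /=; first by rewrite eq_sym add0n; apply: idfam0.
by case: i => //= i; rewrite addSn eqSS; apply: IH.
Qed.

Lemma unsusp0 m C i j : i != (m + j)%N -> unsusp m C i j = 0.
Proof.
elim: m i => [|m IH] i /=; first by rewrite add0n; apply: idfam0.
by case: i => //= i; rewrite addSn eqSS; apply: IH.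
Qed.

Lemma tosuspK m C j i : i = (m + j)%N -> tosusp m C j i *m unsusp m C i j = 1%:M.
Proof.
elim: m i => [|m IH] i /=; first by rewrite add0n => ->; rewrite !idfam_id mulmx1.
by case: i => //= i; rewrite addSn => -[]; apply: IH.
Qed.

Lemma suspn_small m C i : (i < m)%N -> mdim (suspn m C i) = 0%N.
Proof. by elim: m i => [|m IH] [|i] //=; rewrite ltnS; apply: IH. Qed.

Lemma unsuspK m C j i : i = (m + j)%N -> unsusp m C i j *m tosusp m C j i = 1%:M.
Proof.
elim: m i => [|m IH] i /=; first by rewrite add0n => ->; rewrite !idfam_id mulmx1.
by case: i => //= i; rewrite addSn => -[]; apply: IH.
Qed.

Lemma suspn_obj m C j i : i = (m + j)%N -> suspn m C i = C j.
Proof.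
elim: m i => [|m IH] i /=; first by rewrite add0n => ->.
by case: i => //= i; rewrite addSn => -[]; apply: IH.
Qed.

Lemma idfam_diff C j i : idfam C j.+1 i.+1 *m diff C i = diff C j *m idfam C j i.
Proof.
have [->|ne] := eqVneq j i; first by rewrite !idfam_id mulmx1 mul1mx.
by rewrite !idfam0 ?mulmx0 ?mul0mx.
Qed.

Lemma idfam_inv C a b : a = b -> idfam C a b *m idfam C b a = 1%:M.
Proof. by move=> ->; rewrite !idfam_id mul1mx. Qed.

Lemma dfamSl C i j : dfam C i.+1 j = diff C i *m idfam C i j.
Proof.
have [->|ne] := eqVneq i j; first by rewrite idfam_id dfamE mulmx1.
by rewrite dfam0 ?idfam0 ?mulmx0 // eqSS.
Qed.

Lemma tosusp_diff m C j i :
  tosusp m C j.+1 i.+1 *m diff (suspn m C) i =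
  (-1) ^+ m *: (diff C j *m tosusp m C j i).
Proof.
elim: m i => [|m IH] i /=; first by rewrite expr0 scale1r idfam_diff.
case: i => [|i] /=; first by rewrite !mulmx0 scaler0.
by rewrite mulmxN IH exprS mulN1r scaleNr.
Qed.

Lemma tosusp_diff0 m C i : tosusp m C 0 i.+1 *m diff (suspn m C) i = 0.
Proof.
elim: m i => [|m IH] i /=; first by rewrite idfam0 ?mul0mx.
case: i => [|i] /=; first by rewrite mulmx0.
by rewrite mulmxN IH oppr0.
Qed.

Lemma unsusp_diff m C j i :
  diff (suspn m C) i *m unsusp m C i j =
  (-1) ^+ m *: (unsusp m C i.+1 j.+1 *m diff C j).
Proof.
elim: m i => [|m IH] i /=; first by rewrite expr0 scale1r idfam_diff.
case: i => [|i] /=; last by rewrite mulNmx IH exprS mulN1r scaleNr.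
rewrite mul0mx; elim: m {IH} => [|m IH] /=; last by rewrite mul0mx scaler0.
by rewrite idfam0 ?mul0mx ?scaler0.
Qed.

Fixpoint suspm m C D (f : gmap C D) : gmap (suspn m C) (suspn m D) :=
  match m with
  | 0 => f
  | m'.+1 => fun i => match i with 0 => 0 | i'.+1 => suspm m' f i' end
  end.

Lemma tosusp_suspm m C D (f : gmap C D) j i :
  tosusp m C j i *m suspm m f i = f j *m tosusp m D j i.
Proof.
elim: m i => [|m IH] i /=.
  have [->|ne] := eqVneq j i; first by rewrite !idfam_id mul1mx mulmx1.
  by rewrite !idfam0 ?mulmx0 ?mul0mx.
by case: i => [|i]; [rewrite !mulmx0 | apply: IH].
Qed.

Definition suspg C D (f : gmap C D) : gmap (susp C) (susp D) :=
  fun i => match i with 0 => 0 | i'.+1 => f i' end.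

Lemma suspg_chain C D (f : gmap C D) : chain_map f -> chain_map (suspg f).
Proof.
case=> fH fd; split=> - [|i] //=; first exact: hom0.
  by rewrite mulmx0 mul0mx.
by rewrite mulmxN mulNmx fd.
Qed.

Lemma suspg_qis C D (f : gmap C D) : qis f -> qis (suspg f).
Proof.
case=> fi fs; split=> - [|i] r /=.
- move=> b a _ _; exists 0; rewrite mul0mx.
  by apply/matrixP => ? [].
- move=> b a bc E; have [||b' Eb] := fi i r b (- a).
    by case: i b bc {a E} => //= i b; rewrite mulmxN => /eqP; rewrite oppr_eq0 => /eqP.
    by rewrite E mulmxN mulNmx.
  by exists (- b'); rewrite mulmxN mulNmx opprK.
- move=> a _; exists 0, 0; split=> //; rewrite !mul0mx addr0.
  by apply/matrixP => ? [].
- move=> a ac; have [|b [a' [bc E]]] := fs i r a.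
    by case: i a ac => //= i b; rewrite mulmxN => /eqP; rewrite oppr_eq0 => /eqP.
  exists b, (- a'); split; last by rewrite mulmxN mulNmx opprK.
  by case: i b bc {a ac a' E} => //= [|i] b; [rewrite mulmx0 | rewrite mulmxN => ->; rewrite oppr0].
Qed.

Lemma suspm_chain m C D (f : gmap C D) : chain_map f -> chain_map (suspm m f).
Proof. by move=> fC; elim: m => //= m IH; apply: suspg_chain. Qed.

Lemma suspm_qis m C D (f : gmap C D) : qis f -> qis (suspm m f).
Proof. by move=> fQ; elim: m => //= m IH; apply: suspg_qis. Qed.

End Homotopy.

(** * Components of tensor products of complexes *)

Section TensorComponents.
Context {k : fieldType} {gT : finGroupType} {G : {group gT}}.
Implicit Types C D E Q : complex k G.
Implicit Types M : kGmod k G.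

Section Components.
Variables C D : complex k G.

(** The inclusion of [C_s (x) D_t] into degree [i]; the index [i] is kept free of the
    equation [i = s + t] so that no transport along equalities of degrees is needed. *)
Definition tin i s t : 'M[k]_(mdim (C s) * mdim (D t), mdim (tens C D i)) :=
  \mxrow_(u < i.+1) (idfam C s u *t idfam D t (i - u)%N).

Definition tcase i m (f : forall s t, 'M[k]_(mdim (C s) * mdim (D t), m)) :
    'M[k]_(mdim (tens C D i), m) :=
  \mxcol_(u < i.+1) f u (i - u)%N.

Lemma tin_mxcol i s t m (f : forall u : 'I_i.+1, 'M[k]_(mdim (C u) * mdim (D (i - u)%N), m))
    (u : 'I_i.+1) :
  (u : nat) = s -> (s + t)%N = i ->
  forall g : 'M[k]_(mdim (C s) * mdim (D t), m),
  (forall (e : (u : nat) = s) (e' : (i - u)%N = t),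
     f u = (idfam C u s *t idfam D (i - u)%N t) *m g) ->
  tin i s t *m (\mxcol_u f u) = g.
Proof.
move=> us sti g fg; rewrite /tin mul_mxrow_mxcol (bigD1 u) //= big1 => [|v nv].
  have e' : (i - u)%N = t by rewrite us -sti addKn.
  by rewrite addr0 fg // mulmxA tensmx_mul !idfam_inv // tens11 mul1mx.
rewrite [idfam C s v]idfam0 ?tens0mx ?mul0mx // -us.
by apply: contra nv => /eqP e; apply/eqP/val_inj.
Qed.

Lemma tin_case i s t m (f : forall s t, 'M[k]_(mdim (C s) * mdim (D t), m)) :
  (s + t)%N = i -> tin i s t *m tcase i f = f s t.
Proof.
move=> sti; have si : (s < i.+1)%N by rewrite ltnS -sti leq_addr.
apply: (@tin_mxcol _ _ _ _ _ (Ordinal si)) => //= _ e.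
by rewrite e !idfam_id tens11 mul1mx.
Qed.

(** Together with [tin_case] and [tin_diff] this replaces the block description of the
    tensor product: every identity below is checked on the components [C_s (x) D_t]. *)
Lemma tens_ext i m (A B : 'M[k]_(mdim (tens C D i), m)) :
  (forall s t, (s + t)%N = i -> tin i s t *m A = tin i s t *m B) -> A = B.
Proof.
move=> AB; apply/mxcolP => u.
have ui : (u <= i)%N by rewrite -ltnS.
have E (X : 'M[k]_(mdim (tens C D i), m)) : tin i u (i - u)%N *m X = submxcol X u.
  rewrite -{1}[X]submxcolK.
  by apply: (@tin_mxcol _ _ _ _ _ u) => //; rewrite ?subnKC // => *; rewrite !idfam_id tens11 mul1mx.
by rewrite -!E; apply: AB; rewrite subnKC.
Qed.

Lemma tin_hom i s t : is_hom (M := tens_mod (C s) (D t)) (N := tens C D i) (tin i s t).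
Proof.
move=> x Gx; rewrite /= /tin mul_mxrow mul_mxrow_mxdiag; apply: eq_mxrow => u.
by rewrite !tensmx_mul !idfam_hom.
Qed.

Lemma tens_hom i M (A : 'M[k]_(mdim (tens C D i), mdim M)) :
  (forall s t, (s + t)%N = i ->
     is_hom (M := tens_mod (C s) (D t)) (N := M) (tin i s t *m A)) ->
  is_hom (M := tens C D i) (N := M) A.
Proof.
move=> AH x Gx; apply: tens_ext => s t sti.
rewrite [LHS]mulmxA -(tin_hom i s t Gx) -[LHS]mulmxA [RHS]mulmxA.
exact: AH.
Qed.

Lemma tcase_hom i M (f : forall s t, 'M[k]_(mdim (C s) * mdim (D t), mdim M)) :
  (forall s t, (s + t)%N = i -> is_hom (M := tens_mod (C s) (D t)) (N := M) (f s t)) ->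
  is_hom (M := tens C D i) (N := M) (tcase i f).
Proof. by move=> fH; apply: tens_hom => s t sti; rewrite tin_case //; apply: fH. Qed.

(** The two summands [d (x) 1] and [1 (x) d], without sign, of the differential on
    [C_s (x) D_t]. *)
Definition tdiffl i s t : 'M[k]_(mdim (C s) * mdim (D t), mdim (tens C D i)) :=
  match s with
  | 0 => 0
  | s'.+1 => (diff C s' *t 1%:M) *m tin i s' t
  end.
Definition tdiffr i s t : 'M[k]_(mdim (C s) * mdim (D t), mdim (tens C D i)) :=
  match t with
  | 0 => 0
  | t'.+1 => (1%:M *t diff D t') *m tin i s t'
  end.

Lemma tin_diff i s t : (s + t)%N = i.+1 ->
  tin i.+1 s t *m diff (tens C D) i = tdiffl i s t + (-1) ^+ s *: tdiffr i s t.
Proof.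
move=> sti; have si : (s < i.+2)%N by rewrite ltnS -sti leq_addr.
rewrite /= /tens_diff mxblockEv.
have EL : tdiffl i s t = \mxrow_(u < i.+1) (dfam C s u *t idfam D t (i - u)%N).
  case: s {sti si} => [|s] /=.
    by rewrite -[LHS]mxrow0; apply: eq_mxrow => u; rewrite dfam0 ?tens0mx.
  rewrite /tin mul_mxrow; apply: eq_mxrow => u.
  by rewrite tensmx_mul mul1mx dfamSl.
have ER : tdiffr i s t = \mxrow_(u < i.+1) (idfam C s u *t dfam D t (i - u)%N).
  case: t {sti EL} => [|t] /=.
    by rewrite -[LHS]mxrow0; apply: eq_mxrow => u; rewrite dfam0 ?tensmx0.
  rewrite /tin mul_mxrow; apply: eq_mxrow => u.
  by rewrite tensmx_mul mul1mx dfamSl.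
rewrite EL ER {EL ER}.
have te : t = (i.+1 - s)%N by rewrite -sti addKn.
subst t; apply: (@tin_mxcol _ _ _ _ _ (Ordinal si)) => //= _ _.
rewrite !idfam_id tens11 mul1mx.
have -> r (B : forall u : 'I_i.+1, 'M[k]_(r,
     mdim (tens_mod (C u) (D (i - u)%N)))) c : c *: (\mxrow_u B u) = \mxrow_u (c *: B u).
  rewrite -mul_scalar_mx mul_mxrow; apply: eq_mxrow => u.
  by rewrite mul_scalar_mx.
by rewrite -mxrowD; apply: eq_mxrow => u; rewrite /tens_comp.
Qed.

End Components.

Lemma tens_higman C D i : (forall s, higman (C s)) -> higman (tens C D i).
Proof. by move=> hC; apply: higman_dsum => u; apply: higman_tens. Qed.

End TensorComponents.

(** * Action of a linear form on a tensor product *)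

Section Tens.
Context {k : fieldType} {gT : finGroupType} {G : {group gT}}.
Implicit Types C D E Q : complex k G.

Definition tmap C C' D D' (f : gmap C C') (g : gmap D D') : gmap (tens C D) (tens C' D') :=
  fun i => tcase i (fun s t => (f s *t g t) *m tin C' D' i s t).

Lemma tin_tmap C C' D D' (f : gmap C C') (g : gmap D D') i s t : (s + t)%N = i ->
  tin C D i s t *m tmap f g i = (f s *t g t) *m tin C' D' i s t.
Proof. by move=> sti; rewrite tin_case. Qed.

Lemma tmap_hom C C' D D' (f : gmap C C') (g : gmap D D') :
  (forall i, is_hom (f i)) -> (forall i, is_hom (g i)) -> forall i, is_hom (tmap f g i).
Proof.
move=> fH gH i; apply: tcase_hom => s t _.
apply: (@hom_mul _ _ _ (tens_mod (C s) (D t)) (tens_mod (C' s) (D' t))).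
  exact: hom_tens.
exact: tin_hom.
Qed.

Lemma tmap_chain C C' D D' (f : gmap C C') (g : gmap D D') :
  chain_map f -> chain_map g -> chain_map (tmap f g).
Proof.
move=> [fH fd] [gH gd]; split; first exact: tmap_hom.
move=> i; apply: tens_ext => s t sti.
rewrite [LHS]mulmxA [RHS]mulmxA tin_tmap // -[LHS]mulmxA !tin_diff //.
rewrite mulmxDr mulmxDl -scalemxAr -scalemxAl; congr (_ + _ *: _).
  case: s sti => [|s] //= sti; first by rewrite mulmx0 mul0mx.
  rewrite -[RHS]mulmxA tin_tmap; last by case: sti.
  by rewrite !mulmxA !tensmx_mul mulmx1 mul1mx fd.
case: t sti => [|t] //= sti; first by rewrite mulmx0 mul0mx.
rewrite -[RHS]mulmxA tin_tmap; last by move: sti; rewrite addnS => -[].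
by rewrite !mulmxA !tensmx_mul mulmx1 mul1mx gd.
Qed.

(** A linear form of degree [m] is stored as a family over all degrees, of which only
    the member of index [m] matters: this avoids transports when degrees are shifted. *)
Definition cochain Q := forall s, 'M[k]_(mdim (Q s), 1).

(** The map [w (x) C : Q (x) C -> Sigma^m C].  The factor [tosusp] vanishes unless
    [s = m], so that [w] is only used in degree [m]. *)
Definition cmap Q m (w : cochain Q) C : gmap (tens Q C) (suspn m C) :=
  fun i => tcase i (fun s t => ftens (w s) (tosusp m C t i)).

Definition cobound Q (w : cochain Q) : cochain Q := fun s =>
  match s with 0 => 0 | s'.+1 => diff Q s' *m w s' end.

Definition cochain_hom Q (w : cochain Q) :=
  forall s, is_hom (M := Q s) (N := triv_mod) (w s).

Lemma tin_cmap Q m (w : cochain Q) C i s t : (s + t)%N = i ->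
  tin Q C i s t *m cmap m w C i = ftens (w s) (tosusp m C t i).
Proof. by move=> sti; rewrite tin_case. Qed.

Lemma cmap_hom Q m (w : cochain Q) C :
  cochain_hom w -> forall i, is_hom (cmap m w C i).
Proof. by move=> wH i; apply: tcase_hom => s t _; apply: hom_ftens => //; apply: tosusp_hom. Qed.

(** The Leibniz rule.  The sign [(-1)^s] of the tensor product agrees with the sign
    [(-1)^m] of the suspension, as only [s = m] contributes. *)
Lemma cmap_diff Q m (w : cochain Q) C i :
  diff (tens Q C) i *m cmap m w C i =
  (cmap m.+1 (cobound w) C i.+1 : 'M_(_, mdim (suspn m C i)))
    + cmap m w C i.+1 *m diff (suspn m C) i.
Proof.
apply: tens_ext => s t sti.
rewrite [LHS]mulmxA tin_diff // mulmxDl mulmxDr; congr (_ + _).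
  apply: (etrans _ (esym (tin_cmap m.+1 (cobound w) C sti))).
  case: s sti => [|s] //= sti; first by rewrite mul0mx ftens0l.
  by case: sti => sti; rewrite -mulmxA tin_cmap // tens_ftens mul1mx.
rewrite [RHS]mulmxA tin_cmap // ftens_mul.
case: t sti => [|t] //= sti.
  by rewrite tosusp_diff0 ftens0r scaler0 mul0mx.
rewrite addnS in sti; case: sti => sti.
rewrite tosusp_diff ftensZr -scalemxAl -mulmxA tin_cmap // tens_ftens mul1mx.
have [->//|ne] := eqVneq s m.
rewrite tosusp0 ?mulmx0 ?ftens0r ?scaler0 //.
by rewrite -sti eqn_add2r.
Qed.

Lemma cmap_ext Q m (w w' : cochain Q) C i :
  (forall s, w s = w' s) -> cmap m w C i = cmap m w' C i.
Proof. by move=> ww; apply: tens_ext => s t sti; rewrite !tin_cmap // ww. Qed.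

Lemma cmap0 Q m C i : cmap m (fun s => 0 : 'M_(mdim (Q s), 1)) C i = 0.
Proof. by apply: tens_ext => s t sti; rewrite tin_cmap // ftens0l mulmx0. Qed.

Lemma cmap_chain Q m (w : cochain Q) C :
  cochain_hom w -> (forall s, diff Q s *m w s = 0) -> chain_map (cmap m w C).
Proof.
move=> wH dw; split; first exact: cmap_hom.
move=> i; rewrite cmap_diff (_ : cmap m.+1 _ C i.+1 = 0) ?add0r //.
rewrite -[RHS](cmap0 Q m.+1 C i.+1); apply: cmap_ext => -[|s] //=.
Qed.

(** The primitive [w] itself provides the homotopy, by the Leibniz rule. *)
Lemma cmap_null Q m (w : cochain Q) C :
  cochain_hom w -> homotopic (cmap m.+1 (cobound w) C) (gzero _ _).
Proof.
move=> wH; exists (cmap m w C); rewrite /gzero; split=> [i||i].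
- exact: (cmap_hom m C wH).
- by apply/matrixP => ? [].
- by rewrite subr0 cmap_diff /= mulmxN addrCA addNr addr0.
Qed.

Lemma tmap_cmap Q Q' m (f : gmap Q Q') (w : cochain Q') C i :
  tmap f (gid C) i *m cmap m w C i = cmap m (fun s => f s *m w s) C i.
Proof.
apply: tens_ext => s t sti.
by rewrite mulmxA tin_tmap // -mulmxA !tin_cmap // tens_ftens mul1mx.
Qed.

Lemma cmap_nat Q m (w : cochain Q) C D (g : gmap C D) i :
  tmap (gid Q) g i *m cmap m w D i = cmap m w C i *m suspm m g i.
Proof.
apply: tens_ext => s t sti.
rewrite mulmxA tin_tmap // -mulmxA tin_cmap // tens_ftens mul1mx.
by rewrite [RHS]mulmxA tin_cmap // ftens_mul tosusp_suspm.
Qed.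

(** A [k]-linear deformation retraction of [Q] onto [k] placed in degree [m]. *)
Definition contraction Q m (w : cochain Q) : Prop :=
  exists c : forall s, 'M[k]_(mdim (Q s), mdim (Q s.+1)),
  exists e : forall s, 'M[k]_(1, mdim (Q s)),
  [/\ e m *m w m = 1%:M, forall s, s != m -> w s = 0, forall s, c s *m w s.+1 = 0,
      c 0%N *m diff Q 0 + w 0%N *m e 0%N = 1%:M
    & forall s, c s.+1 *m diff Q s.+1 + diff Q s *m c s + w s.+1 *m e s.+1 = 1%:M].

(** The [k]-linear retraction survives tensoring with [C]: [c'] is the contraction
    [c (x) 1] and [g] the section [e (x) 1] of [w (x) C]. *)
Lemma cmap_qis Q m (w : cochain Q) C :
  cochain_hom w -> (forall s, diff Q s *m w s = 0) ->
  contraction m w -> qis (cmap m w C).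
Proof.
move=> wH dw [c [e [ew w0 cw c0 cS]]].
have [_ pd] := cmap_chain m C wH dw.
pose c' i := tcase (C := Q) (D := C) i (fun s t => (c s *t 1%:M) *m tin Q C i.+1 s.+1 t).
have c'w i : c' i *m cmap m w C i.+1 = 0.
  apply: tens_ext => s t sti; rewrite mulmxA tin_case // -mulmxA tin_cmap ?addSn ?sti //.
  by rewrite tens_ftens cw ftens0l mulmx0.
pose W i := tcase (C := Q) (D := C) i (fun s t => ((w s *m e s) *t 1%:M) *m tin Q C i s t).
have cd0 : c' 0%N *m diff (tens Q C) 0 + W 0%N = 1%:M.
  apply: tens_ext => s t sti; rewrite mulmxDr mulmxA !tin_case // -mulmxA mulmx1.
  have [-> ->] : s = 0%N /\ t = 0%N by case: s t sti => [|s] [].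
  rewrite tin_diff //= scaler0 addr0 mulmxA tensmx_mul mulmx1 -mulmxDl -tensDl.
  by rewrite c0 tens11 mul1mx.
have cdS i : c' i.+1 *m diff (tens Q C) i.+1 + diff (tens Q C) i *m c' i + W i.+1 = 1%:M.
  apply: tens_ext => s t sti; rewrite !mulmxDr !mulmxA !tin_case // mulmx1.
  rewrite -[X in X + _ + _]mulmxA !tin_diff ?addSn ?sti //=.
  have E : (c s *t 1%:M) *m tdiffr Q C i.+1 s.+1 t = tdiffr Q C i s t *m c' i.
    case: t sti => [|t] sti /=; first by rewrite mulmx0 mul0mx.
    rewrite addnS in sti; case: sti => sti.
    by rewrite -mulmxA tin_case // !mulmxA !tensmx_mul !mul1mx !mulmx1.
  rewrite mulmxDr mulmxDl -scalemxAl -scalemxAr E exprS mulN1r scaleNr.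
  rewrite addrACA addNr addr0 mulmxA tensmx_mul mulmx1.
  case: s sti {E} => [|s] sti /=.
    by rewrite mul0mx addr0 -mulmxDl -tensDl c0 tens11 mul1mx.
  case: sti => sti; rewrite -mulmxA tin_case // mulmxA tensmx_mul mul1mx.
  by rewrite -!mulmxDl -!tensDl cS tens11 mul1mx.
pose g i := unsusp m C i (i - m)%N *m vtens _ (e m) *m tin Q C i m (i - m).
have pg i : cmap m w C i *m g i = W i.
  apply: tens_ext => s t sti; rewrite mulmxA tin_cmap // tin_case //.
  have [sm|nsm] := eqVneq s m; last first.
    by rewrite w0 // ftens0l !mul0mx tens0mx mul0mx.
  rewrite /g -sti sm addKn ftens_mul !mulmxA tosuspK // mul1mx.
  by rewrite -ftens_mul ftens_vtens.
have gp i : g i *m cmap m w C i = 1%:M.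
  have [im|mi] := ltnP i m.
    by apply: no_rows; apply: suspn_small.
  rewrite /g -mulmxA tin_cmap ?subnKC // -mulmxA vtens_ftens //.
  by apply: unsuspK; rewrite subnKC.
(* On the kernel of [w (x) C] the contraction satisfies [c' d + d c' = 1]. *)
have ker i r (b : 'M_(r, mdim (tens Q C i))) :
    cyc b -> b *m cmap m w C i = 0 -> b = b *m c' i *m diff (tens Q C) i.
  move=> bc b0; rewrite -{1}[b]mulmx1.
  case: i b bc b0 => [|i] b /= bc b0.
    by rewrite -cd0 mulmxDr -pg !mulmxA b0 !mul0mx addr0.
  rewrite -cdS !mulmxDr -pg [b *m (cmap m w C i.+1 *m _)]mulmxA b0 mul0mx addr0.
  by rewrite [b *m (diff _ i *m _)]mulmxA bc mul0mx addr0 !mulmxA.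
split=> i r.
  move=> b a bc E; pose x := a *m g i.+1.
  have xE : x *m cmap m w C i.+1 = a by rewrite /x -mulmxA gp mulmx1.
  have /ker : cyc (b - x *m diff (tens Q C) i).
    by apply: cyc_sub => //; apply: cyc_diff.
  move=> /(_ _)/eqP; rewrite subr_eq -mulmxDl => E'.
  eexists; apply/eqP/E'; apply/eqP.
  by rewrite mulmxBl -mulmxA -pd mulmxA xE E subrr.
move=> a ac; pose x := a *m g i.
have xE : x *m cmap m w C i = a by rewrite /x -mulmxA gp mulmx1.
case: i a ac x xE => [|i] a /= ac x xE.
  by exists x, 0; rewrite xE mul0mx addr0.
have /ker E : cyc (x *m diff (tens Q C) i) by apply: cyc_diff.
exists (x - x *m diff (tens Q C) i *m c' i), 0; split.
  by rewrite mulmxBl {1}E ?subrr // -mulmxA -pd mulmxA xE.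
by rewrite mulmxBl -[X in _ - X]mulmxA c'w mulmx0 subr0 xE mul0mx addr0.
Qed.

Lemma susp_contraction Q m (w : cochain Q) : contraction m w ->
  contraction (Q := susp Q) m.+1
    (fun s => match s return 'M[k]_(mdim (susp Q s), 1) with 0 => 0 | s'.+1 => w s' end).
Proof.
case=> c [e [ew w0 cw c0 cS]].
exists (fun s => match s return 'M[k]_(mdim (susp Q s), mdim (susp Q s.+1)) with
  0 => 0 | s'.+1 => - c s' end).
exists (fun s => match s return 'M[k]_(1, mdim (susp Q s)) with 0 => 0 | s'.+1 => e s' end).
split=> //.
- by case=> [|s] //; apply: w0.
- by case=> [|s] /=; rewrite ?mul0mx // mulNmx cw oppr0.
- by apply/matrixP => - [].
- case=> [|s] /=; first by rewrite mulmxN mulNmx opprK mulmx0 addr0.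
  rewrite !mulmxN !mulNmx !opprK. exact: cS.
Qed.

End Tens.

(** * Resolutions and classes killing a complex *)

Section Resolutions.
Context {k : fieldType} {gT : finGroupType} {G : {group gT}}.
Implicit Types C D E Q : complex k G.
Local Notation kk := (@triv_mod k gT G).

Lemma contraction_ext Q m (w w' : cochain Q) :
  (forall s, w s = w' s) -> contraction m w -> contraction m w'.
Proof.
move=> ww [c [e [ew w0 cw c0 cS]]]; exists c, e.
by split=> [|s|s||s]; rewrite -!ww //; apply: w0.
Qed.

Section OneResolution.
Variable P : resolution kk.

Lemma res_higman s : higman (P s).
Proof. by apply: projective_higman => A B g f; apply: res_projective. Qed.

Lemma diff_aug : diff P 0 *m aug P = 0.
Proof. by apply/sub_kermxP; rewrite (eqmxP (aug_exact P)). Qed.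

Lemma res_cyc i r (a : 'M_(r, mdim (P i))) :
  cyc a -> a *m augfam (aug P) i = 0 -> exists a', a = a' *m diff P i.
Proof.
case: i a => [|i] a /=.
  by move=> _ /sub_kermxP; rewrite (eqmxP (aug_exact P)) => /submxP.
by move=> /sub_kermxP; rewrite (eqmxP (res_exact P i)) => /submxP.
Qed.

(** An exact complex of vector spaces is contractible; [pinvmx] makes the choices
    explicit. *)
Lemma res_contraction : contraction 0 (augfam (aug P)).
Proof.
have /row_fullP[e0 e0E] := aug_full P.
pose c := fix c i : 'M[k]_(mdim (P i), mdim (P i.+1)) := match i with
  | 0 => (1%:M - aug P *m e0) *m pinvmx (diff P 0)
  | i'.+1 => (1%:M - diff P i' *m c i') *m pinvmx (diff P i'.+1) end.
have c0 : c 0%N *m diff P 0 = 1%:M - aug P *m e0.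
  apply: mulmxKpV; rewrite -(eqmxP (aug_exact P)); apply/sub_kermxP.
  by rewrite mulmxBl mul1mx -mulmxA e0E mulmx1 subrr.
have cS i : c i.+1 *m diff P i.+1 = 1%:M - diff P i *m c i.
  apply: mulmxKpV; rewrite -(eqmxP (res_exact P i)); apply/sub_kermxP.
  elim: i => [|i IH].
    by rewrite mulmxBl mul1mx -mulmxA c0 mulmxBr mulmx1 mulmxA diff_aug mul0mx subr0 subrr.
  have E : c i.+1 *m diff P i.+1 = 1%:M - diff P i *m c i.
    apply: mulmxKpV; rewrite -(eqmxP (res_exact P i)).
    by apply/sub_kermxP; exact: IH.
  by rewrite mulmxBl mul1mx -mulmxA E mulmxBr mulmx1 mulmxA diffK mul0mx subr0 subrr.
exists c, (fun s => match s return 'M_(1, mdim (P s)) with 0 => e0 | _ => 0 end).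
split=> //.
- by case.
- by move=> s; rewrite mulmx0.
- by rewrite c0 /= subrK.
- by move=> s; rewrite cS subrK mulmx0 addr0.
Qed.

(** The augmentation of [P], seen as a linear form of degree [m] on [suspn m P]; it is
    the zero form in all other degrees. *)
Definition raug m : cochain (suspn m P) := fun s => unsusp m P s 0 *m aug P.
Arguments raug : clear implicits.

Lemma raug0 s : raug 0 s = augfam (aug P) s.
Proof.
case: s => [|s]; rewrite /raug /=; first by rewrite idfam_id mul1mx.
by rewrite idfam0 ?mul0mx.
Qed.

Lemma raug_hom m : cochain_hom (raug m).
Proof. by move=> s; apply: hom_mul (aug_hom P); apply: unsusp_hom. Qed.

Lemma raug_diff m s : diff (suspn m P) s *m raug m s = 0.
Proof.
by rewrite mulmxA unsusp_diff -scalemxAl -mulmxA diff_aug mulmx0 scaler0.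
Qed.

Lemma raug_contraction m : contraction m (raug m).
Proof.
elim: m => [|m IH].
  by apply: contraction_ext res_contraction => s; rewrite -raug0.
apply: contraction_ext (susp_contraction IH) => -[|s] //.
by rewrite /raug mul0mx.
Qed.

Lemma raug_ne m i : i != m -> raug m i = 0.
Proof. by move=> im; rewrite /raug unsusp0 ?mul0mx // addn0. Qed.

Lemma susp_res_cyc m i r (u : 'M_(r, mdim (suspn m P i))) :
  cyc u -> u *m raug m i = 0 -> exists u', u = u' *m diff (suspn m P) i.
Proof.
have [c [e [_ _ _ c0 cS]]] := raug_contraction m.
case: i u => [|i] u uc u0; exists (u *m c _); rewrite -mulmxA.
  rewrite -{1}[u]mulmx1 -c0 mulmxDr [u *m (raug m 0 *m _)]mulmxA u0 mul0mx addr0.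
  by rewrite mulmxA.
rewrite -{1}[u]mulmx1 -cS !mulmxDr [u *m (raug m _ *m _)]mulmxA u0 mul0mx addr0.
by rewrite [u *m (diff _ _ *m _)]mulmxA uc mul0mx addr0 mulmxA.
Qed.

Lemma raug_tens_qis m C : qis (cmap m (raug m) C).
Proof. by apply: cmap_qis (raug_contraction m); [apply: raug_hom | apply: raug_diff]. Qed.

Lemma raug_tens_chain m C : chain_map (cmap m (raug m) C).
Proof. by apply: cmap_chain; [apply: raug_hom | apply: raug_diff]. Qed.

(** The equivalence [P (x) C -> C]. *)
Definition eps C : gmap (tens P C) C := cmap 0 (raug 0) C.

Lemma eps_qis C : qis (eps C). Proof. exact: (@raug_tens_qis 0 C). Qed.
Lemma eps_chain C : chain_map (eps C). Proof. exact: (@raug_tens_chain 0 C). Qed.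

Lemma tens_res_higman C i : higman (tens P C i).
Proof. by apply: tens_higman => s; apply: res_higman. Qed.

Lemma eps_nat C D (f : gmap C D) i :
  tmap (gid P) f i *m eps D i = eps C i *m f i.
Proof. exact: (@cmap_nat _ _ _ P 0 (raug 0) C D f i). Qed.

(** Two out of three, as [eps] is a natural quasi-isomorphism. *)
Lemma tmap_qis C D (f : gmap C D) : chain_map f -> qis f -> qis (tmap (gid P) f).
Proof.
move=> fC fQ; apply: (qis_cancel (g := eps D)).
- by apply: tmap_chain => //; apply: chain_id.
- exact: eps_chain.
- exact: eps_qis.
apply: (qis_eq (f := gcomp (eps C) f)); first by move=> i; rewrite /gcomp eps_nat.
by apply: qis_comp => //; [apply: eps_chain | apply: eps_qis].
Qed.

(** Lifting the identity of [C] along [eps C] gives [s]; the other composite is a lift of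
    [eps C] along itself, hence homotopic to the identity. *)
Lemma eps_inverse C : (forall i, higman (C i)) ->
  exists s : gmap C (tens P C), [/\ chain_map s, homotopic (gcomp s (eps C)) (gid C)
    & homotopic (gcomp (eps C) s) (gid (tens P C))].
Proof.
move=> hC.
have [s sC se] := qis_lift hC (eps_chain C) (@eps_qis C) (chain_id C).
exists s; split=> //.
apply: (qis_homotopic (tens_res_higman C) (eps_chain C) (@eps_qis C)).
- by apply: chain_comp => //; apply: eps_chain.
- exact: chain_id.
apply: homotopic_trans (_ : homotopic _ (gcomp (eps C) (gid C))) _.
  apply: homotopic_trans (homotopic_compl (@eps_chain C) se).
  by apply: homotopic_eq => i; rewrite /gcomp mulmxA.
by apply: homotopic_eq => i; rewrite /gcomp /gid mul1mx mulmx1.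
Qed.

(** As [P (x) C] is a projective replacement of [C], this says that the class of [y]
    annihilates [C] in the derived category. *)
Definition kills N (y : cochain P) C : Prop :=
  homotopic (cmap N y C) (gzero (tens P C) (suspn N C)).

(** The modules of [C] and [D] need not be projective: the homotopies are moved along
    [P (x) f], which has a homotopy section, and along [Sigma^N f], which is cancelled
    after maps out of complexes of projectives. *)
Lemma kills_qis N (y : cochain P) C D (f : gmap C D) :
  cochain_hom y -> (forall s, diff P s *m y s = 0) ->
  chain_map f -> qis f -> kills N y C <-> kills N y D.
Proof.
move=> yH dy fC fQ.
have FC : chain_map (tmap (gid P) f) by apply: tmap_chain => //; apply: chain_id.
have FQ := tmap_qis fC fQ.
have yC E : chain_map (cmap N y E) by apply: cmap_chain.
have sC := suspm_chain N fC.
split=> [kC|kD].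
  have [g gC gF] := qis_lift (tens_res_higman D) FC FQ (chain_id _).
  rewrite /kills; apply: homotopic_trans (_ : homotopic (gcomp (gcomp g (tmap (gid P) f)) (cmap N y D)) _).
    apply: homotopic_trans (homotopic_compr (yC D) (homotopic_sym gF)).
    by apply: homotopic_eq => i; rewrite /gcomp /gid mul1mx.
  apply: homotopic_trans (_ : homotopic (gcomp g (gcomp (gzero _ _) (suspm N f))) _).
    apply: homotopic_trans (homotopic_compl gC (homotopic_compr sC kC)).
    by apply: homotopic_eq => i; rewrite /gcomp -mulmxA cmap_nat.
  by apply: homotopic_eq => i; rewrite /gcomp /gzero mul0mx mulmx0.
apply: (qis_null (tens_res_higman C) sC (suspm_qis N fQ) (yC C)).
apply: homotopic_trans (_ : homotopic (gcomp (tmap (gid P) f) (gzero _ _)) _).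
  apply: homotopic_trans (homotopic_compl FC kD).
  by apply: homotopic_eq => i; rewrite /gcomp cmap_nat.
by apply: homotopic_eq => i; rewrite /gcomp /gzero mulmx0.
Qed.

End OneResolution.
End Resolutions.

(** * Splicing a module onto a truncated complex *)

Section Sums.
Context {k : fieldType} {gT : finGroupType} {G : {group gT}}.
Implicit Types M N : kGmod k G.

Definition sel (b : bool) M : kGmod k G := if b then M else zero_mod.
Definition sel_in b M : 'M[k]_(mdim (sel b M), mdim M) :=
  match b return 'M_(mdim (sel b M), mdim M) with true => 1%:M | false => 0 end.
Definition sel_out b M : 'M[k]_(mdim M, mdim (sel b M)) :=
  match b return 'M_(mdim M, mdim (sel b M)) with true => 1%:M | false => 0 end.

Lemma sel_in_hom b M : is_hom (sel_in b M).
Proof. by case: b; [apply: hom1 | apply: hom0]. Qed.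
Lemma sel_out_hom b M : is_hom (sel_out b M).
Proof. by case: b; [apply: hom1 | apply: hom0]. Qed.
Lemma sel_in0 (b : bool) M : ~~ b -> sel_in b M = 0.
Proof. by case: b. Qed.
Lemma sel_out0 (b : bool) M : ~~ b -> sel_out b M = 0.
Proof. by case: b. Qed.
Lemma sel_inK b M : sel_in b M *m sel_out b M = 1%:M.
Proof. by case: b; [apply: mulmx1 | apply: no_rows]. Qed.
Lemma sel_outK b M : sel_out b M *m sel_in b M = b%:R%:M.
Proof. by case: b => /=; [apply: mulmx1 | rewrite mulmx0 raddf0]. Qed.

Lemma add_mx_repr M N : mx_repr G (fun x => block_mx (mrep M x) 0 0 (mrep N x)).
Proof.
split=> [|x y Gx Gy]; first by rewrite !repr_mx1 -scalar_mx_block.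
by rewrite mulmx_block !mul0mx !mulmx0 !addr0 !add0r !repr_mxM.
Qed.
Definition add_mod M N : kGmod k G := KGmod (MxRepresentation (add_mx_repr M N)).

Definition inl_mx M N : 'M[k]_(mdim M, mdim (add_mod M N)) := row_mx 1%:M 0.
Definition inr_mx M N : 'M[k]_(mdim N, mdim (add_mod M N)) := row_mx 0 1%:M.
Definition prl_mx M N : 'M[k]_(mdim (add_mod M N), mdim M) := col_mx 1%:M 0.
Definition prr_mx M N : 'M[k]_(mdim (add_mod M N), mdim N) := col_mx 0 1%:M.

Lemma inl_hom M N : is_hom (inl_mx M N).
Proof. by move=> x Gx; rewrite /inl_mx /inr_mx /= mul_mx_row mul_row_block !mulmx0 !mul0mx mulmx1 mul1mx !addr0. Qed.
Lemma inr_hom M N : is_hom (inr_mx M N).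
Proof. by move=> x Gx; rewrite /inl_mx /inr_mx /= mul_mx_row mul_row_block !mulmx0 !mul0mx mulmx1 mul1mx !add0r. Qed.
Lemma prl_hom M N : is_hom (prl_mx M N).
Proof. by move=> x Gx; rewrite /prl_mx /= mul_block_col mul_col_mx !mulmx0 !mul0mx mulmx1 mul1mx !addr0. Qed.
Lemma prr_hom M N : is_hom (prr_mx M N).
Proof. by move=> x Gx; rewrite /prr_mx /= mul_block_col mul_col_mx !mulmx0 !mul0mx mulmx1 mul1mx !add0r. Qed.
Lemma inl_prl M N : inl_mx M N *m prl_mx M N = 1%:M.
Proof. by rewrite mul_row_col mulmx1 mulmx0 addr0. Qed.
Lemma inr_prr M N : inr_mx M N *m prr_mx M N = 1%:M.
Proof. by rewrite mul_row_col mulmx1 mulmx0 add0r. Qed.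
Lemma inl_prr M N : inl_mx M N *m prr_mx M N = 0.
Proof. by rewrite mul_row_col mulmx1 mulmx0 addr0. Qed.
Lemma inr_prl M N : inr_mx M N *m prl_mx M N = 0.
Proof. by rewrite mul_row_col mulmx1 mulmx0 addr0. Qed.
Lemma add_mod_id M N : prl_mx M N *m inl_mx M N + prr_mx M N *m inr_mx M N = 1%:M.
Proof.
rewrite !mul_col_row !mulmx1 !mulmx0 ?mul0mx add_block_mx !addr0 !add0r.
by rewrite -scalar_mx_block.
Qed.

Lemma higman_add M N : higman M -> higman N -> higman (add_mod M N).
Proof.
move=> [t tE] [u uE].
exists (prl_mx M N *m t *m inl_mx M N + prr_mx M N *m u *m inr_mx M N).
rewrite avgD (avg_mulr _ (@inl_hom M N)) (avg_mulr _ (@inr_hom M N)).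
rewrite (avg_mull _ (@prl_hom M N)) (avg_mull _ (@prr_hom M N)).
by rewrite tE uE !mulmx1 add_mod_id.
Qed.

Lemma sel_higman (b : bool) M : (b -> higman M) -> higman (sel b M).
Proof. by case: b => [/(_ isT)|_] //=; apply: higman_zero. Qed.

End Sums.

Section Splice.
Context {k : fieldType} {gT : finGroupType} {G : {group gT}}.
Variables (C : complex k G) (n : nat) (L : kGmod k G).
Variable iota : 'M[k]_(mdim L, mdim (C n)).
Hypotheses (iotaH : is_hom iota) (iota_cyc : cyc iota).

(** The terms of the complex [L -> C_n -> ... -> C_0].  Each is the sum of a term of the
    truncation of [C] and a copy of [L] which is absent except in degree [n + 1]; so the
    maps to and from the summands are defined in all degrees. *)
Definition splice_obj i := add_mod (sel (i <= n)%N (C i)) (sel (i == n.+1) L).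

(** The projections and inclusions are locked: they are only used through the relations
    below. *)
Definition toC i : 'M[k]_(mdim (splice_obj i), mdim (C i)) :=
  locked (prl_mx _ _ *m sel_in (i <= n)%N (C i)).
Definition ofC i : 'M[k]_(mdim (C i), mdim (splice_obj i)) :=
  locked (sel_out (i <= n)%N (C i) *m inl_mx _ _).
Definition toL i : 'M[k]_(mdim (splice_obj i), mdim L) :=
  locked (prr_mx _ _ *m sel_in (i == n.+1) L).
Definition ofL i : 'M[k]_(mdim L, mdim (splice_obj i)) :=
  locked (sel_out (i == n.+1) L *m inr_mx _ _).

Lemma toC_hom i : is_hom (toC i).
Proof. by rewrite /toC -lock; apply: hom_mul; [apply: prl_hom | apply: sel_in_hom]. Qed.
Lemma ofC_hom i : is_hom (ofC i).
Proof. by rewrite /ofC -lock; apply: hom_mul; [apply: sel_out_hom | apply: inl_hom]. Qed.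
Lemma toL_hom i : is_hom (toL i).
Proof. by rewrite /toL -lock; apply: hom_mul; [apply: prr_hom | apply: sel_in_hom]. Qed.
Lemma ofL_hom i : is_hom (ofL i).
Proof. by rewrite /ofL -lock; apply: hom_mul; [apply: sel_out_hom | apply: inr_hom]. Qed.

Lemma ofC_toC i : ofC i *m toC i = (i <= n)%N%:R%:M.
Proof. by rewrite /toC /ofC /toL /ofL -!lock mulmxA -[X in X *m _]mulmxA inl_prl mulmx1 sel_outK. Qed.
Lemma ofL_toL i : ofL i *m toL i = (i == n.+1)%:R%:M.
Proof. by rewrite /toC /ofC /toL /ofL -!lock mulmxA -[X in X *m _]mulmxA inr_prr mulmx1 sel_outK. Qed.
Lemma ofC_toL i : ofC i *m toL i = 0.
Proof. by rewrite /toC /ofC /toL /ofL -!lock mulmxA -[X in X *m _]mulmxA inl_prr mulmx0 mul0mx. Qed.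
Lemma ofL_toC i : ofL i *m toC i = 0.
Proof. by rewrite /toC /ofC /toL /ofL -!lock mulmxA -[X in X *m _]mulmxA inr_prl mulmx0 mul0mx. Qed.
Lemma splice_id i : toC i *m ofC i + toL i *m ofL i = 1%:M.
Proof.
rewrite /toC /ofC /toL /ofL -!lock !mulmxA -[X in X *m _ + _]mulmxA -[X in _ + X *m _]mulmxA !sel_inK !mulmx1.
exact: add_mod_id.
Qed.
Lemma toC0 i : (n < i)%N -> toC i = 0.
Proof. by move=> ni; rewrite /toC -lock sel_in0 ?mulmx0 // -ltnNge. Qed.
Lemma ofC0 i : (n < i)%N -> ofC i = 0.
Proof. by move=> ni; rewrite /ofC -lock sel_out0 ?mul0mx // -ltnNge. Qed.
Lemma toL0 i : i != n.+1 -> toL i = 0.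
Proof. by move=> ni; rewrite /toL -lock sel_in0 ?mulmx0. Qed.

Definition trunc_obj i := sel (i <= n)%N (C i).
Definition trunc_in i : 'M[k]_(mdim (trunc_obj i), mdim (splice_obj i)) :=
  locked (inl_mx _ _).
Definition trunc_out i : 'M[k]_(mdim (splice_obj i), mdim (trunc_obj i)) :=
  locked (prl_mx _ _).

Lemma trunc_inK i : trunc_in i *m trunc_out i = 1%:M.
Proof. rewrite /trunc_in /trunc_out -!lock; exact: inl_prl. Qed.
Lemma trunc_in_hom i : is_hom (trunc_in i).
Proof. rewrite /trunc_in -lock; exact: inl_hom. Qed.
Lemma trunc_out_hom i : is_hom (trunc_out i).
Proof. rewrite /trunc_out -lock; exact: prl_hom. Qed.
Lemma trunc_in_toC i : trunc_in i *m toC i = sel_in (i <= n)%N (C i).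
Proof. by rewrite /trunc_in /toC /toL -!lock mulmxA inl_prl mul1mx. Qed.
Lemma trunc_in_toL i : trunc_in i *m toL i = 0.
Proof. by rewrite /trunc_in /toC /toL -!lock mulmxA inl_prr mul0mx. Qed.
Lemma sel_out_trunc_in i : sel_out (i <= n)%N (C i) *m trunc_in i = ofC i.
Proof. by rewrite /trunc_in /ofC -!lock. Qed.
Lemma trunc_outK i : i != n.+1 -> trunc_out i *m trunc_in i = 1%:M.
Proof.
move=> ni; rewrite -[RHS]splice_id toL0 // mul0mx addr0.
by rewrite /toC /ofC /trunc_in /trunc_out -!lock mulmxA -[_ *m sel_in _ _ *m _]mulmxA sel_inK mulmx1.
Qed.

Definition splice_diff i : 'M[k]_(mdim (splice_obj i.+1), mdim (splice_obj i)) :=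
  (toC i.+1 *m diff C i + toL i.+1 *m iota *m idfam C n i) *m ofC i.

Lemma splice_diff_hom i : is_hom (splice_diff i).
Proof.
apply: hom_mul; last exact: ofC_hom.
apply: hom_add.
  by apply: hom_mul (diff_hom C i); apply: toC_hom.
apply: hom_mul (idfam_hom C n i); apply: hom_mul iotaH; exact: toL_hom.
Qed.

Lemma iota_idfam i : iota *m idfam C n i.+1 *m diff C i = 0.
Proof.
have [e|ne] := eqVneq n i.+1; last by rewrite idfam0 // mulmx0 mul0mx.
by move: iota iota_cyc; rewrite e => io ioc; rewrite idfam_id mulmx1.
Qed.

Lemma splice_diffK i : splice_diff i.+1 *m splice_diff i = 0.
Proof.
have E : ofC i.+1 *m (toC i.+1 *m diff C i + toL i.+1 *m iota *m idfam C n i) =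
    (i < n)%N%:R *: diff C i.
  rewrite mulmxDr !mulmxA ofC_toC ofC_toL !mul0mx addr0.
  by rewrite mul_scalar_mx.
rewrite /splice_diff -mulmxA [ofC _ *m _]mulmxA E -scalemxAl -scalemxAr mulmxA.
rewrite mulmxDl -[X in (X + _) *m _]mulmxA diffK mulmx0 add0r -[toL _ *m _ *m _]mulmxA.
by rewrite -[toL _ *m _ *m _]mulmxA iota_idfam mulmx0 mul0mx scaler0.
Qed.

Definition splice : complex k G := Complex splice_diff_hom splice_diffK.

Lemma splice_high i : (n.+1 < i)%N -> mdim (splice i) = 0%N.
Proof.
move=> ni; rewrite /= /sel leqNgt (ltnW ni) /=.
by case: eqVneq ni => [->|]; rewrite ?ltnn.
Qed.

Lemma splice_higman i : (forall j, higman (C j)) -> (i <= n)%N -> higman (splice i).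
Proof.
move=> hC ni; apply: higman_add; apply: sel_higman => //.
by move/eqP=> e; rewrite e ltnn in ni.
Qed.

Definition trunc_diff i : 'M[k]_(mdim (trunc_obj i.+1), mdim (trunc_obj i)) :=
  sel_in (i < n)%N (C i.+1) *m diff C i *m sel_out (i <= n)%N (C i).

Lemma trunc_diff_hom i : is_hom (trunc_diff i).
Proof.
apply: hom_mul; last exact: sel_out_hom.
by apply: hom_mul (diff_hom C i); apply: sel_in_hom.
Qed.

Lemma trunc_diffK i : trunc_diff i.+1 *m trunc_diff i = 0.
Proof.
rewrite /trunc_diff -!mulmxA [sel_out _ _ *m _]mulmxA sel_outK mul_scalar_mx.
by rewrite -!scalemxAr [diff _ _ *m (diff _ _ *m _)]mulmxA diffK mul0mx mulmx0 scaler0.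
Qed.

Definition trunc : complex k G := Complex trunc_diff_hom trunc_diffK.

Lemma trunc_higman i : (forall j, higman (C j)) -> higman (trunc i).
Proof. by move=> hC; apply: sel_higman. Qed.

Lemma trunc_high i : (n < i)%N -> mdim (trunc i) = 0%N.
Proof. by move=> ni; rewrite /= /trunc_obj /sel leqNgt ni. Qed.

Lemma trunc_in_chain : chain_map (trunc_in : gmap trunc splice).
Proof.
split=> i; first exact: trunc_in_hom.
rewrite /= /splice_diff mulmxA mulmxDr !mulmxA trunc_in_toC trunc_in_toL.
by rewrite !mul0mx addr0 /trunc_diff -[RHS]mulmxA sel_out_trunc_in.
Qed.

End Splice.

Section SpliceKills.
Context {k : fieldType} {gT : finGroupType} {G : {group gT}}.
Local Notation kk := (@triv_mod k gT G).
Variables (P : resolution kk) (n : nat) (y : cochain P).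
Hypotheses (yH : cochain_hom y) (dy : forall s, diff P s *m y s = 0).
Variables (C : complex k G) (L : kGmod k G) (iota : 'M[k]_(mdim L, mdim (C n))).
Hypotheses (hC : forall i, higman (C i)).
Hypotheses (iotaH : is_hom iota) (iota_cyc : cyc iota) (iota_free : row_free iota).

Local Notation V := (splice iotaH iota_cyc).
Local Notation X := (trunc C n).
Local Notation D := (tens P V).
Local Notation T := (suspn n.+1 V).
Local Notation yV := (cmap n.+1 y V).

Local Notation toC := (toC C n L).
Local Notation ofC := (ofC C n L).
Local Notation toL := (toL C n L).
Local Notation ofL := (ofL C n L).

Lemma splice_exact i r (a : 'M_(r, mdim (V i))) :
  (n < i)%N -> cyc a -> exists a', a = a' *m diff V i.
Proof.
move=> ni ac; exists 0; rewrite mul0mx.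
have [e|ne] := eqVneq i n.+1; last by apply: no_cols; apply: splice_high; lia.
rewrite e /= in a ac *.
rewrite -[a]mulmx1 -splice_id toC0 // mul0mx add0r mulmxA.
suff -> : a *m toL n.+1 = 0 by rewrite mul0mx.
apply: (row_free_inj iota_free); rewrite mul0mx /=.
have : a *m splice_diff iota n *m toC n = 0 by rewrite ac mul0mx.
rewrite /splice_diff toC0 // mul0mx add0r idfam_id mulmx1 -!mulmxA ofC_toC leqnn.
by rewrite mulmx1.
Qed.

Lemma tens_splice_exact i r (a : 'M_(r, mdim (D i))) :
  (n < i)%N -> cyc a -> exists a', a = a' *m diff D i.
Proof.
move=> ni ac.
have ec : cyc (a *m eps P V i) by apply: cyc_map => //; apply: eps_chain.
have [v Ev] := splice_exact ni ec.
exact: (eps_qis P V).1 ac Ev.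
Qed.

Lemma T_high i : (n.+1 + n.+1 < i)%N -> mdim (T i) = 0%N.
Proof.
move=> ni; have E : i = (n.+1 + (i - n.+1))%N by rewrite subnKC //; lia.
by rewrite (suspn_obj V E); apply: splice_high; lia.
Qed.

(** The only term of [Sigma^N V] that may fail to be projective is [L], in degree [2 N]. *)
Lemma T_higman i : i != (n.+1 + n.+1)%N -> higman (T i).
Proof.
move=> ne; have [i_lt|i_ge] := ltnP i n.+1.
  by apply: higman_empty; apply: suspn_small.
have E : i = (n.+1 + (i - n.+1))%N by rewrite subnKC.
have [gt|le] := ltnP (n.+1 + n.+1) i; first by apply: higman_empty; apply: T_high.
by rewrite (suspn_obj V E); apply: splice_higman => //; lia.
Qed.

Lemma yV_chain : chain_map yV. Proof. exact: cmap_chain. Qed.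

(** A null-homotopy of [y (x) V], required only in degrees above [m]. *)
Definition high_homotopy m := exists h : forall i, 'M[k]_(mdim (D i), mdim (T i.+1)),
  (forall i, is_hom (h i)) /\
  (forall i, (m <= i)%N -> yV i.+1 = h i.+1 *m diff T i.+1 + diff D i *m h i).

(** The homotopy in degree [m] is an extension along [D_(m+1) -> D_m] of a map which
    vanishes on the cycles; it exists by injectivity of the target.  In degrees below [N]
    the target is zero. *)
Lemma high_homotopy_step m :
  (m.+1 < n.+1 + n.+1)%N -> high_homotopy m.+1 -> high_homotopy m.
Proof.
move=> mn [h [hH hE]]; have [yVH yVd] := yV_chain.
have [m_lt|m_ge] := ltnP m.+1 n.+1.
  exists h; split=> // i; rewrite leq_eqVlt => /orP[/eqP<-|]; last exact: hE.
  by apply: no_cols; apply: suspn_small.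
pose v := yV m.+1 - h m.+1 *m diff T m.+1.
have vH : is_hom v by apply: hom_sub => //; apply: hom_mul (diff_hom _ _).
have kv : (kermx (diff D m) <= kermx v)%MS.
  apply/sub_kermxP; have [||a ->] := @tens_splice_exact m.+1 _ (kermx (diff D m)).
  - by lia.
  - exact: mulmx_ker.
  rewrite -mulmxA mulmxBr -yVd hE // mulmxDl -!mulmxA diffK mulmx0 add0r subrr.
  by rewrite mulmx0.
have [h' h'H Eh'] := higman_extend (T_higman (negbT (ltn_eqF mn))) vH (diff_hom D m) kv.
exists (fun i => if i == m then conform_mx 0 h' else h i); split=> i.
  case: eqVneq => [->|_] //; rewrite ?conform_mx_id //.
rewrite leq_eqVlt => /orP[/eqP<-|mi].
  by rewrite eqxx conform_mx_id Eh' gtn_eqF // /v addrC subrK.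
by rewrite !gtn_eqF ?hE // ltnW.
Qed.

(** The null-homotopy for [L] gives one in degrees [2 N - 1] and above, where the target
    is only [L]; it is then extended downwards. *)
Lemma splice_kills :
  coboundary (N := L) (tensm_map L (y n.+1)) -> kills n.+1 y V.
Proof.
case=> hL hLH EL.
suff [h [hH hE]] : high_homotopy 0.
  exists h; rewrite /gzero; split=> // [|i]; last by rewrite subr0 hE.
  exact: no_cols.
have down m : (m <= n + n.+1)%N -> high_homotopy m -> high_homotopy 0.
  elim: m => // m IH mn hm; apply: IH; first by lia.
  by apply: high_homotopy_step hm; rewrite addSn ltnS.
apply: down (leqnn _) _.
pose h i : 'M[k]_(mdim (D i), mdim (T i.+1)) := tcase (C := P) (D := V) i
  (fun s t => (idfam P s n *t toL t) *m hL *m ofL n.+1 *m tosusp n.+1 V n.+1 i.+1).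
exists h; split=> i.
  apply: tcase_hom => s t _.
  have tH : is_hom (M := tens_mod (P s) (V t)) (N := tens_mod (P n) L) (idfam P s n *t toL t).
    by apply: hom_tens; [apply: idfam_hom | apply: toL_hom].
  apply: hom_mul (tosusp_hom _ _ _ _); apply: hom_mul (ofL_hom _ _ _ _).
  exact: hom_mul tH hLH.
rewrite leq_eqVlt => /orP[/eqP<-{i}|ni]; last first.
  by apply: no_cols; apply: T_high; rewrite addSn ltnS.
set i := (n + n.+1)%N.
rewrite (_ : h i.+1 *m _ = 0) ?add0r; last first.
  rewrite (_ : h i.+1 = 0) ?mul0mx //; apply: no_cols; apply: T_high.
  by rewrite /i; lia.
apply: tens_ext => s t sti; rewrite tin_cmap // mulmxA tin_diff // mulmxDl -scalemxAl.
rewrite (_ : tdiffr _ _ _ _ _ *m _ = 0) ?scaler0 ?addr0; last first.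
  case: t sti => [|t] sti; first by rewrite /= mul0mx.
  rewrite /tdiffr -mulmxA tin_case; last by move: sti; rewrite addnS => -[].
  rewrite !mulmxA tensmx_mul mul1mx (_ : diff V t *m toL t = 0) ?tensmx0 ?mul0mx //.
  by rewrite /= /splice_diff -[LHS]mulmxA ofC_toL mulmx0.
have [tN|tN] := eqVneq t n.+1; last first.
  rewrite tosusp0 ?ftens0r; last by apply: contraNN tN; rewrite /i -addSn eqn_add2l eq_sym.
  case: s sti => [|s] sti; first by rewrite mul0mx.
  rewrite /tdiffl -mulmxA tin_case; last by case: sti.
  by rewrite toL0 // tensmx0 !mul0mx mulmx0.
subst t; have -> : s = n.+1 by move: sti; rewrite /i; lia.
rewrite /tdiffl -mulmxA tin_case // idfam_id !mulmxA tensmx_mul mulmx1 mul1mx.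
have -> : diff P n *t toL n.+1 = (1%:M *t toL n.+1) *m tensm_diff P L n.
  by rewrite tensmx_mul mul1mx mulmx1.
rewrite -[_ *m tensm_diff _ _ _ *m _]mulmxA -EL.
have -> : tensm_map L (y n.+1) = ftens (y n.+1) 1%:M by [].
rewrite tens_ftens mul1mx mulmx1 !ftens_mul; congr ftens.
have /esym := splice_id C n L n.+1; rewrite toC0 // mul0mx add0r => <-.
by rewrite mul1mx.
Qed.

(** [P (x) X] is homotopy equivalent to [X], which vanishes above degree [n]. *)
Lemma trunc_null i : (n <= i)%N ->
  exists K, exists K', [/\ is_hom K, is_hom K' &
  (1%:M : 'M_(mdim (tens P X i.+1))) =
    K' *m diff (tens P X) i.+1 + diff (tens P X) i *m (K : 'M_(mdim (tens P X i), mdim (tens P X i.+1)))].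
Proof.
move=> ni; have hX j : higman (X j) by apply: trunc_higman.
have [g [gC _ [K [KH _ KS]]]] := eps_inverse P hX.
exists (- K i), (- K i.+1); split; try exact: hom_opp.
have := KS i; rewrite /gcomp /gid (_ : eps P X i.+1 *m _ = 0).
  by rewrite mulNmx mulmxN -opprD => <-; rewrite sub0r opprK.
rewrite (_ : eps P X i.+1 = 0) ?mul0mx //; apply: no_cols.
exact: trunc_high.
Qed.

(** The part [kappa] of the homotopy with values in [L] is a cocycle on [P (x) X], hence a
    coboundary there.  Subtracting that coboundary from [kappa] does not change its
    boundary, and what is left lives on [P_n (x) L]. *)
Lemma kills_splice :
  kills n.+1 y V -> coboundary (N := L) (tensm_map L (y n.+1)).
Proof.
case=> h [hH _ hS].
pose i := (n + n)%N; pose kappa := h i.+1.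
have Ey : yV i.+2 = diff D i.+1 *m kappa.
  have := hS i.+1; rewrite /gzero subr0 => ->.
  rewrite (_ : h i.+2 = 0) ?mul0mx ?add0r //; apply: no_cols; apply: T_high.
  by rewrite /i; lia.
(* [J] and [Pr] are the inclusion of [P (x) X] and its graded retraction. *)
pose J := tmap (gid P) (trunc_in C n L : gmap X V).
have [JH Jd] : chain_map J.
  by apply: tmap_chain; [apply: chain_id | apply: trunc_in_chain].
pose Pr := tmap (gid P) (trunc_out C n L : gmap V X).
have JPr j : J j *m Pr j = 1%:M.
  apply: tens_ext => s t st; rewrite mulmxA tin_tmap // -mulmxA tin_tmap //.
  by rewrite mulmxA tensmx_mul trunc_inK mul1mx tens11 mulmx1 mul1mx.
have du : diff (tens P X) i.+1 *m (J i.+1 *m kappa) = 0.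
  rewrite mulmxA -Jd -mulmxA -Ey cmap_nat (_ : cmap _ _ _ _ = 0) ?mul0mx //.
  have e : i.+2 = (n.+1 + n.+1)%N by rewrite /i; lia.
  by apply: no_cols; rewrite (suspn_obj X e); apply: trunc_high.
have [|K [K' [KH K'H EK]]] := @trunc_null i; first exact: leq_addr.
pose g := K *m (J i.+1 *m kappa).
have Eu : J i.+1 *m kappa = diff (tens P X) i *m g.
  rewrite -[LHS]mul1mx EK mulmxDl -[K' *m _ *m _]mulmxA du mulmx0 add0r.
  by rewrite /g [RHS]mulmxA.
pose kappa' := kappa - diff D i *m (Pr i *m g).
have Jk : J i.+1 *m kappa' = 0.
  rewrite mulmxBr [X in _ - X]mulmxA Jd -mulmxA [J i *m _]mulmxA JPr mul1mx Eu.
  by rewrite subrr.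
have Ey' : yV i.+2 = diff D i.+1 *m kappa'.
  by rewrite mulmxBr -Ey [X in _ - X]mulmxA diffK mul0mx subr0.
have ein : (n + n.+1)%N = i.+1 by rewrite addnS.
pose hL : 'M_(mdim (tens_mod (P n) L), mdim L) :=
  (1%:M *t ofL n.+1) *m tin P V i.+1 n n.+1 *m kappa' *m unsusp n.+1 V i.+2 n.+1 *m toL n.+1.
exists hL.
  have tH : is_hom (M := tens_mod (P n) L) (N := tens_mod (P n) (V n.+1)) (1%:M *t ofL n.+1).
    by apply: hom_tens; [apply: hom1 | apply: ofL_hom].
  have PrH : is_hom (Pr i).
    by apply: tmap_hom => j; [apply: hom1 | apply: trunc_out_hom].
  have gH : is_hom g := hom_mul KH (hom_mul (JH i.+1) (hH i.+1)).
  have kH : is_hom kappa'.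
    exact: (hom_sub (hH i.+1) (hom_mul (diff_hom D i) (hom_mul PrH gH))).
  have uH : is_hom (M := T i.+2) (N := V n.+1) (unsusp n.+1 V i.+2 n.+1) := unsusp_hom _ _ _ _.
  have iH := tin_hom P V i.+1 n n.+1.
  have toLH : is_hom (M := V n.+1) (N := L) (toL n.+1) := toL_hom _ _ _ _.
  exact: hom_mul (hom_mul (hom_mul (hom_mul tH iH) kH) uH) toLH.
have -> : tensm_map L (y n.+1) = ftens (y n.+1) 1%:M by [].
rewrite /hL /= /tensm_diff !mulmxA tensmx_mul mulmx1 mul1mx.
have -> : diff P n *t ofL n.+1 = (1%:M *t ofL n.+1) *m (diff P n *t 1%:M).
  by rewrite tensmx_mul mul1mx mulmx1.
have eN : (n.+1 + n.+1)%N = i.+2 by rewrite addSn ein.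
have El : (diff P n *t (1%:M : 'M_(mdim (V n.+1)))) *m tin P V i.+1 n n.+1 *m kappa' =
    ftens (y n.+1) (tosusp n.+1 V n.+1 i.+2).
  rewrite -(tin_cmap n.+1 y V eN) Ey' mulmxA tin_diff // mulmxDl.
  rewrite -[LHS]addr0; congr (_ + _); apply/esym.
  rewrite -scalemxAl /tdiffr -mulmxA.
  have -> : tin P V i.+1 n.+1 n = (1%:M *t trunc_out C n L n) *m (tin P X i.+1 n.+1 n *m J i.+1).
    rewrite /J tin_tmap; last by rewrite addSn.
    by rewrite mulmxA tensmx_mul mulmx1 trunc_outK ?tens11 ?mul1mx // ltn_eqF.
  by rewrite -!mulmxA Jk !mulmx0 scaler0.
rewrite -!mulmxA [X in _ *m X](_ : _ =
  ftens (y n.+1) (tosusp n.+1 V n.+1 i.+2) *m (unsusp n.+1 V i.+2 n.+1 *m toL n.+1)); last first.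
  by rewrite -El !mulmxA.
rewrite ftens_mul tens_ftens mul1mx; congr ftens.
by rewrite [tosusp _ _ _ _ *m _]mulmxA tosuspK ?eN // mul1mx ofL_toL eqxx.
Qed.
End SpliceKills.

(** * Homology of the complex P(zeta) *)

Section Extension.
Context {k : fieldType} {gT : finGroupType} {G : {group gT}}.
Local Notation kk := (@triv_mod k gT G).
Variables (P : resolution kk) (n : nat) (B : complex k G).
Variables (i : gmap (suspn n P) B) (q : gmap B P) (s : gmap P B).
Variable alpha : gmap P (suspn n.+1 P).
Hypothesis iC : chain_map i.
Hypothesis qC : chain_map q.
Hypothesis i_free : forall j, row_free (i j).
Hypothesis iq : forall j, (kermx (q j) == i j)%MS.
Hypothesis alphaC : chain_map alpha.
Hypothesis sH : forall j, is_hom (s j).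
Hypothesis sq : forall j, s j *m q j = 1%:M.
Hypothesis sd : forall j, s j.+1 *m diff B j =
  diff P j *m s j + (alpha j.+1 : 'M_(mdim (P j.+1), mdim (suspn n P j))) *m i j.

Local Notation A := (suspn n P).

(** The retraction onto [Sigma^n P] complementary to the section [s]. *)
Definition retr : gmap B A := fun j => (1%:M - q j *m s j) *m pinvmx (i j).

Lemma i_q j : i j *m q j = 0.
Proof. by apply/sub_kermxP; rewrite (eqmxP (iq j)). Qed.

Lemma retrE j : retr j *m i j = 1%:M - q j *m s j.
Proof.
apply: mulmxKpV; rewrite -(eqmxP (iq j)); apply/sub_kermxP.
by rewrite mulmxBl mul1mx -mulmxA sq mulmx1 subrr.
Qed.

Lemma ext_id j : q j *m s j + retr j *m i j = 1%:M.
Proof. by rewrite retrE addrC subrK. Qed.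

Lemma i_retr j : i j *m retr j = 1%:M.
Proof.
apply: (row_free_inj (i_free j)) => /=.
by rewrite -mulmxA retrE mulmxBr mulmxA i_q mul0mx subr0 mulmx1 mul1mx.
Qed.

Lemma s_retr j : s j *m retr j = 0.
Proof.
apply: (row_free_inj (i_free j)) => /=.
by rewrite -mulmxA retrE mulmxBr mulmxA sq mul1mx mulmx1 subrr mul0mx.
Qed.

Lemma retr_hom j : is_hom (retr j).
Proof.
apply: (hom_cancel_free (i_free j)); first exact: iC.1.
by rewrite retrE; apply: hom_sub; [apply: hom1 | apply: hom_mul (sH j); apply: qC.1].
Qed.

Lemma ext_higman j : higman (B j).
Proof.
have [t tE] := res_higman P j.
have [u uE] : higman (A j).
  have [lt|le] := ltnP j n; first by apply: higman_empty; apply: suspn_small.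
  by rewrite (suspn_obj P (esym (subnKC le))); apply: res_higman.
exists (q j *m t *m s j + retr j *m u *m i j).
rewrite avgD (avg_mulr _ (sH j)) (avg_mulr _ (iC.1 j)).
rewrite (avg_mull _ (qC.1 j)) (avg_mull _ (retr_hom j)).
by rewrite tE uE !mulmx1 ext_id.
Qed.

Lemma retr_diff j : diff B j *m retr j =
  q j.+1 *m (alpha j.+1 : 'M_(mdim (P j.+1), mdim (A j))) + retr j.+1 *m diff A j.
Proof.
rewrite -[LHS]mul1mx -ext_id mulmxDl -!mulmxA.
rewrite [s _ *m _]mulmxA sd mulmxDl -!mulmxA s_retr i_retr mulmx0 add0r mulmx1.
by rewrite [i _ *m _]mulmxA iC.2 -[diff A j *m _ *m _]mulmxA i_retr mulmx1.
Qed.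

(** The cocycle [y] of the extension.  Its pullback to [B] is the coboundary of the
    linear form [ext_primitive] on [B_n]. *)
Definition ext_cocycle : cochain P := fun j => alpha j *m raug P n.+1 j.
Definition ext_primitive : cochain B := fun j => retr j *m raug P n j.

Lemma ext_cocycle_hom : cochain_hom ext_cocycle.
Proof. by move=> j; apply: hom_mul (alphaC.1 j) (@raug_hom _ _ _ P n.+1 j). Qed.

Lemma ext_cocycle_diff j : diff P j *m ext_cocycle j = 0.
Proof. by rewrite mulmxA -alphaC.2 -mulmxA raug_diff mulmx0. Qed.

Lemma ext_primitive_hom : cochain_hom ext_primitive.
Proof. by move=> j; apply: hom_mul (retr_hom j) (@raug_hom _ _ _ P n j). Qed.

Lemma ext_cocycleS j :
  ext_cocycle j.+1 = (alpha j.+1 : 'M_(_, mdim (A j))) *m raug P n j.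
Proof. by []. Qed.

Lemma ext_primitive_diff j : diff B j *m ext_primitive j = q j.+1 *m ext_cocycle j.+1.
Proof.
rewrite mulmxA retr_diff mulmxDl -[X in _ + X]mulmxA raug_diff mulmx0 addr0.
by rewrite -mulmxA.
Qed.

Lemma cobound_ext_primitive j : cobound ext_primitive j = q j *m ext_cocycle j.
Proof.
case: j => [|j]; last exact: ext_primitive_diff.
by rewrite /ext_cocycle /raug /= mul0mx !mulmx0.
Qed.

(** The long exact sequence of the extension: subtracting the boundary of [s p] moves [b]
    into [Sigma^n P], where the only obstruction to being a boundary is the value of the
    augmentation. *)
Lemma ext_exact j r (b : 'M_(r, mdim (B j))) (p : 'M_(r, mdim (P j.+1))) :
  cyc b -> b *m q j = p *m diff P j ->
  b *m ext_primitive j = p *m ext_cocycle j.+1 -> exists b', b = b' *m diff B j.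
Proof.
move=> bc bq br; pose c := b - p *m s j.+1 *m diff B j.
have cc : cyc c by apply: cyc_sub => //; apply: cyc_diff.
have cq : c *m q j = 0.
  rewrite mulmxBl bq -!mulmxA -qC.2 [s _ *m _]mulmxA sq mul1mx.
  by rewrite subrr.
have cE : c = c *m retr j *m i j.
  by rewrite -mulmxA retrE mulmxBr mulmxA cq mul0mx subr0 mulmx1.
have [||u Eu] := @susp_res_cyc _ _ _ P n j _ (c *m retr j).
- case: (j) (c) cc cE => //= j' c' cc' cE'.
  apply: (row_free_inj (i_free j')) => /=.
  by rewrite mul0mx -mulmxA -iC.2 mulmxA -cE'.
- rewrite -mulmxA -/(ext_primitive j) mulmxBl br -!mulmxA.
  rewrite [s _ *m _]mulmxA sd mulmxDl -!mulmxA [s _ *m _]mulmxA s_retr mul0mx mulmx0 add0r.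
  by rewrite [i _ *m _]mulmxA i_retr mul1mx ext_cocycleS subrr.
exists (p *m s j.+1 + u *m i j.+1).
by rewrite mulmxDl -[u *m _ *m _]mulmxA iC.2 [u *m _]mulmxA -Eu -cE addrC subrK.
Qed.

(** The generator of the homology coming from [Sigma^n P], in degree [n]. *)
Lemma ext_class : exists e : 'M[k]_(1, mdim (B n)),
  [/\ cyc e, e *m q n = 0 & e *m ext_primitive n = 1%:M].
Proof.
have [c [e [ew _ _ _ _]]] := raug_contraction P n.
exists (e n *m i n); split.
- apply: cyc_map => //; case: (n) (e n) => //= m f.
  by apply: no_cols; apply: (@suspn_small _ _ _ m.+1 P m).
- by rewrite -mulmxA i_q mulmx0.
- by rewrite -mulmxA [i n *m _]mulmxA i_retr mul1mx.
Qed.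

Lemma ext_aug : exists e : 'M[k]_(1, mdim (B 0%N)), e *m q 0%N *m aug P = 1%:M.
Proof.
have /row_fullP[e eE] := aug_full P.
by exists (e *m s 0%N); rewrite -[e *m _ *m _]mulmxA sq mulmx1.
Qed.

End Extension.

(** * P(zeta) and the spliced complex are quasi-isomorphic *)

Section Kernels.
Context {k : fieldType} {gT : finGroupType} {G : {group gT}}.
Local Notation kk := (@triv_mod k gT G).

Section Kernel.
Variables (M N : kGmod k G) (f : 'M[k]_(mdim M, mdim N)) (fH : is_hom f).

Definition ker_in : 'M[k]_(mdim (ker_mod fH), mdim M) := val_submod 1%:M.

Lemma ker_in_hom : is_hom ker_in.
Proof.
move=> x Gx; rewrite /ker_in /= -val_submodE -[X in val_submod X]mul1mx.
by rewrite -[mrep M x]/(mrep M x) val_submodJ.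
Qed.

Lemma ker_in_free : row_free ker_in.
Proof.
apply/row_freeP; exists (in_submod (kermx f) 1%:M).
by rewrite -in_submodE val_submodK.
Qed.

Lemma ker_in0 : ker_in *m f = 0.
Proof. by apply/sub_kermxP; apply: val_submodP. Qed.

Lemma ker_inP r (x : 'M_(r, mdim M)) : x *m f = 0 -> x = in_submod (kermx f) x *m ker_in.
Proof. by move=> /sub_kermxP xk; rewrite -val_submodE in_submodK. Qed.
End Kernel.

Lemma omega_in (Pm : resolution kk) n :
  exists io : 'M[k]_(mdim (omega Pm n), mdim (Pm n)),
  [/\ is_hom io, row_free io, cyc io, io *m augfam (aug Pm) n = 0 &
      to_omega Pm n *m io = diff Pm n /\
      forall r (x : 'M_(r, mdim (Pm n))), cyc x -> x *m augfam (aug Pm) n = 0 ->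
        exists x', x = x' *m io].
Proof.
case: n => [|n].
  exists (ker_in (aug_hom Pm)); split; [exact: ker_in_hom|exact: ker_in_free|by []|exact: ker_in0|].
  split; first exact: (esym (ker_inP (aug_hom Pm) (diff_aug Pm))).
  by move=> r x _ x0; eexists; apply: (ker_inP (aug_hom Pm)).
exists (ker_in (diff_hom Pm n)); split.
- exact: ker_in_hom.
- exact: ker_in_free.
- exact: ker_in0.
- by rewrite /= mulmx0.
split; first exact: (esym (ker_inP (diff_hom Pm n) (diffK Pm n))).
by move=> r x x0 _; eexists; apply: (ker_inP (diff_hom Pm n)).
Qed.

End Kernels.

Section Comparison.
Context {k : fieldType} {gT : finGroupType} {G : {group gT}}.
Local Notation kk := (@triv_mod k gT G).
Variables (P Pm : resolution kk) (n : nat) (B : complex k G) (q : gmap B P).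
Variables (y : cochain P) (rb : cochain B).
Hypotheses (qC : chain_map q) (hB : forall j, higman (B j)).
Hypotheses (rbH : cochain_hom rb) (rb_ne : forall j, j != n -> rb j = 0).
Hypothesis y_ne : forall j, j != n.+1 -> y j = 0.
Hypothesis drb : forall j, diff B j *m rb j = q j.+1 *m y j.+1.
Hypothesis B_exact : forall j r (b : 'M_(r, mdim (B j))) (p : 'M_(r, mdim (P j.+1))),
  cyc b -> b *m q j = p *m diff P j -> b *m rb j = p *m y j.+1 ->
  exists b', b = b' *m diff B j.
Hypothesis B_class : exists e : 'M[k]_(1, mdim (B n)),
  [/\ cyc e, e *m q n = 0 & e *m rb n = 1%:M].
Hypothesis B_aug : exists e : 'M[k]_(1, mdim (B 0%N)), e *m q 0%N *m aug P = 1%:M.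

Variables (theta : gmap P Pm) (thC : chain_map theta).
Hypothesis th_aug : theta 0%N *m aug Pm = aug P.
Variables (zh : 'M[k]_(mdim (omega Pm n), mdim kk)) (zhH : is_hom zh).
Variable g : 'M[k]_(mdim (P n), mdim kk).
Hypothesis gH : is_hom g.
Hypothesis yz : y n.+1 - theta n.+1 *m (to_omega Pm n *m zh) = diff P n *m g.
Hypothesis zh_neq0 : zh != 0.

Local Notation L := (ker_mod zhH).

(** In degrees below [n] the map is [theta q].  In degree [n + 1] it should land in [L],
    so [theta q] has to be corrected in degree [n] by a map [w] into the syzygy with
    [w zh] the form [r' = rb - q g], whose coboundary is the pullback of the cocycle.
    Such a [w] exists because [zh] is surjective; this is where the class being nonzero
    enters.  On homology, the generator of [ext_class] hits the missing line
    [omega / L]. *)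
Lemma comparison : exists (iota : 'M[k]_(mdim L, mdim (Pm n))) (iotaH : is_hom iota)
  (iota_cyc : cyc iota) (f : gmap B (splice iotaH iota_cyc)),
  [/\ row_free iota, chain_map f & qis f].
Proof.
have [io [ioH io_free io_cyc io_aug [io_to io_P]]] := omega_in Pm n.
have [iL [iLH iL_free iL0 iL_P]] : exists iL : 'M_(mdim L, mdim (omega Pm n)),
    [/\ is_hom iL, row_free iL, iL *m zh = 0 & forall r (x : 'M_(r, mdim (omega Pm n))),
      x *m zh = 0 -> exists x', x = x' *m iL].
  exists (ker_in zhH); split; [exact: ker_in_hom|exact: ker_in_free|exact: ker_in0|].
  by move=> r x x0; eexists; apply: ker_inP.
have [iota iotaE] : exists iota, iota = iL *m io by eexists.
have iotaH : is_hom iota by rewrite iotaE; apply: hom_mul iLH ioH.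
have iota_cyc : cyc iota by rewrite iotaE; apply: cyc_mul.
have iota_free : row_free iota.
  have /row_freeP[a Ea] := iL_free; have /row_freeP[b Eb] := io_free.
  by apply/row_freeP; exists (b *m a); rewrite iotaE -mulmxA [io *m _]mulmxA Eb mul1mx.
have io_augi j : io *m idfam Pm n j *m augfam (aug Pm) j = 0.
  have [<-|ne] := eqVneq n j; first by rewrite idfam_id mulmx1.
  by rewrite idfam0 // mulmx0 mul0mx.
have io_di j : io *m idfam Pm n j.+1 *m diff Pm j = 0 by apply: iota_idfam.
pose r' : 'M_(mdim (B n), mdim kk) := rb n - q n *m g.
have r'H : is_hom r' by apply: hom_sub => //; apply: hom_mul gH; apply: qC.1.
have dr' : diff B n *m r' = q n.+1 *m (theta n.+1 *m (to_omega Pm n *m zh)).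
  rewrite mulmxBr drb [X in _ - X]mulmxA -qC.2 -[X in _ - X]mulmxA -yz -mulmxBr.
  by rewrite opprB addrCA subrr addr0.
have zh_full : row_full zh.
  by rewrite /row_full eqn_leq rank_leq_col lt0n mxrank_eq0.
have [w wH wzh] := higman_lift (hB n) r'H zhH (submx_full _ zh_full).
pose mu := q n.+1 *m theta n.+1 *m to_omega Pm n - diff B n *m w.
have mu_io : mu *m io = diff B n *m (q n *m theta n) - diff B n *m w *m io.
  rewrite mulmxBl; congr (_ - _).
  by rewrite -[LHS]mulmxA io_to -[LHS]mulmxA thC.2 [LHS]mulmxA qC.2 -[LHS]mulmxA.
have mu_zh : mu *m zh = 0.
  by rewrite mulmxBl -[X in _ - X]mulmxA wzh dr' !mulmxA subrr.
have [lam lam_iL] := iL_P _ _ mu_zh.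
have muH : is_hom (M := B n.+1) (N := omega Pm n) mu.
  apply: (hom_cancel_free io_free ioH); rewrite mu_io.
  apply: hom_sub; first by apply: hom_mul (diff_hom _ _) _; apply: hom_mul (qC.1 n) (thC.1 n).
  by apply: hom_mul ioH; apply: hom_mul (diff_hom _ _) wH.
have lamH : is_hom lam.
  by apply: (hom_cancel_free iL_free iLH); rewrite -lam_iL.
have dlam : diff B n.+1 *m lam = 0.
  apply: (row_free_inj iota_free); rewrite mul0mx /= iotaE mulmxA -[_ *m lam *m _]mulmxA -lam_iL.
  by rewrite -mulmxA mu_io mulmxBr !mulmxA diffK !mul0mx subrr.
exists iota, iotaH, iota_cyc.
pose V := splice iotaH iota_cyc.
have [W WE] : exists W : gmap B Pm,
  forall j, W j = idfam B j n *m w *m io *m idfam Pm n j by eexists.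
have [Lam LamE] : exists Lam : forall j, 'M_(mdim (B j), mdim L),
  forall j, Lam j = idfam B j n.+1 *m lam by eexists.
have [phi phiE] : exists phi : gmap B Pm,
  forall j, phi j = q j *m theta j - W j by eexists.
pose f j : 'M_(mdim (B j), mdim (V j)) :=
  phi j *m ofC Pm n L j + Lam j *m ofL Pm n L j.
have W0 j : j != n -> W j = 0 by move=> ne; rewrite WE idfam0 // !mul0mx.
have Wn : W n = w *m io by rewrite WE !idfam_id mul1mx mulmx1.
have Lam0 j : j != n.+1 -> Lam j = 0 by move=> ne; rewrite LamE idfam0 // mul0mx.
have Lamn : Lam n.+1 = lam by rewrite LamE idfam_id mul1mx.
have phiH j : is_hom (phi j).
  rewrite phiE WE; apply: hom_sub; first exact: hom_mul (qC.1 j) (thC.1 j).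
  exact: hom_mul (hom_mul (hom_mul (idfam_hom B j n) wH) ioH) (idfam_hom Pm n j).
have LamH j : is_hom (Lam j) by rewrite LamE; apply: hom_mul (idfam_hom B j n.+1) lamH.
have lam_iota : lam *m iota = diff B n *m phi n.
  by rewrite iotaE mulmxA -lam_iL mu_io phiE Wn mulmxBr !mulmxA.
have phid j : phi j.+1 *m diff Pm j = q j.+1 *m theta j.+1 *m diff Pm j.
  rewrite phiE mulmxBl [X in _ - X](_ : _ = 0) ?subr0 // WE -!mulmxA.
  by rewrite [io *m _]mulmxA io_di !mulmx0.
(* [D1] is the differential of [V] before the inclusion [ofC]. *)
pose D1 j : 'M_(mdim (splice_obj Pm n L j.+1), mdim (Pm j)) :=
  toC Pm n L j.+1 *m diff Pm j + toL Pm n L j.+1 *m iota *m idfam Pm n j.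
have EC j : ofC Pm n L j.+1 *m D1 j = (j < n)%N%:R *: diff Pm j.
  by rewrite mulmxDr !mulmxA ofC_toC ofC_toL !mul0mx addr0 mul_scalar_mx.
have EL j : ofL Pm n L j.+1 *m D1 j = (j == n)%:R *: (iota *m idfam Pm n j).
  by rewrite mulmxDr !mulmxA ofL_toC ofL_toL !mul0mx add0r eqSS -mulmxA mul_scalar_mx.
have fC : chain_map (f : gmap B V).
  split=> j; first exact: hom_add (hom_mul (phiH j) (ofC_hom _ _ _ j)) (hom_mul (LamH j) (ofL_hom _ _ _ j)).
  rewrite /f [RHS]mulmxDr [diff B j *m (Lam j *m _)]mulmxA.
  rewrite (_ : diff B j *m Lam j = 0) ?mul0mx ?addr0; last first.
    have [->|ne] := eqVneq j n.+1; last by rewrite Lam0 // mulmx0.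
    by rewrite Lamn dlam.
  rewrite /= /splice_diff [LHS]mulmxA [RHS]mulmxA; have [gt|] := boolP (n < j)%N.
    by rewrite [ofC Pm n L j]ofC0 // !mulmx0.
  rewrite -leqNgt => le.
  suff E : (phi j.+1 *m ofC Pm n L j.+1 + Lam j.+1 *m ofL Pm n L j.+1) *m D1 j =
    diff B j *m phi j by exact: (congr1 (fun X => X *m ofC Pm n L j) E).
  rewrite mulmxDl -!mulmxA EC EL -!scalemxAr.
  move: le; rewrite leq_eqVlt => /orP[/eqP e|lt].
    by rewrite e ltnn scale0r add0r eqxx scale1r Lamn idfam_id mulmx1 lam_iota.
  rewrite lt scale1r ltn_eqF // scale0r addr0 phid.
  by rewrite phiE W0 ?ltn_eqF // subr0 -mulmxA thC.2 mulmxA qC.2 -mulmxA.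
have diff_augfam j : diff Pm j *m augfam (aug Pm) j = 0.
  by case: j => [|j]; [apply: diff_aug | apply: mulmx0].
have phi_aug j : phi j *m augfam (aug Pm) j = q j *m augfam (aug P) j.
  rewrite phiE WE mulmxBl -!mulmxA [io *m _]mulmxA io_augi !mulmx0 subr0.
  by case: j => [|j] /=; [rewrite th_aug | rewrite !mulmx0].
have iota_augi j : iota *m idfam Pm n j *m augfam (aug Pm) j = 0.
  by rewrite [X in X *m idfam _ _ _]iotaE -!mulmxA [io *m _]mulmxA io_augi mulmx0.
have phi_cyc j r (b : 'M_(r, mdim (B j))) : cyc b -> cyc (b *m phi j).
  case: j b => //= j b bc; rewrite -mulmxA phid -[X in b *m X]mulmxA thC.2.
  by rewrite [X in b *m X]mulmxA qC.2 !mulmxA bc !mul0mx.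
have f_toC j : (j <= n)%N -> f j *m toC Pm n L j = phi j.
  move=> le; rewrite /f mulmxDl -!mulmxA ofC_toC ofL_toC mulmx0 addr0 le.
  by rewrite mul_mx_scalar scale1r.
have [dV dVE] : exists dV : forall j, 'M_(mdim (V j.+1), mdim (V j)),
  forall j, diff V j = dV j by eexists.
have d_toC j : (j <= n)%N -> dV j *m toC Pm n L j =
    toC Pm n L j.+1 *m diff Pm j + toL Pm n L j.+1 *m iota *m idfam Pm n j.
  move=> le; rewrite -dVE /= /splice_diff -[LHS]mulmxA ofC_toC le.
  by rewrite mul_mx_scalar scale1r.
have ofC_dV j : ofC Pm n L j.+1 *m dV j = (j < n)%N%:R *: (diff Pm j *m ofC Pm n L j).
  by rewrite -dVE -[LHS]/(ofC Pm n L j.+1 *m (D1 j *m ofC Pm n L j)) [LHS]mulmxA EC scalemxAl.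
have ofL_dV j : ofL Pm n L j.+1 *m dV j =
    (j == n)%:R *: (iota *m idfam Pm n j *m ofC Pm n L j).
  by rewrite -dVE -[LHS]/(ofL Pm n L j.+1 *m (D1 j *m ofC Pm n L j)) [LHS]mulmxA EL -scalemxAl.
exists f; split=> //; split=> j r.
  move=> b a bc; rewrite dVE => E.
  have bq : cyc (b *m q j) by apply: cyc_map.
  have baug : b *m q j *m augfam (aug P) j = 0.
    have [le|gt] := leqP j n; last first.
      by case: (j) gt (b *m q j) => // j' _ c; rewrite mulmx0.
    rewrite -mulmxA -phi_aug mulmxA -f_toC // mulmxA E -[a *m _ *m _]mulmxA d_toC //.
    by rewrite -mulmxA mulmxDl -!mulmxA diff_augfam [iota *m _]mulmxA iota_augi !mulmx0 addr0 mulmx0.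
  have [p Ep] := res_cyc bq baug.
  apply: (B_exact bc Ep).
  have [ej|ne] := eqVneq j n; last by rewrite rb_ne ?y_ne ?mulmx0 // eqSS.
  subst j.
  have Eb : b *m phi n = a *m toL Pm n L n.+1 *m iota.
    rewrite -f_toC // mulmxA E -[LHS]mulmxA d_toC // toC0 // mul0mx add0r.
    by rewrite idfam_id mulmx1 mulmxA.
  have : (p *m (theta n.+1 *m to_omega Pm n) - b *m w) *m io = a *m toL Pm n L n.+1 *m iL *m io.
    rewrite -[RHS]mulmxA -iotaE -Eb phiE Wn mulmxBl mulmxBr; congr (_ - _).
      by rewrite -!mulmxA io_to thC.2 !mulmxA Ep.
    by rewrite [RHS]mulmxA.
  move=> /(row_free_inj io_free) /=.
  move=> /(congr1 (fun X => X *m zh)); rewrite mulmxBl -[_ *m iL *m _]mulmxA iL0 mulmx0.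
  move/eqP; rewrite subr_eq0 -[b *m w *m zh]mulmxA wzh => /eqP E2.
  have -> : rb n = r' + q n *m g by rewrite subrK.
  rewrite mulmxDr -E2 [b *m (q n *m g)]mulmxA Ep -[p *m _ *m g]mulmxA -yz mulmxBr.
  by rewrite !mulmxA addrC subrK.
move=> a ac.
have [le|gt] := leqP j n; last first.
  have [a' Ea] := splice_exact iota_free gt ac.
  exists 0, a'; rewrite mul0mx add0r; split=> //.
  by case: (j) => // j' /=; rewrite mul0mx.
have a_ofC : a = a *m toC Pm n L j *m ofC Pm n L j.
  rewrite -mulmxA -{1}[a]mulmx1 -(splice_id Pm n L j) mulmxDr.
  by rewrite toL0 ?mul0mx ?mulmx0 ?addr0 // ltn_eqF.
pose x := a *m toC Pm n L j.
have xc : cyc x.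
  rewrite /x; case: j a ac le {a_ofC x} => // j a ac le.
  have {}ac : a *m dV j = 0 by rewrite -dVE; exact: ac.
  have := congr1 (fun X => X *m toC Pm n L j) ac; rewrite mul0mx.
  rewrite -[LHS]mulmxA d_toC; last exact: ltnW.
  by rewrite toL0 ?ltn_eqF // !mul0mx addr0 mulmxA.
have [e0 e0E] := B_aug; have [kap [kapc kapq kapr]] := B_class.
pose b1 := x *m augfam (aug Pm) j *m e0 *m idfam B 0 j.
have b1c : cyc b1.
  by rewrite /b1; case: (j) (x) => //= j' x'; rewrite idfam0 // mulmx0 mul0mx.
have b1q : b1 *m q j *m augfam (aug P) j = x *m augfam (aug Pm) j.
  rewrite /b1; case: (j) (x) => [|j'] x' /=; last by rewrite !mulmx0.
  by rewrite idfam_id mulmx1 -!mulmxA [e0 *m _]mulmxA e0E mulmx1.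
pose x1 := x - b1 *m phi j.
have x1aug : x1 *m augfam (aug Pm) j = 0.
  by rewrite mulmxBl -[X in _ - X]mulmxA phi_aug [X in _ - X]mulmxA b1q subrr.
have x1c : cyc x1 by apply: cyc_sub => //; apply: phi_cyc.
have f_low : Lam j = 0 -> f j = phi j *m ofC Pm n L j.
  by move=> e; rewrite /f e mul0mx addr0.
have f_lowj : f j = phi j *m ofC Pm n L j.
  by apply: f_low; apply: Lam0; rewrite ltn_eqF.
move: le; rewrite leq_eqVlt => /orP[/eqP ej|lt]; last first.
  have [v Ev] := res_cyc x1c x1aug.
  exists b1, (v *m ofC Pm n L j.+1); split=> //.
  rewrite dVE -[v *m _ *m _]mulmxA ofC_dV lt scale1r f_lowj !mulmxA -mulmxDl -Ev.
  by rewrite /x1 addrC subrK.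
subst j.
have [v Ev] := io_P _ _ x1c x1aug.
(* The multiple of the generator that moves [v] into [L]. *)
pose t : 'M_(r, 1) := - (v *m zh).
have : (v + t *m kap *m w) *m zh = 0.
  rewrite mulmxDl -[_ *m w *m zh]mulmxA wzh mulmxBr -!mulmxA kapr.
  by rewrite [kap *m (q n *m _)]mulmxA kapq mul0mx mulmx0 subr0 mulmx1 addrN.
move=> /iL_P[l El].
exists (b1 + t *m kap), (l *m ofL Pm n L n.+1); split.
  by apply: cyc_add => //; apply: cyc_mul.
rewrite dVE -[l *m _ *m _]mulmxA ofL_dV eqxx scale1r idfam_id mulmx1 f_lowj.
rewrite !mulmxA -mulmxDl {1}a_ofC; congr (_ *m _).
rewrite -/x -(subrK (b1 *m phi n) x) -/x1 Ev [X in l *m X]iotaE [l *m _]mulmxA -El.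
rewrite mulmxDl phiE Wn !mulmxBr !mulmxDl !mulmxA.
rewrite -[t *m kap *m q n]mulmxA kapq. rewrite mulmx0 mul0mx.
by mx_abel.
Qed.
End Comparison.

(** * From a left counit to a two-sided one *)

Section TwoSided.
Context {k : fieldType} {gT : finGroupType} {G : {group gT}}.
Variables (B : complex k G) (e : 'M[k]_(mdim (B 0%N), 1)).
Hypothesis eH : is_hom (M := B 0%N) (N := triv_mod) e.
Hypothesis de : diff B 0 *m e = 0.

Lemma diff_augfam_eq0 t : diff B t *m augfam e t = 0.
Proof. by case: t => [|t]; [apply: de | apply: mulmx0]. Qed.

Lemma tin_id_tens_aug i s t : (s + t)%N = i ->
  tin B B i s t *m id_tens_aug B e i = tensf (idfam B s i) (augfam e t).
Proof. exact: (@tin_case _ _ _ B B i s t _ (fun s t => tensf (idfam B s i) (augfam e t))). Qed.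

Lemma tin_aug_tens_id i s t : (s + t)%N = i ->
  tin B B i s t *m aug_tens_id B e i = ftens (augfam e s) (idfam B t i).
Proof. exact: (@tin_case _ _ _ B B i s t _ (fun s t => ftens (augfam e s) (idfam B t i))). Qed.

Lemma augfam_hom j : is_hom (M := B j) (N := triv_mod) (augfam e j).
Proof. by case: j => [|j]; [apply: eH | apply: hom0]. Qed.

Lemma id_tens_aug_chain : chain_map (id_tens_aug B e : gmap (tens B B) B).
Proof.
split=> i.
  apply: (@tens_hom _ _ _ B B) => s t sti; rewrite tin_id_tens_aug // -flipmx_ftens.
  have fH := @hom_flip _ _ _ (B s) (B t).
  exact: hom_mul fH (hom_ftens (augfam_hom t) (idfam_hom B s i)).
apply: tens_ext => s t sti; rewrite mulmxA tin_id_tens_aug // tensf_mul.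
rewrite [RHS]mulmxA tin_diff // mulmxDl -scalemxAl.
rewrite (_ : tdiffr B B i s t *m _ = 0) ?scaler0 ?addr0; last first.
  case: t sti => [|t] sti; first by rewrite mul0mx.
  rewrite -mulmxA tin_id_tens_aug; last by move: sti; rewrite addnS => -[].
  by rewrite tens_tensf diff_augfam_eq0 tensf0r.
case: s sti => [|s] sti; first by rewrite idfam0 // !mul0mx tensf0l.
rewrite -mulmxA tin_id_tens_aug; last by case: sti.
by rewrite tens_tensf mul1mx idfam_diff.
Qed.

Variables (Delta : gmap B (tens B B)).
Hypothesis DC : chain_map Delta.
Hypothesis Dl : homotopic (gcomp Delta (aug_tens_id B e)) (gid B).

Let phi := gsub (gcomp Delta (id_tens_aug B e)) (gid B).

Let phiC : chain_map phi.
Proof.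
by apply: chain_sub (chain_id B); apply: chain_comp DC id_tens_aug_chain.
Qed.

(** Both counits of [Delta] have the same composite with [e], and maps from [B] to a
    module in degree [0] are homotopic only if they are equal. *)
Let phi_e : phi 0%N *m e = 0.
Proof.
rewrite /phi /gsub /gcomp mulmxBl -mulmxA.
have -> : id_tens_aug B e 0%N *m e = aug_tens_id B e 0%N *m e.
  apply: tens_ext => s t sti; rewrite [LHS]mulmxA [RHS]mulmxA.
  rewrite tin_id_tens_aug // tin_aug_tens_id //.
  have [-> ->] : s = 0%N /\ t = 0%N by case: s t sti => [|s] [].
  rewrite !idfam_id ftens_mul tensf_mul !mul1mx /=.
  apply/matrixP => a b; case: (mxtens_indexP a) => a1 a2.
  by rewrite ftensE tensfE [b]ord1.
have [h [_ h0 _]] := Dl.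
by move: h0; rewrite /gcomp mulmxA -mulmxBl => ->; rewrite -mulmxA de mulmx0.
Qed.

(** The endomorphism [x (x) y |-> +- phi y (x) x] of [B (x) B]. *)
Let flip_phi : gmap (tens B B) (tens B B) := fun i => tcase (C := B) (D := B) i
  (fun s t => (-1) ^+ (s * t) *:
     (flipmx k (mdim (B s)) (mdim (B t)) *m ((phi t *t 1%:M) *m tin B B i t s))).

Let tin_flip_phi i s t : (s + t)%N = i -> tin B B i s t *m flip_phi i =
  (-1) ^+ (s * t) *:
     (flipmx k (mdim (B s)) (mdim (B t)) *m ((phi t *t 1%:M) *m tin B B i t s)).
Proof. by move=> sti; rewrite tin_case. Qed.

Let flip_phi_chain : chain_map flip_phi.
Proof.
split=> i.
  apply: tcase_hom => s t _.
  have fH := @hom_flip _ _ _ (B s) (B t).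
  have pH : is_hom (M := tens_mod (B t) (B s)) (N := tens_mod (B t) (B s)) (phi t *t 1%:M).
    by apply: hom_tens; [apply: phiC.1 | apply: hom1].
  apply: (@hom_scale _ _ _ (tens_mod (B s) (B t))).
  exact: hom_mul fH (hom_mul pH (tin_hom B B i t s)).
apply: tens_ext => s t sti; rewrite mulmxA tin_flip_phi //.
have tsi : (t + s)%N = i.+1 by rewrite addnC.
rewrite -scalemxAl -!mulmxA tin_diff // [RHS]mulmxA tin_diff // mulmxDl.
rewrite !mulmxDr scalerDr addrC -!scalemxAr scalerA -scalemxAl; congr (_ + _).
  case: s sti tsi => [|s] sti tsi.
    by rewrite /= mul0mx !mulmx0 scaler0.
  rewrite -[RHS]mulmxA tin_flip_phi; last by case: sti.
  rewrite -scalemxAr; congr (_ *: _).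
    by rewrite mulSn exprD mulrAC -expr2 sqrr_sign mul1r.
  rewrite [RHS]mulmxA tens_flipmx -mulmxA; congr (_ *m _).
  by rewrite !mulmxA !tensmx_mul !mul1mx !mulmx1.
case: t sti tsi => [|t] sti tsi.
  by rewrite /= mul0mx !mulmx0 !scaler0.
rewrite [X in _ = _ *: X](_ : _ =
  (1%:M *t diff B t) *m (tin B B i s t *m flip_phi i)); last by rewrite [RHS]mulmxA.
rewrite tin_flip_phi; last by move: sti; rewrite addnS => -[].
rewrite -scalemxAr scalerA; congr (_ *: _); first by rewrite mulnS exprD.
rewrite [RHS]mulmxA tens_flipmx -mulmxA; congr (_ *m _).
by rewrite !mulmxA !tensmx_mul phiC.2.
Qed.

Let flip_phi_l i : flip_phi i *m aug_tens_id B e i = 0.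
Proof.
apply: tens_ext => s t sti; rewrite mulmxA tin_flip_phi // mulmx0.
rewrite -scalemxAl -!mulmxA tin_aug_tens_id 1?addnC // tens_ftens.
case: t sti => [|t] sti /=; last by rewrite mulmx0 ftens0l mulmx0 scaler0.
by rewrite phi_e ftens0l mulmx0 scaler0.
Qed.

Let flip_phi_r i : flip_phi i *m id_tens_aug B e i = aug_tens_id B e i *m phi i.
Proof.
apply: tens_ext => s t sti; rewrite mulmxA tin_flip_phi // [RHS]mulmxA.
rewrite tin_aug_tens_id // ftens_mul.
rewrite -scalemxAl -!mulmxA tin_id_tens_aug 1?addnC // tens_tensf mul1mx flipmx_tensf.
case: s sti => [|s] sti; last by rewrite !ftens0l scaler0.
rewrite mul0n expr0 scale1r -sti add0n.
by rewrite idfam_id mulmx1 mul1mx.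
Qed.

(** The correction term has left counit zero because [phi] followed by [e] is zero, and
    right counit [(e (x) 1) Delta] followed by [phi], that is [phi] up to homotopy. *)
Lemma two_sided_counit : exists Delta' : gmap B (tens B B),
  [/\ chain_map Delta', homotopic (gcomp Delta' (id_tens_aug B e)) (gid B)
    & homotopic (gcomp Delta' (aug_tens_id B e)) (gid B)].
Proof.
exists (gsub Delta (gcomp Delta flip_phi)); split.
- by apply: chain_sub => //; apply: chain_comp.
- have H := homotopic_sub (homotopic_eq (fun i => erefl (gcomp Delta (id_tens_aug B e) i)))
    (homotopic_compr phiC Dl).
  apply: homotopic_trans (homotopic_trans H _); apply: homotopic_eq => i.
    by rewrite /gsub /gcomp mulmxBl -!mulmxA flip_phi_r.
  by rewrite /gsub {2}/gcomp /gid mul1mx /phi /gsub /gid opprB addrCA subrr addr0.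
- apply: homotopic_trans Dl; apply: homotopic_eq => i.
  by rewrite /gsub /gcomp mulmxBl -!mulmxA flip_phi_l mulmx0 subr0.
Qed.
End TwoSided.

(** * Counits and the vanishing of zeta on P(zeta) *)

Section Counit.
Context {k : fieldType} {gT : finGroupType} {G : {group gT}}.
Local Notation kk := (@triv_mod k gT G).
Variables (P : resolution kk) (n : nat) (B : complex k G).
Variables (i : gmap (suspn n P) B) (q : gmap B P) (s : gmap P B).
Variable alpha : gmap P (suspn n.+1 P).
Hypothesis iC : chain_map i.
Hypothesis qC : chain_map q.
Hypothesis i_free : forall j, row_free (i j).
Hypothesis iq : forall j, (kermx (q j) == i j)%MS.
Hypothesis alphaC : chain_map alpha.
Hypothesis sH : forall j, is_hom (s j).
Hypothesis sq : forall j, s j *m q j = 1%:M.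
Hypothesis sd : forall j, s j.+1 *m diff B j =
  diff P j *m s j + (alpha j.+1 : 'M_(mdim (P j.+1), mdim (suspn n P j))) *m i j.

Local Notation y := (ext_cocycle alpha).
Local Notation e := (q 0%N *m aug P).
Local Notation qB := (tmap q (gid B)).

Lemma counitE j : qB j *m eps P B j = aug_tens_id B e j.
Proof.
apply: (etrans (@tmap_cmap _ _ _ B P 0 q (raug P 0) B j)).
apply: (@cmap_ext _ _ _ B 0 _ (augfam e) B j) => t.
by rewrite raug0; case: t => //= t; rewrite mulmx0.
Qed.

Let hB j : higman (B j) := ext_higman iC qC i_free iq sH sq j.
Let yC : chain_map (cmap n.+1 y B).
Proof. by apply: cmap_chain; [apply: ext_cocycle_hom | apply: ext_cocycle_diff]. Qed.
Let qBC : chain_map qB.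
Proof. exact: tmap_chain qC (chain_id B). Qed.

(** The composite [sigma] of [Delta] with [B (x) B -> P (x) B] is a homotopy inverse of
    [eps]; since the pullback of [y] to [B] is a coboundary, [y (x) B] vanishes on
    [sigma], hence vanishes. *)
Lemma counit_kills (Delta : gmap B (tens B B)) :
  chain_map Delta -> homotopic (gcomp Delta (aug_tens_id B e)) (gid B) ->
  kills n.+1 y B.
Proof.
move=> DC De; pose sigma := gcomp Delta qB.
have sC : chain_map sigma by apply: chain_comp.
have eC := eps_chain P B.
have se : homotopic (gcomp sigma (eps P B)) (gid B).
  apply: homotopic_trans De; apply: homotopic_eq => j.
  by rewrite /gcomp -mulmxA counitE.
have es : homotopic (gcomp (eps P B) sigma) (gid (tens P B)).
  apply: (qis_homotopic (tens_res_higman P B) eC (@eps_qis _ _ _ P B)).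
  - exact: chain_comp.
  - exact: chain_id.
  apply: homotopic_trans (_ : homotopic _ (gcomp (eps P B) (gid B))) _.
    apply: homotopic_trans (homotopic_compl eC se).
    by apply: homotopic_eq => j; rewrite /gcomp -mulmxA.
  by apply: homotopic_eq => j; rewrite /gcomp /gid mul1mx mulmx1.
have sy : homotopic (gcomp sigma (cmap n.+1 y B)) (gzero B (suspn n.+1 B)).
  apply: homotopic_trans (_ : homotopic (gcomp Delta
      (cmap n.+1 (cobound (ext_primitive i q s)) B)) _).
    apply: homotopic_eq => j; rewrite /gcomp -mulmxA tmap_cmap; congr (_ *m _).
    by apply: cmap_ext => t; rewrite (cobound_ext_primitive iC i_free iq sq sd).
  have rH := ext_primitive_hom iC qC i_free iq sH sq.
  apply: homotopic_trans (homotopic_compl DC (cmap_null n B rH)) _.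
  by apply: homotopic_eq => j; rewrite /gcomp /gzero mulmx0.
apply: homotopic_trans (_ : homotopic (gcomp (gcomp (eps P B) sigma) (cmap n.+1 y B)) _).
  apply: homotopic_trans (homotopic_compr yC (homotopic_sym es)).
  by apply: homotopic_eq => j; rewrite /gcomp /gid mul1mx.
apply: homotopic_trans (_ : homotopic (gcomp (eps P B) (gzero B _)) _).
  apply: homotopic_trans (homotopic_compl eC sy).
  by apply: homotopic_eq => j; rewrite /gcomp -mulmxA.
by apply: homotopic_eq => j; rewrite /gcomp /gzero mulmx0.
Qed.

Local Notation SB := (tens (suspn n.+1 P) B).
Local Notation alphaB := (tmap alpha (gid B)).

(** The map [i (x) B], of degree [-1] on the suspension. *)
Let iB j : 'M[k]_(mdim (SB j.+1), mdim (tens B B j)) :=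
  tcase (C := suspn n.+1 P) (D := B) j.+1 (fun a b =>
    match a return 'M_(mdim (suspn n.+1 P a) * mdim (B b), _) with
    | 0 => 0
    | a'.+1 => (i a' *t 1%:M) *m tin B B j a' b
    end).

Let iB_hom j : is_hom (M := SB j.+1) (N := tens B B j) (iB j).
Proof.
apply: tcase_hom => - [|a] b _; first exact: hom0.
have tH : is_hom (M := tens_mod (suspn n P a) (B b)) (N := tens_mod (B a) (B b)) (i a *t 1%:M).
  by apply: hom_tens; [apply: iC.1 | apply: hom1].
exact: hom_mul tH (tin_hom B B j a b).
Qed.

Let iB_diff j : iB j.+1 *m diff (tens B B) j = - (diff SB j.+1 *m iB j).
Proof.
apply: tens_ext => a b ab; rewrite mulmxN mulmxA tin_case // [X in - X]mulmxA tin_diff //.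
case: a ab => [|a] ab.
  rewrite !mul0mx mulmxDl mul0mx add0r expr0 scale1r.
  case: b ab => [|b] ab; first by rewrite mul0mx oppr0.
  by rewrite -mulmxA tin_case /= ?mulmx0 ?oppr0 //; lia.
have ab' : (a + b)%N = j.+1 by case: ab.
rewrite -mulmxA tin_diff // mulmxDr mulmxDl opprD; congr (_ + _).
  case: a ab ab' => [|a] ab ab'.
    rewrite [tdiffl B B j 0 b]/= mulmx0 -[X in - X]mulmxA tin_case //.
    by rewrite /= mulmx0 oppr0.
  rewrite -[X in - X]mulmxA tin_case; last by case: ab.
  rewrite -[diff (suspn n.+1 P) a.+1]/(- diff (suspn n P) a) tensNl mulNmx opprK.
  by rewrite !mulmxA !tensmx_mul iC.2.
rewrite -scalemxAr -scalemxAl -scaleNr exprS mulN1r opprK; congr (_ *: _).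
case: b ab ab' => [|b] ab ab'; first by rewrite mul0mx mulmx0.
rewrite -[RHS]mulmxA tin_case; last by lia.
by rewrite !mulmxA !tensmx_mul !mul1mx !mulmx1.
Qed.

(** If [y (x) B] is null-homotopic then so is [alpha (x) B], by cancelling the
    augmentation of [Sigma^N P]; the null-homotopy [H] corrects the graded section
    [s (x) B] to a chain map [xi]. *)
Lemma kills_counit : kills n.+1 y B -> exists Delta : gmap B (tens B B),
  chain_map Delta /\ homotopic (gcomp Delta (aug_tens_id B e)) (gid B).
Proof.
move=> kB.
have aBC : chain_map alphaB := tmap_chain alphaC (chain_id B).
have [H [HH _ HS]] : homotopic alphaB (gzero (tens P B) SB).
  apply: (qis_null (tens_res_higman P B) (raug_tens_chain P n.+1 B) (raug_tens_qis P n.+1 B) aBC).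
  by apply: homotopic_trans kB; apply: homotopic_eq => j; rewrite /gcomp tmap_cmap.
pose sB := tmap s (gid B).
have sB_diff j : sB j.+1 *m diff (tens B B) j =
    diff (tens P B) j *m sB j + alphaB j.+1 *m iB j.
  apply: tens_ext => a b ab; rewrite [LHS]mulmxA tin_tmap // -[LHS]mulmxA tin_diff //.
  rewrite [RHS]mulmxDr [X in _ = X + _]mulmxA tin_diff //.
  rewrite [X in _ = _ + X]mulmxA tin_tmap // mulmxDr mulmxDl.
  have -> : (-1) ^+ a *: tdiffr P B j a b *m sB j =
    (s a *t gid B b) *m ((-1) ^+ a *: tdiffr B B j a b).
    rewrite -scalemxAl -scalemxAr; congr (_ *: _).
    case: b ab => [|b] ab; first by rewrite mul0mx mulmx0.
    rewrite -mulmxA tin_tmap; last by move: ab; rewrite addnS => -[].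
    by rewrite !mulmxA !tensmx_mul !mul1mx !mulmx1.
  rewrite addrAC; congr (_ + _); rewrite -[X in _ + X]mulmxA tin_case //.
  case: a ab => [|a] ab; first by rewrite !mulmx0 mul0mx addr0.
  rewrite -[X in X + _]mulmxA tin_tmap; last by case: ab.
  rewrite !mulmxA !tensmx_mul -mulmxDl; congr (_ *m _).
  by rewrite sd tensDl /gid !mulmx1.
pose xi j := sB j + H j *m iB j.
have xiC : chain_map (xi : gmap (tens P B) (tens B B)).
  split=> j.
    apply: hom_add; last exact: hom_mul (HH j) (iB_hom j).
    by apply: tmap_hom => // t; apply: hom1.
  have Ea : alphaB j.+1 = H j.+1 *m diff SB j.+1 + diff (tens P B) j *m H j.
    by rewrite -HS /gzero subr0.
  rewrite /xi mulmxDl mulmxDr sB_diff -[X in _ + X = _]mulmxA iB_diff mulmxN Ea mulmxDl.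
  by rewrite !mulmxA -addrA; congr (_ + _); rewrite addrAC subrr add0r.
have xiq j : xi j *m qB j = 1%:M.
  apply: tens_ext => a b ab; rewrite /xi mulmxDl.
  rewrite -[H j *m _ *m _]mulmxA (_ : iB j *m qB j = 0) ?mulmx0 ?addr0.
    rewrite mulmxA tin_tmap // -mulmxA tin_tmap // mulmxA tensmx_mul sq /gid.
    by rewrite [RHS]mulmx1 mulmx1 tens11 mul1mx.
  apply: tens_ext => {ab}a {}b ab; rewrite mulmxA tin_case // mulmx0.
  case: a ab => [|a] ab; first by rewrite mul0mx.
  rewrite -mulmxA tin_tmap; last by case: ab.
  by rewrite mulmxA tensmx_mul (i_q iq) tens0mx mul0mx.
have [sigma [sC se _]] := eps_inverse P hB.
exists (gcomp sigma xi); split; first exact: chain_comp.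
apply: homotopic_trans se; apply: homotopic_eq => j.
by rewrite /gcomp -counitE -mulmxA [xi j *m _]mulmxA xiq mul1mx.
Qed.
End Counit.

(** * Productivity *)

Section Productive.
Context {k : fieldType} {gT : finGroupType} {G : {group gT}}.
Local Notation kk := (@triv_mod k gT G).

Lemma coboundary_at (Q : complex k G) (N : kGmod k G) i j
    (h : 'M_(mdim (Q i), mdim N)) (u : 'M_(mdim (Q j), mdim N)) :
  i = j.+1 -> is_hom u -> h = dfam Q i j *m u -> coboundary h.
Proof. by move=> e uH ->; move: h; rewrite e => _; exists u; rewrite ?dfamE. Qed.

(** In degree [m = 0] the augmentation represents the identity of [L], whose product with
    the class of [z (x) L] is that class.  Conversely, a Yoneda product with a coboundary
    is a coboundary. *)
Lemma annihilates_ExtP (Pm : resolution kk) n (z : 'M_(mdim (Pm n.+1), mdim kk)) L :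
  annihilates_Ext z L <-> coboundary (N := L) (tensm_map L z).
Proof.
split=> [ann|[u uH Eu]].
  apply: (ann 0%N (tensm_map L (aug Pm)) (tensm_map L z)).
    split; first exact: hom_ftens (aug_hom Pm) (hom1 L).
    by rewrite /= /tensm_diff [LHS]tens_ftens diff_aug ftens0l.
  exists (gid _); split; first exact: chain_id.
  - by rewrite /= idfam_id !mul1mx.
  - by rewrite /= idfam_id !mul1mx.
move=> m f h _ [F [[FH Fd] _ <-]].
apply: (@coboundary_at (tensm Pm L) L _ (m + n) _
  ((-1) ^+ m *: (F (m + n)%N *m unsusp m (tensm Pm L) (m + n) n *m u))).
- by rewrite addnS.
- apply: hom_scale; apply: hom_mul uH; exact: hom_mul (FH _) (unsusp_hom _ _ _ _).
rewrite Eu.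
have E i j : i = j.+1 -> F i *m unsusp m (tensm Pm L) i n.+1 *m diff (tensm Pm L) n =
    (-1) ^+ m *: (dfam (tensm Pm L) i j *m (F j *m unsusp m (tensm Pm L) j n)).
  move=> ->; rewrite dfamE mulmxA -Fd -!mulmxA unsusp_diff -!scalemxAr scalerA.
  by rewrite -expr2 sqrr_sign scale1r.
by rewrite mulmxA (E _ (m + n)%N) ?addnS // -scalemxAl -scalemxAr !mulmxA.
Qed.

Lemma tensm_coboundary (C C' : complex k G) (f : gmap C C') n
    (z : 'M_(mdim (C n.+1), mdim kk)) (z' : 'M_(mdim (C' n.+1), mdim kk)) L :
  chain_map f -> coboundary (N := kk) (z - f n.+1 *m z') ->
  coboundary (N := L) (tensm_map L z') -> coboundary (N := L) (tensm_map L z).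
Proof.
move=> [fH fd] [g gH Eg] [h hH Eh].
exists ((f n *t 1%:M) *m h + ftens g 1%:M).
  apply: hom_add; last exact: hom_ftens gH (hom1 L).
  have tH : is_hom (M := tens_mod (C n) L) (N := tens_mod (C' n) L) (f n *t 1%:M).
    by apply: hom_tens; [apply: fH | apply: hom1].
  exact: hom_mul tH hH.
have -> : z = f n.+1 *m z' + diff C n *m g by rewrite -Eg addrC subrK.
transitivity ((f n.+1 *t (1%:M : 'M_(mdim L))) *m tensm_map L z' +
   tensm_diff C L n *m ftens g (1%:M : 'M_(mdim L))).
  apply: (etrans (ftensDl _ _ _)); congr (_ + _); apply/esym.
    by apply: (etrans (tens_ftens _ _ _ _)); rewrite mulmx1.
  by apply: (etrans (tens_ftens _ _ _ _)); rewrite mulmx1.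
rewrite Eh [RHS]mulmxDr [X in X + _ = _]mulmxA [X in _ = X + _]mulmxA /= /tensm_diff.
by rewrite !tensmx_mul fd.
Qed.

Definition conc_obj i := if i is 0 then kk else zero_mod.
Lemma conc_diff_hom i : is_hom (0 : 'M[k]_(mdim (conc_obj i.+1), mdim (conc_obj i))).
Proof. exact: hom0. Qed.
Lemma conc_diffK i : (0 : 'M[k]_(mdim (conc_obj i.+2), mdim (conc_obj i.+1))) *m
  (0 : 'M[k]_(mdim (conc_obj i.+1), mdim (conc_obj i))) = 0.
Proof. exact: mulmx0. Qed.
Definition conc := Complex conc_diff_hom conc_diffK.

Definition conc_aug (P : resolution kk) : gmap P conc := fun i =>
  match i return 'M_(mdim (P i), mdim (conc i)) with 0 => aug P | _ => 0 end.

Lemma conc_aug_chain P : chain_map (conc_aug P).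
Proof.
split=> [[|i]|[|i]] /=; rewrite ?mulmx0 ?diff_aug //; [exact: aug_hom | exact: hom0].
Qed.

Lemma conc_aug_qis P : qis (conc_aug P).
Proof.
split=> i r.
  move=> b a bc; rewrite mulmx0 => E; apply: res_cyc => //.
  by case: i b a bc E => [|i] b a bc E //=; rewrite mulmx0.
case: i => [|i] a ac /=.
  have /row_fullP[e eE] := aug_full P.
  by exists (a *m e), 0; rewrite mul0mx addr0 -mulmxA eE mulmx1.
exists 0, 0; rewrite /= mul0mx; split=> //; exact: no_cols.
Qed.

(** Resolutions of [kk] are quasi-isomorphic to [conc], so that comparison maps between
    them are unique up to homotopy. *)
Lemma comparison_inverse (P Pm : resolution kk) (theta : gmap P Pm) :
  chain_map theta -> theta 0%N *m aug Pm = aug P ->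
  exists2 theta' : gmap Pm P, chain_map theta' & homotopic (gcomp theta' theta) (gid Pm).
Proof.
move=> tC ta.
have [t' t'C t'a] := qis_lift (@res_higman _ _ _ Pm) (conc_aug_chain P) (conc_aug_qis P) (conc_aug_chain Pm).
exists t' => //.
apply: (qis_homotopic (@res_higman _ _ _ Pm) (conc_aug_chain Pm) (conc_aug_qis Pm)).
- exact: chain_comp.
- exact: chain_id.
apply: homotopic_trans (_ : homotopic (gcomp t' (conc_aug P)) _).
  apply: homotopic_eq => -[|i]; rewrite /gcomp -mulmxA /= ?ta //.
  by rewrite !mulmx0.
apply: homotopic_trans t'a _; apply: homotopic_eq => i.
by rewrite /gcomp /gid mul1mx.
Qed.

Lemma coboundary_inverse (P Pm : resolution kk) (theta : gmap P Pm) (theta' : gmap Pm P) n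
    (y : 'M_(mdim (P n.+1), mdim kk)) (z : 'M_(mdim (Pm n.+1), mdim kk)) :
  chain_map theta' -> homotopic (gcomp theta' theta) (gid Pm) -> cocycle z ->
  coboundary (N := kk) (y - theta n.+1 *m z) ->
  coboundary (N := kk) (z - theta' n.+1 *m y).
Proof.
move=> [tH td] [K [KH _ KS]] [zH dz] [g gH Eg].
exists (- (K n *m z) - theta' n *m g).
  apply: hom_sub; last exact: hom_mul (tH n) gH.
  by apply: hom_opp; apply: hom_mul (KH n) zH.
have -> : y = theta n.+1 *m z + diff P n *m g by rewrite -Eg addrC subrK.
have := congr1 (fun X => X *m z) (KS n).
rewrite /gcomp /gid mulmxBl mulmxDl -[K n.+1 *m _ *m _]mulmxA dz mulmx0 add0r mul1mx => E.
rewrite mulmxBr mulmxN [diff Pm n *m (K n *m z)]mulmxA -E mulmxDr opprB opprD addrA.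
by rewrite [theta' n.+1 *m (diff P n *m g)]mulmxA td -!mulmxA.
Qed.

(** [to_omega] is a split surjection of vector spaces, with kernel the boundaries, on which
    the cocycle [z] vanishes. *)
Lemma omega_factor (Pm : resolution kk) n (z : 'M_(mdim (Pm n.+1), mdim kk)) :
  cocycle z -> exists2 zh : 'M_(mdim (omega Pm n), mdim kk),
    is_hom zh & to_omega Pm n *m zh = z.
Proof.
move=> [zH dz]; have [io [ioH io_free io_cyc io_aug [io_to io_P]]] := omega_in Pm n.
have toH : is_hom (M := Pm n.+1) (N := omega Pm n) (to_omega Pm n).
  by apply: (hom_cancel_free io_free ioH); rewrite io_to; apply: diff_hom.
have [u Eu] := res_cyc io_cyc io_aug.
have uto : u *m to_omega Pm n = 1%:M.
  by apply: (row_free_inj io_free); rewrite mul1mx /= -mulmxA io_to -Eu.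
have E : to_omega Pm n *m (u *m z) = z.
  apply/eqP; rewrite -subr_eq0 mulmxA -[X in _ - X]mul1mx -mulmxBl.
  have : (to_omega Pm n *m u - 1%:M) *m diff Pm n = 0.
    by rewrite mulmxBl mul1mx -mulmxA -[X in _ *m (_ *m X)]io_to [u *m _]mulmxA uto mul1mx io_to subrr.
  by move=> /(@res_cyc _ _ _ Pm n.+1 _ _)[|v ->]; rewrite ?mulmx0 // -mulmxA dz mulmx0.
exists (u *m z) => //.
apply: (hom_cancel_full _ toH); last by rewrite E.
by apply/row_fullP; exists u.
Qed.

End Productive.

Theorem theorem1p2 (k : fieldType) (p : nat) (charkp : p \in [pchar k])
    (gT : finGroupType) (G : {group gT})
    (Pm : resolution (@triv_mod k gT G)) (Pm_min : minimal Pm)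
    (n : nat) (z : 'M[k]_(mdim (Pm n.+1), mdim (@triv_mod k gT G)))
    (z_cocycle : cocycle z) (z_neq0 : ~ coboundary z)
    (P : resolution (@triv_mod k gT G))
    (B : complex k G) (i : gmap (suspn n P) B) (q : gmap B P)
    (B_Pzeta : is_Pzeta z i q) :
  productive z <->
  exists Delta : gmap B (tens B B),
    [/\ chain_map Delta,
        homotopic (gcomp Delta (id_tens_aug B (q 0%N *m aug P))) (gid B)
      & homotopic (gcomp Delta (aug_tens_id B (q 0%N *m aug P))) (gid B)].
Proof.
case: B_Pzeta => -[iC qC ex] [alpha [alphaC [s [sHq sd]] [theta [thC th_aug cob]]]].
have i_free j : row_free (i j) by case: (ex j).
have iq j : (kermx (q j) == i j)%MS by case: (ex j).
have sH j : is_hom (s j) by case: (sHq j).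
have sq j : s j *m q j = 1%:M by case: (sHq j).
pose y := ext_cocycle alpha.
have yE : cocycle_of alpha = y n.+1 by rewrite /cocycle_of -mulmxA.
rewrite yE in cob.
have yH : cochain_hom y := ext_cocycle_hom alphaC.
have dy j : diff P j *m y j = 0 := ext_cocycle_diff alphaC j.
have key zh (zhH : is_hom zh) : to_omega Pm n *m zh = z ->
    kills n.+1 y B <-> coboundary (N := ker_mod zhH) (tensm_map (ker_mod zhH) z).
  move=> zhz; have zh_neq0 : zh != 0.
    apply/eqP => zh0; apply: z_neq0; exists 0; first exact: hom0.
    by rewrite -zhz zh0 !mulmx0.
  case: (cob) => g gH Eg; rewrite -zhz in Eg.
  have rb_ne j : j != n -> ext_primitive i q s j = 0.
    by move=> jn; rewrite /ext_primitive raug_ne ?mulmx0.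
  have y_ne j : j != n.+1 -> y j = 0.
    by move=> jn; rewrite /y /ext_cocycle raug_ne ?mulmx0.
  have [iota [iotaH [iota_cyc [f [iota_free fC fQ]]]]] :=
    comparison qC (ext_higman iC qC i_free iq sH sq)
      (ext_primitive_hom iC qC i_free iq sH sq) rb_ne y_ne
      (ext_primitive_diff iC i_free iq sq sd) (@ext_exact _ _ _ P n B i q s alpha iC qC i_free iq sq sd)
      (ext_class iC i_free iq sq) (ext_aug sq) thC th_aug zhH gH Eg zh_neq0.
  have [t' t'C t't] := comparison_inverse thC th_aug.
  have cob' := coboundary_inverse t'C t't z_cocycle cob.
  split=> [kB|cz].
    apply: (tensm_coboundary t'C cob').
    by apply: (kills_splice (res_higman Pm) iota_free); exact: (kills_qis n.+1 yH dy fC fQ).1.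
  apply: (kills_qis n.+1 yH dy fC fQ).2; apply: (splice_kills yH dy (res_higman Pm) _ _ iota_free).
  exact: (tensm_coboundary thC cob).
have eH : is_hom (M := B 0%N) (N := triv_mod) (q 0%N *m aug P).
  exact: hom_mul (qC.1 0%N) (aug_hom P).
have de : diff B 0 *m (q 0%N *m aug P) = 0.
  by rewrite mulmxA -qC.2 -mulmxA diff_aug mulmx0.
split=> [[zh [zhH [zhz /annihilates_ExtP/(key _ zhH zhz) kB]]]|[Delta [DC _ Dl]]].
  have [D0 [D0C D0l]] := kills_counit iC qC i_free iq alphaC sH sq sd kB.
  by have [D [DC Dr Dl]] := two_sided_counit eH de D0C D0l; exists D.
have [zh zhH zhz] := omega_factor z_cocycle.
exists zh, zhH; split=> //; apply/annihilates_ExtP/(key _ zhH zhz).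
exact: (counit_kills iC qC i_free iq alphaC sH sq sd DC Dl).
Qed.
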